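(* Let $\tilde\rho_h$ be a solution of the semidiscrete problem: $\tilde\rho_h=\rho_h-\pi\phi:\mathbb R_+\to W_h$, $\tilde\rho_h(0)=\pi\tilde\rho^0$, and $$(\tilde\rho_{h,t},w_h)+(K(|\nabla\rho_h|)\nabla\rho_h,\nabla w_h)=(\tilde f,w_h)\qquad\forall w_h\in W_h,\ t>0 .$$ Put $\mathfrak g(t)=\|\tilde f(t)\|^{\lambda}+\|\phi(t)\|_1^2$. Then there exists a positive constant $C$ such that for all $t\ge0$ $$\|\nabla\rho_h(t)\|_{0,\beta}^{\beta}\le C\,\mathcal A(t),$$ where $$\mathcal A(t)=1+\|\rho^0\|_1^2+\|\phi^0\|^2+\int_0^te^{-\frac12(t-s)}\Big(\|\phi_t(s)\|_1^2+(\mathrm{Env}\,\mathfrak g(s))^{2/\beta}\Big)ds .$$ Furthermore, $$\limsup_{t\to\infty}\|\nabla\rho_h(t)\|_{0,\beta}^\beta\le C\Big(1+\limsup_{t\to\infty}\|\phi_t(t)\|_1^2+\big(\limsup_{t\to\infty}\mathfrak g(t)\big)^{2/\beta}\Big).$$ If $\limsup_{t\to\infty}\|\tilde f(t)\|=\limsup_{t\to\infty}\|\phi(t)\|_1=\limsup_{t\to\infty}\|\phi_t(t)\|_1=0$, then $\limsup_{t\to\infty}\|\nabla\rho_h(t)\|_{0,\beta}=0$.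
   Context: Setting. $\Omega\subset\mathbb R^d$ ($d\ge2$) is open and bounded with smooth boundary $\Gamma$; $\mathbb R_+=[0,\infty)$. $(\cdot,\cdot)$ and $\|\cdot\|$ are the $L^2(\Omega)$ inner product and norm (for scalar or vector functions), $\|\cdot\|_{m,q}$ is the $W^{m,q}(\Omega)$ norm (so $\|\cdot\|_{0,q}$ is the $L^q(\Omega)$ norm), and $\|\cdot\|_m=\|\cdot\|_{m,2}$. For a function of $(x,t)$, $u(t)=u(\cdot,t)$; subscript $t$ is the time derivative. Nonlinearity. Fix $N\ge1$, reals $0=\alpha_0<\alpha_1<\dots<\alpha_N$, coefficients $a_i\ge0$ with $a_0,a_N>0$, and $g(s)=\sum_{i=0}^N a_is^{\alpha_i}$, $s\ge0$, $\deg g=\alpha_N$. For $\xi\ge0$, $K(\xi)=1/g(s(\xi))$, where $s=s(\xi)\ge0$ is the unique nonnegative solution of $s\,g(s)=\xi$. Set $a=\frac{\alpha_N}{\alpha_N+1}$, $\beta=2-a$, $\lambda=\frac{2-a}{1-a}$. Standing assumption (Degree Condition): $a\le\frac4{d+2}$ (equivalently $\deg g\le\frac4{d-2}$), so that $W^{1,\beta}(\Omega)$ embeds continuously in $L^2(\Omega)$. Data. $f(x,t)$ is a source, $\rho^0(x)$ an initial datum, $\psi$ a Dirichlet datum on $\Gamma\times\mathbb R_+$, and $\phi(x,t)$ an extension of $\psi$ to $\Omega\times\mathbb R_+$. Set $\tilde f=f-\phi_t$, $\phi^0=\phi(\cdot,0)$, $\tilde\rho^0=\rho^0-\phi^0$.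 The data are regular enough that all quantities occurring in the statement are defined, and those required to be continuous in time are. Discretization. $\mathcal T_h$ is a member of a globally quasiuniform family of triangulations of $\Omega$, $h$ its maximal element diameter; $W_h\subset H_0^1(\Omega)$ is the finite element space of continuous piecewise polynomials of degree $r$ over $\mathcal T_h$. $\pi$ is the $L^2$-projection onto $W_h$: $(\pi w,v_h)=(w,v_h)$ for all $v_h\in W_h$. It is assumed to satisfy, with constants $C_0,C_1>0$: $\|\pi w\|_s\le C_0\|w\|_s$ for $w\in H^s(\Omega)$, $s\in\{0,1\}$; and $\|\pi w-w\|_{0,q}\le C_1h^m\|w\|_{m,q}$ for $w\in W^{m,q}(\Omega)$, $0\le m\le r+1$, $1\le q\le\infty$. Envelope. $\mathrm{Env}(F)$ denotes a continuous, increasing function on the interval of definition of $F$ with $\mathrm{Env}(F)(t)\ge F(t)$ for all $t$; $\mathrm{Env}\,\mathfrak g(t)$ is its value at $t$. Constants. $C$ depends only on the exponents and coefficients of $g$, on $d$, $\Omega$ and on the constants $C_0,C_1$ (and quasiuniformity constants); it does not depend on the data, on $t$, or otherwise on $h$. *)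

(* Defs.v *)
From HB Require Import structures.
From mathcomp Require Import all_boot all_order all_algebra.
From mathcomp Require Import all_classical all_reals all_analysis.
From mathcomp Require Import measurable_realfun.
Set Implicit Arguments. Unset Strict Implicit. Unset Printing Implicit Defensive.
Import Order.TTheory GRing.Theory Num.Theory.
Import numFieldNormedType.Exports.
Local Open Scope classical_set_scope.
Local Open Scope ring_scope.

(* Borel sigma-algebra and Lebesgue measure on R^n, for R^n = 'rV[R]_n.       *)
(* The sigma-algebra is the one generated by the coordinates.                 *)
Definition rowvec_display : measure_display.
Proof. exact: default_measure_display. Qed.

Section measurable_rowvec.
Context (R : realType) (n : nat).

Definition rowvec_coord (i : 'I_n) (x : 'rV[R]_n) : R := x ord0 i.

Let rowvec_set0 : g_sigma_preimage rowvec_coord set0.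
Proof. exact: sigma_algebra0. Qed.

Let rowvec_setC A : g_sigma_preimage rowvec_coord A ->
  g_sigma_preimage rowvec_coord (~` A).
Proof. exact: sigma_algebraC. Qed.

Let rowvec_bigcup (F : (set 'rV[R]_n)^nat) :
  (forall i, g_sigma_preimage rowvec_coord (F i)) ->
  g_sigma_preimage rowvec_coord (\bigcup_i (F i)).
Proof. exact: sigma_algebra_bigcup. Qed.

HB.instance Definition _ := @isMeasurable.Build rowvec_display
  'rV[R]_n (g_sigma_preimage rowvec_coord) rowvec_set0 rowvec_setC rowvec_bigcup.
End measurable_rowvec.

Section rowvec_cons.
Context (R : realType) (n : nat).
Definition rowvec_cons (p : R * 'rV[R]_n) : 'rV[R]_n.+1 :=
  \row_i oapp (fun j => p.2 ord0 j) p.1 (unlift ord0 i).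

Lemma measurable_rowvec_coord i :
  measurable_fun setT (@rowvec_coord R n i).
Proof.
move=> _ Y mY; rewrite setTI; apply: sub_sigma_algebra => /=.
rewrite -bigcup_seq/=; exists i => /=; first by rewrite mem_index_enum.
by exists Y => //; rewrite setTI.
Qed.

Lemma measurable_fun_rowvecP d (T : measurableType d) m (f : T -> 'rV[R]_m) :
  (forall i, measurable_fun setT (fun x => f x ord0 i)) ->
  measurable_fun setT f.
Proof.
move=> mf _ A mA.
have -> : setT `&` f @^-1` A = [set x | A (f x)] by rewrite setTI.
suff : g_sigma_preimage (@rowvec_coord R m) `<=` [set B | measurable (f @^-1` B)].
  by move=> /(_ _ mA).
apply: smallest_sub.
  split => /=; first by rewrite preimage_set0.
  - by move=> B mB; rewrite setTD preimage_setC; exact: measurableC.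
  - by move=> F mF; rewrite preimage_bigcup; exact: bigcup_measurable.
rewrite -bigcup_seq; apply: bigcup_sub => i _ B [C mC <-] /=.
rewrite setTI; have := mf i measurableT C mC.
by rewrite setTI.
Qed.

End rowvec_cons.

Section rowvec_measure.
Context (R : realType) (n : nat).

Lemma measurable_rowvec_cons : measurable_fun setT (@rowvec_cons R n).
Proof.
apply: measurable_fun_rowvecP => i.
case: (unliftP ord0 i) => [j ->|->].
  rewrite (_ : (fun _ => _) = @rowvec_coord R n j \o snd).
    apply: measurableT_comp; last exact: measurable_snd.
    exact: measurable_rowvec_coord.
  by apply/funext => x /=; rewrite mxE liftK.
rewrite (_ : (fun _ => _) = fst); first exact: measurable_fst.
by apply/funext => x /=; rewrite mxE unlift_none.
Qed.

Variable mu : {sigma_finite_measure set 'rV[R]_n -> \bar R}.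

Definition rowvec_cons_measure : set 'rV[R]_n.+1 -> \bar R :=
  pushforward (lebesgue_measure \x mu)%E (@rowvec_cons R n).

Let cons_measure0 : rowvec_cons_measure set0 = 0%E.
Proof. by rewrite /rowvec_cons_measure /pushforward preimage_set0 measure0. Qed.

Let cons_measure_ge0 A : (0 <= rowvec_cons_measure A)%E.
Proof. by rewrite /rowvec_cons_measure /pushforward measure_ge0. Qed.

Let cons_measure_sigma_additive : semi_sigma_additive rowvec_cons_measure.
Proof.
move=> F mF tF mUF; rewrite /rowvec_cons_measure /pushforward preimage_bigcup.
apply: measure_semi_sigma_additive.
- by move=> k; rewrite -[X in measurable X]setTI; exact: measurable_rowvec_cons.
- apply/trivIsetP => /= i j _ _ ij; rewrite -preimage_setI.
  by move/trivIsetP : tF => /(_ _ _ _ _ ij) ->//; rewrite preimage_set0.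
- rewrite -preimage_bigcup -[X in measurable X]setTI.
  exact: measurable_rowvec_cons.
Qed.

HB.instance Definition _ := isMeasure.Build _ _ _ rowvec_cons_measure
  cons_measure0 cons_measure_ge0 cons_measure_sigma_additive.

Let cons_measure_sigma_finite : sigma_finite setT rowvec_cons_measure.
Proof.
pose unc (x : 'rV[R]_n.+1) : R * 'rV[R]_n :=
  (x ord0 ord0, \row_j x ord0 (lift ord0 j)).
have uncK : cancel (@rowvec_cons R n) unc.
  case=> a y; rewrite /unc /rowvec_cons mxE unlift_none/=; congr pair.
  by apply/rowP => j; rewrite !mxE liftK.
have munc : measurable_fun setT unc.
  apply: measurable_fun_pair; first exact: (@measurable_rowvec_coord R n.+1).
  apply: measurable_fun_rowvecP => j.
  rewrite (_ : (fun _ => _) = @rowvec_coord R n.+1 (lift ord0 j)).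
    exact: measurable_rowvec_coord.
  by apply/funext => x; rewrite mxE.
have /sigma_finiteP[F [FT ndF Foo]] := sigma_finiteT (@lebesgue_measure R).
have /sigma_finiteP[G [GT ndG Goo]] := sigma_finiteT mu.
exists (fun k => unc @^-1` (F k `*` G k)).
  rewrite -preimage_bigcup predeqE => x; split => // _ /=.
  have [i _ Fi] : (\bigcup_k F k) (unc x).1 by rewrite -FT.
  have [j _ Gj] : (\bigcup_k G k) (unc x).2 by rewrite -GT.
  exists (maxn i j) => //; split.
    by move: Fi; exact/subsetPset/ndF/leq_maxl.
  by move: Gj; exact/subsetPset/ndG/leq_maxr.
move=> k; have [mF Fk] := Foo k; have [mG Gk] := Goo k; split.
  by rewrite -[X in measurable X]setTI; apply: munc => //; exact: measurableX.
rewrite /rowvec_cons_measure /pushforward -comp_preimage.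
rewrite (_ : unc \o _ = id); last by apply/funext => p /=; rewrite uncK.
by rewrite preimage_id product_measure1E// lte_mul_pinfty// ge0_fin_numE.
Qed.

HB.instance Definition _ := Measure_isSigmaFinite.Build _ _ _
  rowvec_cons_measure cons_measure_sigma_finite.

End rowvec_measure.

Section lebesgue_rowvec.
Context (R : realType).

(* L^0 is the unit mass on the one-point space R^0, and L^(k+1) is the product *)
(* L^1 x L^k transported by R x R^k = R^(k+1).                                *)
Fixpoint lebesgue_rowvec n : {sigma_finite_measure set 'rV[R]_n -> \bar R} :=
  match n with
  | 0%N => @dirac _ 'rV[R]_0 0 R
  | k.+1 => rowvec_cons_measure (lebesgue_rowvec k)
  end.

End lebesgue_rowvec.

Section calculus.
Context (R : realType) (d : nat).
Local Notation E := 'rV[R]_d.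

(* the Euclidean norm: `|x| is the sup norm of 'rV[R]_d *)
Definition enorm n (x : 'rV[R]_n) : R :=
  Num.sqrt (\sum_(i < n) x ord0 i ^+ 2).

Definition pderiv (i : 'I_d) (f : E -> R) : E -> R :=
  fun x => 'D_(delta_mx ord0 i) f x.

Definition pderivs (s : seq 'I_d) (f : E -> R) : E -> R := foldr pderiv f s.

Definition smooth (f : E -> R) : Prop :=
  forall s : seq 'I_d, continuous (pderivs s f) /\
    forall i x, derivable (pderivs s f) x (delta_mx ord0 i).

Definition boundary (Omega : set E) : set E := closure Omega `\` Omega°.

Definition smooth_boundary (Omega : set E) : Prop :=
  forall x, boundary Omega x -> exists U : set E, exists theta : E -> R,
    [/\ open U, U x, smooth theta, exists i, pderiv i theta x != 0 &
        forall y, U y -> (Omega y <-> theta y < 0)].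

Definition multi_index := 'I_d -> nat.

Definition mi_order (al : multi_index) : nat := (\sum_(i < d) al i)%N.

Definition mi_unit (i : 'I_d) : multi_index := fun j => (j == i : nat).

Definition mi_pderiv (al : multi_index) (f : E -> R) : E -> R :=
  pderivs (flatten [seq nseq (al i) i | i <- enum 'I_d]) f.

(* finite carrier of the multi-indices of order at most m *)
Definition mi_of m (al : {ffun 'I_d -> 'I_m.+1}) : multi_index :=
  fun i => al i : nat.

Definition polyfun (r : nat) (p : E -> R) : Prop :=
  exists c : {ffun 'I_d -> 'I_r.+1} -> R, forall x,
    p x = \sum_(al | (mi_order (mi_of al) <= r)%N)
            c al * \prod_(i < d) x ord0 i ^+ al i.

End calculus.

Section sobolev.
Context (R : realType) (d : nat) (Omega : set 'rV[R]_d).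
Local Notation E := 'rV[R]_d.
Local Notation mu := (lebesgue_rowvec R d).

Definition test_function (theta : E -> R) : Prop :=
  smooth theta /\ exists K : set E, [/\ compact K, K `<=` Omega &
    forall x, ~ K x -> theta x = 0].

Definition loc_integrable (u : E -> R) : Prop :=
  measurable_fun Omega u /\
  forall K : set E, compact K -> K `<=` Omega -> mu.-integrable K (EFin \o u).

Definition is_wderiv (al : multi_index d) (u v : E -> R) : Prop :=
  [/\ loc_integrable u, loc_integrable v &
      forall theta, test_function theta ->
        \int[mu]_(x in Omega) (u x * mi_pderiv al theta x) =
        (-1) ^+ mi_order al * \int[mu]_(x in Omega) (v x * theta x)].

(* a representative of the weak derivative, 0 if there is none *)
Definition wderiv (al : multi_index d) (u : E -> R) : E -> R :=
  xget (cst 0) [set v | is_wderiv al u v].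

Definition wgrad (u : E -> R) : E -> E :=
  fun x => \row_i wderiv (mi_unit i) u x.

Definition Lqnorm (q : \bar R) (u : E -> R) : \bar R :=
  'N[mu]_q[EFin \o (u \_ Omega)].

Definition Lqspace (q : \bar R) (u : E -> R) : Prop :=
  measurable_fun Omega u /\ (Lqnorm q u < +oo)%E.

Definition sobolev (m : nat) (q : \bar R) (u : E -> R) : Prop :=
  forall al, (mi_order al <= m)%N ->
    exists2 v, is_wderiv al u v & Lqspace q v.

(* meaningful for u in sobolev m q *)
Definition sobnorm (m : nat) (q : \bar R) (u : E -> R) : \bar R :=
  match q with
  | p%:E => ((\sum_(al : {ffun 'I_d -> 'I_m.+1} | (mi_order (mi_of al) <= m)%N)
               Lqnorm p%:E (wderiv (mi_of al) u) `^ p) `^ p^-1)%E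
  | _ => \big[Order.max/0%E]_(al : {ffun 'I_d -> 'I_m.+1}
               | (mi_order (mi_of al) <= m)%N) Lqnorm q (wderiv (mi_of al) u)
  end.

(* H^1_0(Omega), the closure of the test functions in H^1(Omega) *)
Definition H10 (u : E -> R) : Prop :=
  sobolev 1 2%:E u /\ forall eps : R, 0 < eps ->
    exists2 theta, test_function theta &
      (sobnorm 1 2%:E (u \- theta)%R < eps%:E)%E.

Definition inner (u v : E -> R) : R := \int[mu]_(x in Omega) (u x * v x).

Definition vinner (F G : E -> E) : R :=
  \int[mu]_(x in Omega) \sum_(i < d) F x ord0 i * G x ord0 i.

(* continuity in time, on [0, +oo), with values in L^2(Omega) *)
Definition L2continuous (u : R -> E -> R) : Prop :=
  forall t, 0 <= t ->
    Lqnorm 2%:E (u s \- u t)%R @[s --> within `[0, +oo[ (nbhs t)] --> 0%E.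

(* v is the derivative at time t, in L^2(Omega), of u on [0, +oo) (one-sided *)
(* at t = 0)                                                                 *)
Definition L2derive (u : R -> E -> R) (t : R) (v : E -> R) : Prop :=
  Lqnorm 2%:E (fun x => (s - t)^-1 * (u s x - u t x) - v x)
    @[s --> within `[0, +oo[ (t^')] --> 0%E.

End sobolev.

Section mesh.
Context (R : realType) (d : nat).
Local Notation E := 'rV[R]_d.

(* The reference simplex in barycentric coordinates: [ref_face A] is its face *)
(* spanned by the vertices in A, empty for A = set0.                          *)
Definition ref_face (A : {set 'I_d.+1}) : set 'rV[R]_d.+1 :=
  [set l | [/\ forall k, 0 <= l ord0 k, \sum_k l ord0 k = 1 &
               forall k, k \notin A -> l ord0 k = 0]].

Definition ref_simplex : set 'rV[R]_d.+1 := ref_face [set: 'I_d.+1].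

(* A triangulation of the closure of Omega. The boundary of Omega being       *)
(* smooth, no union of finitely many straight simplices is equal to that      *)
(* closure, whence the elements meeting the boundary may be curved: they are  *)
(* bi-Lipschitz images of the reference simplex. The other elements are       *)
(* straight.                                                                  *)
Record triangulation (Omega : set E) := Triangulation {
  tri_index : finType ;
  tri_map : tri_index -> 'rV[R]_d.+1 -> E ;
  tri_bilipschitz : forall T, exists c1 c2 : R, [/\ 0 < c1, 0 < c2 &
    forall l l', ref_simplex l -> ref_simplex l' ->
      c1 * enorm (l - l') <= enorm (tri_map T l - tri_map T l')
        <= c2 * enorm (l - l')] ;
  tri_straight : forall T,
    tri_map T @` ref_simplex `&` boundary Omega = set0 ->
    exists p : 'I_d.+1 -> E, forall l, ref_simplex l ->
      tri_map T l = \sum_k l ord0 k *: p k ;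
  tri_cover : closure Omega = \bigcup_T (tri_map T @` ref_simplex) ;
  tri_conforming : forall T T', T != T' -> exists A A' : {set 'I_d.+1},
    [/\ A \proper [set: 'I_d.+1], A' \proper [set: 'I_d.+1],
        tri_map T @` ref_simplex `&` tri_map T' @` ref_simplex =
          tri_map T @` ref_face A &
        tri_map T @` ref_face A = tri_map T' @` ref_face A'] }.

Context (Omega : set E) (Th : triangulation Omega).

Definition element (T : tri_index Th) : set E := tri_map T @` ref_simplex.

Definition diam (A : set E) : R :=
  sup [set z | exists x y, [/\ A x, A y & z = enorm (x - y)]].

Definition meshsize : R := \big[Num.max/0]_T diam (element T).

(* every element contains a ball of radius at least meshsize / sigma *)
Definition quasiuniform (sigma : R) : Prop :=
  forall T, exists x : E, exists2 rad : R,
    meshsize <= sigma * rad & [set y | enorm (y - x) <= rad] `<=` element T.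

(* Functions on the closure of Omega that vanish on its boundary are extended *)
(* by 0 to the whole space.                                                   *)
Definition fespace (r : nat) : set (E -> R) :=
  [set v | [/\ continuous v, forall x, ~ Omega x -> v x = 0, H10 Omega v &
               forall T, exists2 p, polyfun r p & {in element T, v =1 p}]].

End mesh.

Section projection.
Context (R : realType) (d : nat) (Omega : set 'rV[R]_d).
Local Notation E := 'rV[R]_d.

(* The L^2-projection onto W, extended to L^1(Omega); the extension makes     *)
(* sense for spaces W of bounded functions and is needed for W^{m,q}(Omega)   *)
(* with q < 2.                                                                *)
Definition L2projection (W : set (E -> R)) (proj : (E -> R) -> E -> R) : Prop :=
  forall w, Lqspace Omega 1%:E w -> W (proj w) /\
    forall v, W v -> inner Omega (proj w) v = inner Omega w v.

Definition projection_stable (proj : (E -> R) -> E -> R) (C0 : R) : Prop :=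
  forall s w, (s <= 1)%N -> sobolev Omega s 2%:E w ->
    (sobnorm Omega s 2%:E (proj w) <= C0%:E * sobnorm Omega s 2%:E w)%E.

Definition projection_approx (proj : (E -> R) -> E -> R) (h : R) (r : nat)
    (C1 : R) : Prop :=
  forall m (q : \bar R) w, (m <= r.+1)%N -> (1 <= q)%E -> sobolev Omega m q w ->
    (Lqnorm Omega q (proj w \- w)%R <= (C1 * h ^+ m)%:E * sobnorm Omega m q w)%E.

End projection.

Section forchheimer.
Context (R : realType) (N : nat) (coef expo : 'I_N.+1 -> R).

Definition forch_g (s : R) : R := \sum_i coef i * s `^ expo i.

(* the solution s >= 0 of s g(s) = xi, for xi >= 0 *)
Definition forch_s (xi : R) : R :=
  xget 0 [set s | 0 <= s /\ s * forch_g s = xi].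

Definition forch_K (xi : R) : R := (forch_g (forch_s xi))^-1.

Definition forch_a : R := expo ord_max / (expo ord_max + 1).

Definition forch_beta : R := 2 - forch_a.

Definition forch_lambda : R := (2 - forch_a) / (1 - forch_a).

Definition forch_polynomial : Prop :=
  [/\ (1 <= N)%N, expo ord0 = 0, forall i j : 'I_N.+1, (i < j)%N -> expo i < expo j,
      forall i, 0 <= coef i & 0 < coef ord0 /\ 0 < coef ord_max].

End forchheimer.

(* E is an admissible choice of Env(F), for F defined on [0, +oo) *)
Definition is_envelope (R : realType) (F : R -> \bar R) (E : R -> R) : Prop :=
  [/\ {within `[0, +oo[, continuous E},
      forall s t, 0 <= s -> s <= t -> E s <= E t &
      forall t, 0 <= t -> (F t <= (E t)%:E)%E].

Definition limsup_oo (R : realType) (F : R -> \bar R) : \bar R :=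
  limf_esup F (pinfty_nbhs R).

Section semidiscrete.
Context (R : realType) (d : nat) (Omega : set 'rV[R]_d).
Local Notation E := 'rV[R]_d.

Definition regular_data (f phi phit : R -> E -> R) (rho0 : E -> R) : Prop :=
  [/\ sobolev Omega 1 2%:E rho0,
      forall t, 0 <= t ->
        [/\ Lqspace Omega 2%:E (f t), sobolev Omega 1 2%:E (phi t),
            sobolev Omega 1 2%:E (phit t) & L2derive Omega phi t (phit t)],
      L2continuous Omega f, L2continuous Omega phit &
      measurable_fun (`[0, +oo[%classic : set R)
        (fun t => sobnorm Omega 1 2%:E (phit t))].

Context (N : nat) (coef expo : 'I_N.+1 -> R).

Definition forch_flux (u : E -> R) : E -> E :=
  fun x => forch_K coef expo (enorm (wgrad Omega u x)) *: wgrad Omega u x.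

(* [rt] is the unknown rho_h - proj phi *)
Definition semidiscrete_solution (W : set (E -> R))
    (proj : (E -> R) -> E -> R) (f phi phit : R -> E -> R) (rho0 : E -> R)
    (rt : R -> E -> R) : Prop :=
  [/\ forall t, 0 <= t -> W (rt t),
      L2continuous Omega rt,
      rt 0 = proj (rho0 \- phi 0) &
      forall t, 0 < t -> exists rtt : E -> R,
        [/\ W rtt, L2derive Omega rt t rtt &
            forall w, W w ->
              inner Omega rtt w +
              vinner Omega (forch_flux (rt t \+ proj (phi t))) (wgrad Omega w)
              = inner Omega (f t \- phit t) w]].

(* || grad u ||_{0,q} *)
Definition gradnorm (q : R) (u : E -> R) : \bar R :=
  Lqnorm Omega q%:E (fun x => enorm (wgrad Omega u x)).

Definition data_g (f phi phit : R -> E -> R) (t : R) : \bar R :=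
  (Lqnorm Omega 2%:E (f t \- phit t)%R `^ forch_lambda expo +
   sobnorm Omega 1 2%:E (phi t) ^+ 2)%E.

Definition bound_A (phi phit : R -> E -> R) (rho0 : E -> R) (Env : R -> R)
    (t : R) : \bar R :=
  (1 + sobnorm Omega 1 2%:E rho0 ^+ 2 + Lqnorm Omega 2%:E (phi 0%R) ^+ 2 +
   \int[lebesgue_measure]_(s in `[0%R, t])
     ((expR (- 2^-1 * (t - s)))%:E *
      (sobnorm Omega 1 2%:E (phit s) ^+ 2 +
       (Env s `^ (2 / forch_beta expo))%:E)))%E.

End semidiscrete.

(* Main.v *)
Require Import Defs.
From mathcomp Require Import all_boot all_order all_algebra.
From mathcomp Require Import all_classical all_reals all_analysis.
From mathcomp Require Import measurable_realfun.
From mathcomp Require Import lra ring.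
Set Implicit Arguments.
Unset Strict Implicit.
Unset Printing Implicit Defensive.
Import Order.TTheory GRing.Theory Num.Theory.
Import numFieldNormedType.Exports.
Local Open Scope classical_set_scope.
Local Open Scope ring_scope.

(** The semidiscrete problem is a gradient flow in finitely many unknowns, and its
estimates come from two energies, the kinetic one [N = |y|^2 / 2] and the
potential one [J].

Reduction to coordinates. A function of [fespace Th r] is determined on Omega by
finitely many polynomial coefficients, hence an L^2-orthonormal family in it has
bounded size ([orthonormal_size]) and a maximal one is a basis
([orthonormal_basis]). Let y, z and zeta be the coordinates of rho_h - proj phi,
of proj phi and of proj phi_t. Then z' = zeta and y' = F - Phi (y + z)
([flow_gradient_flow]), where Phi p collects the integrals of
K(|grad u|) grad u . grad w_i for u = \sum_i p_i w_i. Since s(xi) = K(xi) xi is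
increasing, xi |-> \int_0^xi s has an increasing derivative, and Phi is the
gradient of the convex energy J p = \int Psi(|grad u|) ([galerkin_convex]), Psi
being that primitive. Moreover J is comparable to the dissipation
X = Phi p . p = \int K(|grad u|) |grad u|^2.

Coercivity. Splitting according to the size of s(xi) gives
xi^beta <= delta^beta + C_delta s(xi) xi ([forch_growth]), so that
D = \int |grad rho_h|^beta is bounded by delta + C_delta X. The Degree Condition
says that beta is at least the exponent 2d/(d + 2), whose Sobolev conjugate is 2;
hence ||v|| <= C ||grad v||_beta on H^1_0 ([H10_embedding]), which bounds |y| by
D^(1/beta) and ||phi||_1. The case of test functions is the
Gagliardo-Nirenberg-Sobolev inequality ([gns_inequality]): the fundamental
theorem of calculus on the lines parallel to the axes, and the Loomis-Whitney
inequality.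

Energy estimates. Testing the equation with y and with y' gives, with
a_0 s(xi)^2 <= s(xi) xi to absorb the terms in z and zeta ([flux_absorb]),

  N' <= - 3/4 X + C ||phi||_1^2 + ||f~|| |y|,
  J' <= - J / 2 + C (||f~||^2 + |y|^2 + ||phi||_1^2 + ||phi_t||_1^2)

([gf_dN_le], [gf_Q_le]). By coercivity and Young's inequality with the conjugate
exponents beta and lambda, the first one yields N' <= -1 as soon as |y|^beta
exceeds a multiple of 1 + g, where g = ||f~||^lambda + ||phi||_1^2
([kinetic_decay]). Therefore |y(t)|^2 stays below
|y(0)|^2 + C (1 + Env g(t))^(2/beta), because Env g is increasing ([barrier]),
and ends below C (1 + G)^(2/beta) if g is eventually at most G
([eventually_below]). Inserted in the second inequality, these bounds give the
estimate at time t by Gronwall's lemma with the weight exp(-(t - s)/2)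
([gronwall_integral]) and the bound of the upper limit by another use of
[eventually_below]. When the data vanish at infinity, so do successively y, J
and D, the last one because delta is arbitrary ([gf_limit0]).

The constants come from Omega, from the nonlinearity and from the H^1-stability
constant of the projection, which bounds ||grad proj phi|| by ||phi||_1; neither
the number of unknowns nor the Lipschitz constant of Phi enters them
([gradient_flow_estimates]).

Weak gradients are arbitrary representatives, so that the gradient of a
combination of the w_i is known only almost everywhere, by the uniqueness of weak
derivatives ([is_wderiv_unique]); it rests on the du Bois-Reymond lemma
([test_integral0_ae]). *)

(** * Real powers and the Euclidean norm *)

Section real_powers.
Context (R : realType).

Lemma sum_continuous (T : topologicalType) (I : Type) (s : seq I) (F : I -> T -> R) :
  (forall i, continuous (F i)) -> continuous (fun x => \sum_(i <- s) F i x).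
Proof.
move=> cF; elim: s => [|i s IH] x.
  by under eq_fun do rewrite big_nil; exact: cvg_cst.
by under eq_fun do rewrite big_cons; apply: cvgD; [exact: cF|exact: IH].
Qed.

Lemma powR_continuous_pos (r x : R) : 0 < x -> {for x, continuous (@powR R ^~ r)}.
Proof.
move=> x0; apply: differentiable_continuous; apply/derivable1_diffP.
by apply: derivable_powR; rewrite in_itv/= x0.
Qed.

Lemma powR_abs_continuous (r : R) : 0 < r -> continuous (fun x : R => `|x| `^ r).
Proof.
move=> r0 x; have [->|x0] := eqVneq x 0; last first.
  apply: (@continuous_comp _ _ _ (fun x : R => `|x|) (@powR R ^~ r)).
    exact: norm_continuous.
  by apply: powR_continuous_pos; rewrite normr_gt0.
apply/cvgrPdist_lt => e e0; near=> y.
rewrite normr0 powR0 ?gt_eqF// sub0r normrN ger0_norm ?powR_ge0//.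
have -> : e = (e `^ r^-1) `^ r by rewrite -powRrM mulVf ?gt_eqF// powRr1// ltW.
apply: gt0_ltr_powR => //; rewrite ?nnegrE ?powR_ge0//.
near: y; apply/nbhs_ballP; exists (e `^ r^-1); first by rewrite /= powR_gt0.
by move=> y; rewrite /ball/= sub0r normrN.
Unshelve. all: by end_near. Qed.

Lemma ltr_powR_pos (x y r : R) : 0 < r -> 0 <= x -> 0 <= y -> (x `^ r < y `^ r) = (x < y).
Proof.
move=> r0 x0 y0; apply/idP/idP; last by move=> xy; apply: gt0_ltr_powR.
by rewrite !ltNge; apply: contra => yx; apply: ge0_ler_powR => //; exact: ltW.
Qed.

Lemma powRVK (x r : R) : r != 0 -> 0 <= x -> (x `^ r^-1) `^ r = x.
Proof. by move=> r0 x0; rewrite -powRrM mulVf// powRr1. Qed.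

Lemma young2 (a b p : R) : 0 <= a -> 0 <= b -> 0 <= p ->
  a * b `^ (p + 1) <= a `^ (p + 2) / (p + 2) + b `^ (p + 2) * ((p + 1) / (p + 2)).
Proof.
move=> a0 b0 p0.
have h1 : 0 < p + 1 by lra. have h2 : 0 < p + 2 by lra.
have := @conjugate_powR R a (b `^ (p + 1)) (p + 2) ((p + 2) / (p + 1)) a0 (powR_ge0 _ _) h2.
rewrite divr_gt0// => /(_ isT).
have -> : (b `^ (p + 1)) `^ ((p + 2) / (p + 1)) = b `^ (p + 2).
  by rewrite -powRrM; congr (_ `^ _); field; rewrite gt_eqF.
rewrite invf_div.
by apply; field; rewrite gt_eqF.
Qed.

Lemma powR_mono (x y r : R) : 0 <= r -> 0 <= x -> x <= y -> x `^ r <= y `^ r.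
Proof.
by move=> r0 x0 xy; apply: ge0_ler_powR => //; rewrite nnegrE// (le_trans x0).
Qed.

Lemma sqr_powR_half (a : R) : 0 <= a -> (a ^+ 2) `^ 2^-1 = a.
Proof. by move=> a0; rewrite powR12_sqrt ?sqr_ge0// sqrtr_sqr ger0_norm. Qed.

Lemma powR_le_sqr (g be : R) : 0 <= g -> 0 < be -> be <= 2 -> g `^ be <= 1 + g ^+ 2.
Proof.
move=> g0 be0 be2; have [g1|g1] := leP g 1.
  apply: (@le_trans _ _ 1); last by rewrite lerDl sqr_ge0.
  by have := @ge0_ler_powR R be (ltW be0) g 1 g0 ler01 g1; rewrite powR1.
rewrite -powR_mulrn//; apply: (@le_trans _ _ (g `^ 2)); last by rewrite lerDr.
by apply: ler_powR => //; exact: ltW.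
Qed.

Lemma powRD_le (x y p : R) : 0 <= x -> 0 <= y -> 0 <= p ->
  (x + y) `^ p <= 2 `^ p * (x `^ p + y `^ p).
Proof.
move=> x0 y0 p0; wlog xy : x y x0 y0 / x <= y.
  by move=> W; have [/W->//|/ltW/W h] := leP x y; rewrite addrC (addrC (x `^ p)) h.
apply: (@le_trans _ _ ((2 * y) `^ p)).
  by apply: ge0_ler_powR; rewrite ?nnegrE ?addr_ge0 ?mulr_ge0//; lra.
by rewrite powRM// ler_wpM2l ?powR_ge0// lerDr powR_ge0.
Qed.

End real_powers.

Section quadratic.
Context (R : realFieldType).
(** The discriminant criterion, from which the Cauchy-Schwarz inequalities for
    vectors and for functions follow. *)
Lemma quadratic_disc (A B P : R) : 0 <= A ->
  (forall r, 0 <= A * r ^+ 2 + 2 * P * r + B) -> P ^+ 2 <= A * B.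
Proof.
move=> A0 H; have [A00|An0] := eqVneq A 0.
  have [P0|Pn0] := eqVneq P 0; first by rewrite P0 A00 expr0n/= mul0r.
  have := H (- (B + 1) / (2 * P)).
  have -> : A * (- (B + 1) / (2 * P)) ^+ 2 + 2 * P * (- (B + 1) / (2 * P)) + B = - 1.
    by rewrite A00; field.
  by rewrite oppr_ge0 ler10.
have Ap : 0 < A by rewrite lt_neqAle eq_sym An0.
have := H (- P / A).
have -> : A * (- P / A) ^+ 2 + 2 * P * (- P / A) + B = (A * B - P ^+ 2) / A by field.
by rewrite pmulr_lge0 ?invr_gt0// subr_ge0.
Qed.
End quadratic.

Section euclid.
Context (R : realType) (n : nat).
Implicit Types x y : 'rV[R]_n.

Definition dotv x y : R := \sum_i x ord0 i * y ord0 i.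

Lemma enorm_ge0 x : 0 <= enorm x. Proof. exact: sqrtr_ge0. Qed.

Lemma sqr_enorm x : enorm x ^+ 2 = dotv x x.
Proof.
rewrite sqr_sqrtr; first by apply: eq_bigr => i _; rewrite expr2.
by apply: sumr_ge0 => i _; exact: sqr_ge0.
Qed.

Lemma dotvDl x y z : dotv (x + y) z = dotv x z + dotv y z.
Proof. by rewrite -big_split/=; apply: eq_bigr => i _; rewrite mxE mulrDl. Qed.
Lemma dotvC x y : dotv x y = dotv y x.
Proof. by apply: eq_bigr => i _; rewrite mulrC. Qed.
Lemma dotvZl a x y : dotv (a *: x) y = a * dotv x y.
Proof. by rewrite mulr_sumr; apply: eq_bigr => i _; rewrite mxE mulrA. Qed.

Lemma dotvNl x y : dotv (- x) y = - dotv x y.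
Proof. by rewrite -scaleN1r dotvZl mulN1r. Qed.
Lemma dotvBl x y z : dotv (x - y) z = dotv x z - dotv y z.
Proof. by rewrite dotvDl dotvNl. Qed.
Lemma dotvDr x y z : dotv z (x + y) = dotv z x + dotv z y.
Proof. by rewrite dotvC dotvDl !(dotvC z). Qed.
Lemma dotvBr x y z : dotv z (x - y) = dotv z x - dotv z y.
Proof. by rewrite dotvC dotvBl !(dotvC z). Qed.
Lemma rowDE x y i : (x + y) ord0 i = x ord0 i + y ord0 i. Proof. by rewrite mxE. Qed.
Lemma rowBE x y i : (x - y) ord0 i = x ord0 i - y ord0 i. Proof. by rewrite !mxE. Qed.

Lemma dotv_sqr_le x y : dotv x y ^+ 2 <= enorm x ^+ 2 * enorm y ^+ 2.
Proof.
rewrite !sqr_enorm; apply: quadratic_disc; first by rewrite -sqr_enorm sqr_ge0.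
move=> r; have := sqr_ge0 (enorm (r *: x + y)).
rewrite sqr_enorm !dotvDl !dotvZl !(dotvC _ (_ + _)) !dotvDl !dotvZl (dotvC y x).
by rewrite expr2; lra.
Qed.

Lemma dotv_le x y : dotv x y <= enorm x * enorm y.
Proof.
apply: le_trans (ler_norm _) _.
rewrite -(@ler_pXn2r _ 2)// ?nnegrE ?mulr_ge0 ?enorm_ge0//.
by rewrite exprMn real_normK ?num_real// dotv_sqr_le.
Qed.

Lemma enormD x y : enorm (x + y) <= enorm x + enorm y.
Proof.
rewrite -(@ler_pXn2r _ 2)// ?nnegrE ?addr_ge0 ?enorm_ge0//.
rewrite sqr_enorm dotvDl !(dotvC _ (_ + _)) !dotvDl sqrrD -!sqr_enorm (dotvC y x).
by have := dotv_le x y; lra.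
Qed.

Lemma enormZ a x : enorm (a *: x) = `|a| * enorm x.
Proof.
apply/eqP; rewrite -(@eqrXn2 _ 2)// ?mulr_ge0 ?enorm_ge0//.
by rewrite exprMn !sqr_enorm dotvZl dotvC dotvZl real_normK ?num_real// expr2 mulrA.
Qed.

Lemma enormN x : enorm (- x) = enorm x.
Proof. by rewrite -scaleN1r enormZ normrN1 mul1r. Qed.

Lemma enorm0 : enorm (0 : 'rV[R]_n) = 0.
Proof. by rewrite -(scale0r (0 : 'rV[R]_n)) enormZ normr0 mul0r. Qed.

Lemma enorm_eq0 x : enorm x = 0 -> x = 0.
Proof.
move=> x0; apply/rowP => i; rewrite mxE; apply/eqP; rewrite -sqrf_eq0.
have : \sum_i x ord0 i ^+ 2 == 0 :> R.
  rewrite (eq_bigr (fun j => x ord0 j * x ord0 j)) => [|j _]; last by rewrite expr2.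
  by rewrite -/(dotv x x) -sqr_enorm x0 expr0n.
by rewrite psumr_eq0 => [/allP/(_ i (mem_index_enum _))|j _]; rewrite ?sqr_ge0.
Qed.

Lemma coord_le_enorm x i : `|x ord0 i| <= enorm x.
Proof.
rewrite -(@ler_pXn2r _ 2)// ?nnegrE ?enorm_ge0// sqr_enorm real_normK ?num_real//.
rewrite /dotv (bigD1 i)//= expr2 lerDl; apply: sumr_ge0 => j _.
by rewrite -expr2 sqr_ge0.
Qed.

Lemma enorm_le_sum x : enorm x <= \sum_i `|x ord0 i|.
Proof.
rewrite -(@ler_pXn2r _ 2)// ?nnegrE ?enorm_ge0 ?sumr_ge0//.
rewrite sqr_enorm expr2 mulr_suml; apply: ler_sum => i _.
rewrite -expr2 -(@real_normK _ (x _ _)) ?num_real// expr2 ler_wpM2l//.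
by rewrite (bigD1 i)//= lerDl sumr_ge0.
Qed.

Lemma enormB_ge x y : enorm x - enorm y <= enorm (x - y).
Proof. by rewrite lerBlDr -{1}(subrK y x) enormD. Qed.

Lemma enormB_abs x y : `|enorm x - enorm y| <= enorm (x - y).
Proof.
rewrite ler_norml enormB_ge andbT lerNl opprB.
by rewrite -(enormN (x - y)) opprB enormB_ge.
Qed.

End euclid.
(** * The Forchheimer nonlinearity *)

Section forchheimer_facts.
Context (R : realType) (N : nat) (coef expo : 'I_N.+1 -> R).
Hypothesis H : forch_polynomial coef expo.
Local Notation g := (forch_g coef expo).
Local Notation sl := (forch_s coef expo).
Local Notation K := (forch_K coef expo).
Local Notation a0 := (coef ord0).
Local Notation alpha := (expo ord_max).

Lemma expo_ge0 i : 0 <= expo i.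
Proof.
case: H => _ e0 emono _ _; have [->|i0] := eqVneq i ord0; first by rewrite e0.
by rewrite -e0 ltW// emono// lt0n.
Qed.

Lemma expo_le_max i : expo i <= alpha.
Proof.
case: H => _ e0 emono _ _; have [->//|i0] := eqVneq i ord_max.
rewrite ltW// emono// ltn_neqAle -ltnS ltn_ord andbT.
by apply: contra i0 => /eqP i0; apply/eqP/val_inj.
Qed.

Lemma coef_ge0 i : 0 <= coef i. Proof. by case: H. Qed.
Lemma coef0_gt0 : 0 < a0. Proof. by case: H => _ _ _ _ []. Qed.
Lemma alpha_gt0 : 0 < alpha.
Proof. by case: H => N1 e0 emono _ _; rewrite -e0 emono. Qed.

Lemma forch_g_ge0 s : 0 <= g s.
Proof. by apply: sumr_ge0 => i _; rewrite mulr_ge0 ?coef_ge0 ?powR_ge0. Qed.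

Lemma forch_g_ge_coef0 s : a0 <= g s.
Proof.
have e0 : expo ord0 = 0 by case: H.
rewrite /forch_g (bigD1 ord0)//= e0 powRr0 mulr1 lerDl.
by apply: sumr_ge0 => i _; rewrite mulr_ge0 ?coef_ge0 ?powR_ge0.
Qed.

Lemma forch_g_gt0 s : 0 < g s.
Proof. exact: lt_le_trans coef0_gt0 (forch_g_ge_coef0 s). Qed.

Lemma forch_g_le s t : 0 <= s -> s <= t -> g s <= g t.
Proof.
move=> s0 st; apply: ler_sum => i _; rewrite ler_wpM2l ?coef_ge0//.
by apply: ge0_ler_powR => //; rewrite ?expo_ge0// nnegrE (le_trans s0).
Qed.

(** Since g is nondecreasing and at least a_0, s g(s) increases at least at the
    rate a_0; the inverse function [sl] is therefore 1/a_0-Lipschitz. *)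
Lemma mulr_g_lipschitz s t : 0 <= s -> s <= t -> a0 * (t - s) <= t * g t - s * g s.
Proof.
move=> s0 st.
have -> : t * g t - s * g s = g t * (t - s) + s * (g t - g s) by ring.
apply: ler_wpDr; first by rewrite mulr_ge0// subr_ge0 forch_g_le.
by rewrite ler_wpM2r ?subr_ge0// forch_g_ge_coef0.
Qed.

(** With absolute values the powers are continuous on the whole line, as the
    intermediate value theorem asks. *)
Lemma mulr_g_sum s : 0 <= s -> s * g s = \sum_i coef i * `|s| `^ (expo i + 1).
Proof.
move=> s0; rewrite mulr_sumr; apply: eq_bigr => i _.
rewrite mulrCA ger0_norm//; congr (_ * _).
have -> : expo i = expo i + 1 - 1 by ring.
rewrite mulr_powRB1//; first by congr (_ `^ _); ring.
by have := expo_ge0 i; lra.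
Qed.

(** The intermediate value theorem on [0, xi / a_0], as s g(s) >= a_0 s. *)
Lemma forch_sP xi : 0 <= xi -> 0 <= sl xi /\ sl xi * g (sl xi) = xi.
Proof.
move=> xi0; rewrite /forch_s; case: xgetP => [s _ [//]|/(_ _) noroot].
pose h (s : R) := \sum_i coef i * `|s| `^ (expo i + 1).
have ch : continuous h.
  apply: sum_continuous => i s; apply: cvgMr.
  by apply: powR_abs_continuous; have := expo_ge0 i; lra.
have b0 : 0 <= xi / a0 by rewrite divr_ge0// (ltW coef0_gt0).
have h0 : h 0 = 0 by rewrite /h -mulr_g_sum// mul0r.
have hb : xi <= h (xi / a0).
  rewrite /h -mulr_g_sum//; have := mulr_g_lipschitz (lexx 0) b0.
  by rewrite subr0 mul0r subr0 mulrC divfK ?gt_eqF ?coef0_gt0.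
have [||c /itvP cin hc] := @IVT _ h 0 (xi / a0) xi b0.
- exact: continuous_subspaceT.
- by rewrite h0 ge_min xi0/= le_max hb orbT.
exfalso; apply: (noroot c); split; first by rewrite cin.
by rewrite mulr_g_sum ?cin// -hc.
Qed.

Lemma forch_s_ge0 xi : 0 <= sl xi.
Proof.
have [/forch_sP[]//|xi0] := leP 0 xi.
by rewrite /forch_s; case: xgetP => // s _ [].
Qed.

(** For xi < 0 there is no solution and [forch_s] takes its default value 0, which
    makes it monotone and Lipschitz on the whole line. *)
Lemma forch_s_neg xi : xi <= 0 -> sl xi = 0.
Proof.
rewrite le_eqVlt => /orP[/eqP ->|xi0].
  have [_ /eqP] := forch_sP (lexx 0).
  by rewrite mulf_eq0 (gt_eqF (forch_g_gt0 _)) orbF => /eqP.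
rewrite /forch_s; case: xgetP => // s _ [s0 sE].
have : 0 <= xi by rewrite -sE mulr_ge0// forch_g_ge0.
by rewrite leNgt xi0.
Qed.

Lemma forch_s0 : sl 0 = 0. Proof. exact: forch_s_neg. Qed.

Lemma forch_s_lip_le xi eta : xi <= eta ->
  0 <= sl eta - sl xi /\ a0 * (sl eta - sl xi) <= eta - xi.
Proof.
move=> le; have [xi0|xi0] := leP 0 xi; last first.
  rewrite (forch_s_neg (ltW xi0)) subr0 forch_s_ge0; split => //.
  have [eta0|eta0] := leP 0 eta; last by rewrite (forch_s_neg (ltW eta0)) mulr0 subr_ge0.
  have [s0 sE] := forch_sP eta0; have := mulr_g_lipschitz (lexx 0) s0.
  by rewrite sE mul0r !subr0 => /le_trans; apply; lra.
have eta0 : 0 <= eta by exact: le_trans le.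
have [s0 sE] := forch_sP xi0; have [t0 tE] := forch_sP eta0.
have st : sl xi <= sl eta.
  rewrite leNgt; apply/negP => ts.
  have := mulr_g_lipschitz t0 (ltW ts); rewrite sE tE => h.
  have : 0 < a0 * (sl xi - sl eta) by rewrite mulr_gt0 ?coef0_gt0// subr_gt0.
  lra.
by split; [rewrite subr_ge0|have := mulr_g_lipschitz s0 st; rewrite sE tE].
Qed.

Lemma forch_s_lip xi eta : `|sl eta - sl xi| <= a0^-1 * `|eta - xi|.
Proof.
wlog le : xi eta / xi <= eta.
  move=> W; have [/W//|/ltW/W] := leP xi eta.
  by rewrite distrC (distrC xi).
have [h1 h2] := forch_s_lip_le le.
by rewrite (ger0_norm h1) [`|eta - xi|]ger0_norm ?subr_ge0// ler_pdivlMl ?coef0_gt0.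
Qed.

Lemma forch_s_le_lin xi : 0 <= xi -> sl xi <= a0^-1 * xi.
Proof.
move=> xi0; have := forch_s_lip 0 xi; rewrite forch_s0 !subr0.
by rewrite !ger0_norm ?forch_s_ge0.
Qed.

Lemma forch_KM xi : 0 <= xi -> K xi * xi = sl xi.
Proof.
move=> xi0; have [s0 sE] := forch_sP xi0.
by rewrite /forch_K -{2}sE mulrC mulfK// gt_eqF ?forch_g_gt0.
Qed.

Lemma forch_K_ge0 xi : 0 <= K xi.
Proof. by rewrite invr_ge0 forch_g_ge0. Qed.

Lemma coef0_sqr_s xi : 0 <= xi -> a0 * sl xi ^+ 2 <= sl xi * xi.
Proof.
move=> xi0; have [s0 sE] := forch_sP xi0.
rewrite -{3}sE expr2 mulrA (mulrC a0) -mulrA (mulrC a0) ler_wpM2l// ler_wpM2l//.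
exact: forch_g_ge_coef0.
Qed.

(** The primitive of [sl] that vanishes at 0, written in the variable s: since
    xi = s g(s), one has s dxi = \sum_i a_i (alpha_i + 1) s^(alpha_i + 1) ds. *)
Definition forch_Psi (xi : R) : R :=
  \sum_i coef i * (sl xi `^ (expo i + 2) * ((expo i + 1) / (expo i + 2))).

Lemma mulr_s_sum xi (s : R) : 0 <= xi -> s * xi = \sum_i coef i * (s * sl xi `^ (expo i + 1)).
Proof.
move=> xi0; have [s0 sE] := forch_sP xi0.
rewrite -{1}sE mulr_g_sum// mulr_sumr ger0_norm//.
by apply: eq_bigr => i _; rewrite mulrCA.
Qed.

Lemma mulr_powR2 (s e : R) : 0 <= s -> 0 <= e -> s * s `^ (e + 1) = s `^ (e + 2).
Proof.
move=> s0 e0; rewrite -(@mulr_powRB1 _ s (e + 2)); [|by []|lra].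
by congr (_ * _ `^ _); ring.
Qed.

Lemma forch_Psi_le xi : 0 <= xi -> forch_Psi xi <= sl xi * xi.
Proof.
move=> xi0; rewrite mulr_s_sum//; apply: ler_sum => i _.
rewrite ler_wpM2l ?coef_ge0// mulr_powR2 ?forch_s_ge0 ?expo_ge0//.
have e0 := expo_ge0 i.
by rewrite ler_piMr ?powR_ge0// ler_pdivrMr; lra.
Qed.

Lemma forch_Psi_ge xi : 0 <= xi -> 2^-1 * (sl xi * xi) <= forch_Psi xi.
Proof.
move=> xi0; rewrite mulr_s_sum// mulr_sumr; apply: ler_sum => i _.
rewrite mulrCA ler_wpM2l ?coef_ge0// mulr_powR2 ?forch_s_ge0 ?expo_ge0//.
have e0 := expo_ge0 i.
by rewrite mulrC ler_wpM2l ?powR_ge0// ler_pdivlMr; lra.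
Qed.

Lemma forch_Psi_ge0 xi : 0 <= xi -> 0 <= forch_Psi xi.
Proof.
move=> xi0; apply: le_trans (forch_Psi_ge xi0).
by rewrite !mulr_ge0 ?forch_s_ge0 ?invr_ge0.
Qed.

(** Term by term, Young's inequality between sl xi and (sl eta)^(alpha_i + 1):
    this avoids any differentiation of [sl]. *)
Lemma forch_Psi_convex xi eta : 0 <= xi -> 0 <= eta ->
  sl xi * (eta - xi) <= forch_Psi eta - forch_Psi xi.
Proof.
move=> xi0 eta0; rewrite mulrBr !mulr_s_sum// -!sumrB; apply: ler_sum => i _.
rewrite -mulrBr -[leRHS]mulrBr ler_wpM2l ?coef_ge0// mulr_powR2 ?forch_s_ge0 ?expo_ge0//.
have e0 := expo_ge0 i.
have := young2 (forch_s_ge0 xi) (forch_s_ge0 eta) e0.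
have -> : sl xi `^ (expo i + 2) * ((expo i + 1) / (expo i + 2)) =
  sl xi `^ (expo i + 2) - sl xi `^ (expo i + 2) / (expo i + 2).
  by field; rewrite gt_eqF//; lra.
lra.
Qed.

Context (n : nat).
Implicit Types x y : 'rV[R]_n.

Definition fluxv x : 'rV[R]_n := K (enorm x) *: x.

Lemma fluxv0 : fluxv 0 = 0. Proof. exact: scaler0. Qed.

Lemma dotv_fluxv x : dotv (fluxv x) x = sl (enorm x) * enorm x.
Proof. by rewrite dotvZl -sqr_enorm expr2 mulrA forch_KM ?enorm_ge0. Qed.

Lemma dotv_fluxv_le x y : dotv (fluxv x) y <= sl (enorm x) * enorm y.
Proof.
rewrite dotvZl; apply: (@le_trans _ _ (K (enorm x) * (enorm x * enorm y))).
  by rewrite ler_wpM2l ?forch_K_ge0// dotv_le.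
by rewrite mulrA forch_KM ?enorm_ge0.
Qed.

(** Cauchy-Schwarz reduces the vector inequality to the scalar one, the flux being
    parallel to its argument. *)
Lemma fluxv_convex x y :
  dotv (fluxv x) (y - x) <= forch_Psi (enorm y) - forch_Psi (enorm x).
Proof.
apply: le_trans (forch_Psi_convex (enorm_ge0 _) (enorm_ge0 _)).
rewrite dotvC dotvDl -scaleN1r dotvZl mulN1r !(dotvC _ (fluxv x)) dotv_fluxv.
by rewrite mulrBr lerB// dotv_fluxv_le.
Qed.

Lemma enorm_fluxv x : enorm (fluxv x) = sl (enorm x).
Proof. by rewrite enormZ ger0_norm ?forch_K_ge0// forch_KM ?enorm_ge0. Qed.

(** A vector is its length times its direction: s(|x|) is Lipschitz in x, and the
    change of direction is weighted by s(|y|) <= |y| / a_0. *)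
Lemma fluxv_lip x y : enorm (fluxv x - fluxv y) <= 3 / a0 * enorm (x - y).
Proof.
have ai : 0 < a0^-1 by rewrite invr_gt0 coef0_gt0.
have [y0|yn0] := eqVneq (enorm y) 0.
  rewrite (enorm_eq0 y0) fluxv0 (subr0 (fluxv x)) (subr0 x) enorm_fluxv.
  apply: (le_trans (forch_s_le_lin (enorm_ge0 x))).
  by rewrite ler_wpM2r ?enorm_ge0//; lra.
have [x0|xn0] := eqVneq (enorm x) 0.
  rewrite (enorm_eq0 x0) fluxv0 (sub0r (fluxv y)) (sub0r y) !enormN enorm_fluxv.
  apply: (le_trans (forch_s_le_lin (enorm_ge0 y))).
  by rewrite ler_wpM2r ?enorm_ge0//; lra.
have xp : 0 < enorm x by rewrite lt_neqAle eq_sym xn0 enorm_ge0.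
have yp : 0 < enorm y by rewrite lt_neqAle eq_sym yn0 enorm_ge0.
have KE z : enorm z != 0 -> K (enorm z) = sl (enorm z) / enorm z.
  by move=> z0; rewrite -(@forch_KM (enorm z)) ?enorm_ge0// mulfK.
have -> : fluxv x - fluxv y = ((sl (enorm x) - sl (enorm y)) / enorm x) *: x +
  (sl (enorm y) / (enorm x * enorm y)) *: (enorm y *: x - enorm x *: y).
  rewrite /fluxv !KE// scalerBr !scalerA addrA -scalerDl.
  congr (_ *: _ - _ *: _); last by field; exact/andP.
  by field; exact/andP.
apply: le_trans (enormD _ _) _; rewrite !enormZ.
have h1 : `|(sl (enorm x) - sl (enorm y)) / enorm x| * enorm x <= a0^-1 * enorm (x - y).
  rewrite normrM normfV (ger0_norm (enorm_ge0 x)) divfK//.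
  apply: le_trans (forch_s_lip _ _) _; rewrite ler_wpM2l ?(ltW ai)//.
  exact: enormB_abs.
have h2 : enorm (enorm y *: x - enorm x *: y) <= 2 * enorm x * enorm (x - y).
  have -> : enorm y *: x - enorm x *: y =
     (enorm y - enorm x) *: x + enorm x *: (x - y).
    by rewrite scalerBl scalerBr addrA subrK.
  apply: le_trans (enormD _ _) _; rewrite !enormZ (ger0_norm (enorm_ge0 x)).
  have : `|enorm y - enorm x| <= enorm (x - y).
    by rewrite distrC enormB_abs.
  move=> h; rewrite -mulrA mulrDl mul1r lerD2r mulrC.
  by rewrite ler_wpM2l ?enorm_ge0.
have h3 : `|sl (enorm y) / (enorm x * enorm y)| <= a0^-1 / enorm x.
  rewrite ger0_norm ?divr_ge0 ?mulr_ge0 ?forch_s_ge0 ?enorm_ge0//.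
  rewrite ler_pdivrMr ?mulr_gt0//.
  have -> : a0^-1 / enorm x * (enorm x * enorm y) = a0^-1 * enorm y by rewrite mulrA divfK.
  by apply: forch_s_le_lin; exact: enorm_ge0.
have h4 : `|sl (enorm y) / (enorm x * enorm y)| * enorm (enorm y *: x - enorm x *: y)
   <= 2 / a0 * enorm (x - y).
  apply: le_trans (ler_pM _ _ h3 h2) _; rewrite ?enorm_ge0//.
  rewrite le_eqVlt; apply/orP; left; apply/eqP; field.
  by rewrite xn0 gt_eqF// coef0_gt0.
have -> : 3 / a0 * enorm (x - y) = a0^-1 * enorm (x - y) + 2 / a0 * enorm (x - y) by ring.
exact: lerD.
Qed.

End forchheimer_facts.

Section forchheimer_growth.
Context (R : realType) (N : nat) (coef expo : 'I_N.+1 -> R).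
Hypothesis H : forch_polynomial coef expo.
Local Notation sl := (forch_s coef expo).
Local Notation alpha := (expo ord_max).
Local Notation beta := (forch_beta expo).
Local Notation lam := (forch_lambda expo).

Lemma forch_betaE : beta = (alpha + 2) / (alpha + 1).
Proof.
rewrite /forch_beta /forch_a; field.
by rewrite gt_eqF//; have := alpha_gt0 H; lra.
Qed.

Lemma forch_lambdaE : lam = alpha + 2.
Proof.
rewrite /forch_lambda /forch_a; field.
have := alpha_gt0 H => a0; rewrite gt_eqF; last lra.
by rewrite addrAC subrr add0r oner_neq0.
Qed.

Lemma forch_beta_gt1 : 1 < beta.
Proof. by have a0 := alpha_gt0 H; rewrite forch_betaE ltr_pdivlMr; lra. Qed.

Lemma forch_beta_lt2 : beta < 2.
Proof. by have a0 := alpha_gt0 H; rewrite forch_betaE ltr_pdivrMr; lra. Qed.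

Lemma forch_lambda_ge2 : 2 <= lam.
Proof. by have a0 := alpha_gt0 H; rewrite forch_lambdaE; lra. Qed.

Lemma forch_conjugate : beta^-1 + lam^-1 = 1.
Proof.
have a0 := alpha_gt0 H; rewrite forch_betaE forch_lambdaE invf_div.
by field; rewrite gt_eqF//; lra.
Qed.

(** If s(xi) <= 1 then xi <= A s(xi), and xi^(beta-2) is at most delta^(beta-2) for
    xi > delta. If s(xi) > 1 then xi <= A s(xi)^(alpha+1), which is the stated
    growth since beta - 1 = 1/(alpha+1). The arbitrary delta is what makes
    vanishing dissipation force a vanishing gradient. *)
Lemma forch_growth (delta : R) : 0 < delta -> exists2 C : R, 0 < C &
  forall xi, 0 <= xi -> xi `^ beta <= delta `^ beta + C * (sl xi * xi).
Proof.
move=> d0; have a0 := alpha_gt0 H.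
have b0 : 0 < beta by apply: lt_trans forch_beta_gt1.
pose A := \sum_i coef i.
have A0 : 0 < A.
  apply: lt_le_trans (coef0_gt0 H) _.
  by rewrite /A (bigD1 ord0)//= lerDl sumr_ge0// => i _; exact: (coef_ge0 H).
have gA s (M : R) : 0 <= s -> s <= M -> 1 <= M -> forch_g coef expo s <= A * M `^ alpha.
  move=> s0 sM M1; rewrite mulr_suml; apply: ler_sum => i _.
  rewrite ler_wpM2l ?(coef_ge0 H)//.
  apply: (@le_trans _ _ (M `^ expo i)).
    by apply: ge0_ler_powR; rewrite ?nnegrE ?(expo_ge0 H)//; lra.
  by apply: ler_powR => //; exact: (expo_le_max H).
have bE : beta = 1 + (alpha + 1)^-1.
  by rewrite forch_betaE; field; rewrite gt_eqF//; lra.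
pose C := A * delta `^ (beta - 2) + A `^ (alpha + 1)^-1.
have C0 : 0 < C by rewrite addr_gt0// ?mulr_gt0// powR_gt0.
exists C => // xi xi0; have [s0 sE] := forch_sP H xi0.
have [xid|dxi] := leP xi delta.
  apply: (@le_trans _ _ (delta `^ beta)).
    by apply: ge0_ler_powR; rewrite ?nnegrE// ltW.
  by rewrite lerDl (mulr_ge0 (ltW C0))// mulr_ge0.
have xip : 0 < xi by exact: lt_trans dxi.
apply: ler_wpDl; first exact: powR_ge0.
have [s1|s1] := leP (sl xi) 1.
  have h : xi <= A * sl xi.
    rewrite -{1}sE mulrC ler_wpM2r//.
    by have := gA _ _ s0 s1 (lexx 1); rewrite powR1 mulr1.
  have -> : xi `^ beta = xi ^+ 2 * xi `^ (beta - 2).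
    rewrite [xi `^ (beta - 2)]powRB; last by rewrite (gt_eqF xip) implybT.
    by rewrite powR_mulrn// mulrC divfK// expf_neq0// (gt_eqF xip).
  apply: (@le_trans _ _ (A * delta `^ (beta - 2) * (sl xi * xi))); last first.
    by rewrite ler_wpM2r ?mulr_ge0// lerDl powR_ge0.
  rewrite [leRHS]mulrAC; apply: ler_pM; rewrite ?sqr_ge0 ?powR_ge0//.
    by rewrite mulrA expr2 ler_wpM2r.
  have -> : beta - 2 = - (2 - beta) by ring.
  rewrite !powRN lef_pV2 ?posrE ?powR_gt0//.
  apply: ge0_ler_powR; rewrite ?nnegrE; have := forch_beta_lt2; lra.
have h : xi `^ (alpha + 1)^-1 <= A `^ (alpha + 1)^-1 * sl xi.
  have -> : A `^ (alpha + 1)^-1 * sl xi = (A * sl xi `^ (alpha + 1)) `^ (alpha + 1)^-1.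
    rewrite powRM ?(ltW A0) ?powR_ge0// -powRrM mulfV ?powRr1// gt_eqF//; lra.
  apply: ge0_ler_powR; rewrite ?nnegrE ?mulr_ge0 ?powR_ge0 ?invr_ge0 ?(ltW A0)//; try lra.
  rewrite -{1}sE -(mulr_powRB1 s0); last lra.
  by rewrite addrK mulrCA ler_wpM2l// gA// (ltW s1).
apply: (@le_trans _ _ (A `^ (alpha + 1)^-1 * (sl xi * xi))); last first.
  by rewrite ler_wpM2r ?mulr_ge0// lerDr mulr_ge0 ?powR_ge0// (ltW A0).
rewrite bE powRD ?(gt_eqF xip) ?implybT// powRr1// mulrA mulrC.
by rewrite ler_wpM2r.
Qed.

End forchheimer_growth.

(** * Differential inequalities on the half-line *)

Section derive_tools.
Context (R : realType).
Implicit Types (f u : R -> R) (x t : R).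

Lemma is_derive1P f x (l : R) :
  is_derive x (1 : R) f l <-> h^-1 * (f (h + x) - f x) @[h --> 0^'] --> l.
Proof.
split => [[df <-]|fl].
  have := df; rewrite /derivable => /cvg_ex[l' fl'].
  have E : 'D_1 f x = l' by apply/cvg_lim.
  rewrite E; apply: cvg_trans fl'; apply: near_eq_cvg; near=> h.
  by rewrite /= /GRing.scale/= mulr1.
have fl' : h^-1 *: ((f \o shift x) (h *: (1 : R)) - f x) @[h --> 0^'] --> l.
  apply: cvg_trans fl; apply: near_eq_cvg; near=> h.
  by rewrite /= /GRing.scale/= mulr1.
by apply: DeriveDef; [apply/cvg_ex; exists l|apply/cvg_lim].
Unshelve. all: by end_near. Qed.

(** Differentiates a remainder that is only known to be dominated by a function
    with a critical zero. *)
Lemma is_derive1_squeeze (W U : R -> R) x (C : R) :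
  (forall s, `|W s| <= C * U s) -> W x = 0 -> U x = 0 ->
  is_derive x (1 : R) U 0 -> is_derive x (1 : R) W 0.
Proof.
move=> WU W0 U0 /is_derive1P dU; apply/is_derive1P.
rewrite W0 U0 in dU *; apply/cvgr0Pnorm_lt => e e0.
have C0 : 0 < `|C| + 1 by rewrite ltr_pwDr.
move/cvgr0Pnorm_lt : dU => /(_ (e / (`|C| + 1)) (divr_gt0 e0 C0)).
apply: filterS => h; rewrite !subr0 !normrM => hU.
have := WU (h + x) => /(le_trans)/(_ (ler_norm _)); rewrite normrM => hW.
apply: le_lt_trans (_ : (`|C| + 1) * (`|h^-1| * `|U (h + x)|) < e).
  rewrite mulrCA ler_wpM2l//; apply: le_trans hW _.
  by rewrite ler_wpM2r// lerDl.
by rewrite mulrC -ltr_pdivlMr.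
Qed.

Lemma is_derive1_continuous f x (l : R) : is_derive x (1 : R) f l -> {for x, continuous f}.
Proof. by move=> [df _]; apply: differentiable_continuous; apply/derivable1_diffP. Qed.

Lemma le_of_derive (u u' : R -> R) a b c : a <= b -> continuous u ->
  (forall t, a < t < b -> is_derive t (1 : R) u (u' t)) ->
  (forall t, a < t < b -> u' t <= c) -> u b - u a <= c * (b - a).
Proof.
rewrite le_eqVlt => /predU1P[->|ab] cu du u'c; first by rewrite !subrr mulr0.
have du' x : x \in `]a, b[ -> is_derive x (1 : R) u (u' x).
  by rewrite in_itv/= => /du.
have [x] := MVT ab du' (continuous_subspaceT cu).
rewrite in_itv/= => /u'c h ->.
by rewrite ler_wpM2r// subr_ge0 ltW.
Qed.

(** After the last time at which u is at most M, the function would be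
    nonincreasing. *)
Lemma barrier (u u' : R -> R) a b M : a <= b -> continuous u ->
  (forall t, a < t -> is_derive t (1 : R) u (u' t)) ->
  (forall t, a < t < b -> M < u t -> u' t <= 0) -> u a <= M -> u b <= M.
Proof.
move=> ab cu du u'0 uaM; rewrite leNgt; apply/negP => Mub.
pose S := [set t | a <= t <= b] `&` [set t | u t <= M].
have Sa : S a by split => //=; rewrite lexx.
have ubS : ubound S b by move=> t [/= /andP[_]].
have cS : closed S.
  apply: closedI.
    rewrite (_ : [set _ | _] = `[a, b]%classic); first exact: interval_closed.
    by apply/seteqP; split => t /=; rewrite in_itv.
  rewrite (_ : [set _ | _] = u @^-1` `]-oo, M]%classic).
    by apply: preimage_closed => //; exact: interval_closed.
  by apply/seteqP; split => t /=; rewrite in_itv.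
have : S (sup S) by apply: cS; apply: closure_sup; [exists a|exists b].
set c := sup S => -[/= /andP[ac cb] ucM].
have aboveM t : c < t <= b -> M < u t.
  move=> /andP[ct tb]; rewrite ltNge; apply/negP => utM.
  have : t <= c by apply: ub_le_sup; [exists b|split => //=; rewrite tb (le_trans ac)//ltW].
  by rewrite leNgt ct.
have : u b - u c <= 0 * (b - c).
  apply: (@le_of_derive u u') => // t /andP[ct tb]; first by apply: du; exact: le_lt_trans ct.
  by apply: u'0; [rewrite tb (le_lt_trans ac)|apply: aboveM; rewrite ct ltW].
rewrite mul0r subr_le0 => ubc.
by have := lt_le_trans Mub (le_trans ubc ucM); rewrite ltxx.
Qed.

(** Otherwise u would decrease linearly for ever; once below M it stays there by
    [barrier]. *)
Lemma eventually_below (u u' : R -> R) T0 M (del : R) : 0 < del -> continuous u ->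
  (forall t, T0 < t -> is_derive t (1 : R) u (u' t)) ->
  (forall t, T0 < t -> M < u t -> u' t <= - del) ->
  exists2 T1, T0 <= T1 & forall t, T1 <= t -> u t <= M.
Proof.
move=> d0 cu du u'd.
suff [t1 t10 ut1] : exists2 t1, T0 <= t1 & u t1 <= M.
  exists t1 => // t t1t; apply: (@barrier u u' t1 t M) => //.
    by move=> s ts; apply: du; exact: le_lt_trans ts.
  move=> s /andP[ts _] Mus; apply: (le_trans (u'd s _ Mus)); first exact: le_lt_trans ts.
  by rewrite oppr_le0 ltW.
apply: contrapT => /forall2NP nu.
have Mu s : T0 <= s -> M < u s.
  by move=> Ts; case: (nu s) => // /negP; rewrite -ltNge.
pose t := T0 + (u T0 - M) / del.
have Tt : T0 <= t by rewrite lerDl divr_ge0 ?(ltW d0)// subr_ge0 ltW// Mu.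
have : u t - u T0 <= - del * (t - T0).
  apply: (@le_of_derive u u') => // s /andP[Ts _]; first exact: du.
  by apply: u'd => //; apply: Mu; exact: ltW.
have -> : - del * (t - T0) = M - u T0 by rewrite /t; field; rewrite gt_eqF.
by have := Mu t Tt; lra.
Qed.

(** The derivative of e^(s/2) E(s) is at most e^(s/2) r(s). The continuity of Q
    serves the fundamental theorem of calculus, while r is only measurable and its
    integral may be infinite. *)
Lemma gronwall_integral (E Q r : R -> R) t : 0 <= t -> continuous E -> continuous Q ->
  (forall s : R, 0 < s -> is_derive s (1 : R) E (Q s)) ->
  measurable_fun (`[0, t]%classic : set R) r -> (forall s, 0 <= s -> 0 <= r s) ->
  (forall s, 0 <= s -> Q s <= - (2^-1 * E s) + r s) ->
  ((E t)%:E <= (expR (- 2^-1 * t) * E 0)%:E +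
    \int[lebesgue_measure]_(s in `[0%R, t]) (expR (- 2^-1 * (t - s)) * r s)%:E)%E.
Proof.
move=> t0 cE cQ dE mr r0 Qr.
have i0 : (0 <= \int[lebesgue_measure]_(s in `[0%R, t]) (expR (- 2^-1 * (t - s)) * r s)%:E)%E.
  apply: integral_ge0 => s /=; rewrite in_itv/= => /andP[s0 _].
  by rewrite lee_fin mulr_ge0 ?expR_ge0 ?r0.
move: t0; rewrite le_eqVlt => /predU1P[tE|t0].
  by rewrite -tE in i0 *; rewrite mulr0 expR0 mul1r leeDl.
have [->|ioo] := eqVneq (\int[lebesgue_measure]_(s in `[0%R, t]) (expR (- 2^-1 * (t - s)) * r s)%:E)%E +oo%E.
  by rewrite addey// leey.
pose e s := expR (- 2^-1 * (t - s)) : R.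
have de s : is_derive s (1 : R) e (2^-1 * e s).
  rewrite /e.
  have -> : (fun s => expR (- 2^-1 * (t - s))) = expR \o (fun s => - 2^-1 * (t - s)) by [].
  rewrite mulrC; apply: is_derive1_comp.
  have -> : (fun s => - 2^-1 * (t - s)) = (cst (- 2^-1 * t) + (2^-1 \*: id) : R -> R).
    by apply/funext => z; rewrite fctE /= /GRing.scale/=; ring.
  by apply: is_derive_eq; rewrite add0r /GRing.scale/= mulr1.
have ce : continuous e by move=> s; exact: is_derive1_continuous (de s).
pose G s := e s * E s. pose g s := e s * (2^-1 * E s + Q s).
have dG (s : R) : 0 < s -> is_derive s (1 : R) G (g s).
  move=> /dE ds; have -> : G = (e * E : R -> R) by [].
  by apply: is_derive_eq; rewrite /g /GRing.scale/=; ring.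
have cg : continuous g.
  by move=> s; apply: cvgM; [exact: ce|apply: cvgD; [apply: cvgMr; exact: cE|exact: cQ]].
have cG : continuous G by move=> s; apply: cvgM; [exact: ce|exact: cE].
have FTC : (\int[lebesgue_measure]_(x in `[0%R, t]) (g x)%:E = (G t)%:E - (G 0)%:E)%E.
  apply: continuous_FTC2 => //.
  - exact: continuous_subspaceT.
  - split.
    + by move=> x; rewrite in_itv/= => /andP[x0 _]; case: (dG x x0).
    + by apply: cvg_at_right_filter; exact: cG.
    + by apply: cvg_at_left_filter; exact: cG.
  - by move=> x; rewrite in_itv/= => /andP[x0 _]; rewrite derive1E; case: (dG x x0).
have : (\int[lebesgue_measure]_(x in `[0%R, t]) (g x)%:E <=
   \int[lebesgue_measure]_(s in `[0%R, t]) (e s * r s)%:E)%E.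
  apply: le_integral => //.
  - by apply: continuous_compact_integrable; [exact: segment_compact|exact: continuous_subspaceT].
  - apply/integrableP; split.
      apply/measurable_EFinP; apply: measurable_funM => //.
      by apply: measurable_funTS; exact: continuous_measurable_fun.
    apply: (@le_lt_trans _ _ (\int[lebesgue_measure]_(s in `[0%R, t]) (e s * r s)%:E)%E); last by rewrite ltey.
    rewrite le_eqVlt; apply/orP; left; apply/eqP; apply: eq_integral.
    move=> s; rewrite inE/= in_itv/= => /andP[s0 _].
    by rewrite /= ger0_norm// mulr_ge0 ?expR_ge0 ?r0.
  - move=> s; rewrite inE/= in_itv/= => /andP[s0 _].
    by rewrite lee_fin ler_wpM2l ?expR_ge0//; have := Qr s s0; lra.
rewrite FTC /G /e subrr mulr0 expR0 mul1r subr0 => h.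
by rewrite addeC -leeBlDr.
Qed.

End derive_tools.
(** * Energy estimates for gradient flows *)

Section energy_inequalities.
Context (R : realType) (be lam : R).
Hypotheses (be1 : 1 < be) (be2 : be < 2) (lam2 : 2 <= lam) (bl : be^-1 + lam^-1 = 1).

Lemma sqr_le_powR (x : R) : 0 <= x -> x ^+ 2 <= 1 + x `^ lam.
Proof.
move=> x0; have [x1|x1] := leP x 1.
  by rewrite ler_wpDr ?powR_ge0// expr_le1.
by rewrite ler_wpDl// -powR_mulrn// ler_powR// ltW.
Qed.

(** Young's inequality with the conjugate exponents be and lam, scaled so that the
    part in D is absorbed by a quarter of the dissipation. *)
Lemma absorb_source (Cs C1 : R) : 0 < Cs -> 0 < C1 -> exists2 Ca : R, 0 < Ca &
  forall D X ft ph ny, 0 <= D -> 0 <= ft -> 0 <= ph ->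
    D <= 1 + C1 * X -> ny <= Cs * (D `^ be^-1 + ph) ->
    ft * ny <= 4^-1 * X + Ca * (1 + ft `^ lam + ph ^+ 2).
Proof.
move=> Cs0 C10; have b0 : 0 < be by exact: lt_trans be1.
have l0 : 0 < lam by exact: lt_le_trans lam2.
(* With this weight the first term of Young's inequality is D / (4 C1). *)
pose eta := (be / (4 * C1)) `^ be^-1.
have eta0 : 0 < eta by rewrite powR_gt0// divr_gt0// mulr_gt0.
have etaE : eta `^ be = be / (4 * C1).
  by rewrite /eta powRVK ?gt_eqF// divr_ge0 ?ltW// mulr_gt0.
pose Ca := (Cs / eta) `^ lam / lam.
have Ca0 : 0 < Ca by rewrite divr_gt0// powR_gt0// divr_gt0.
exists (Ca + (4 * C1)^-1 + Cs).
  by rewrite !addr_gt0// invr_gt0 mulr_gt0.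
move=> D X ft ph ny D0 ft0 ph0 DX nyle.
have h1 : ft * ny <= ft * (Cs * D `^ be^-1) + Cs * (ft * ph).
  by apply: le_trans (ler_wpM2l ft0 nyle) _; rewrite le_eqVlt; apply/orP; left; apply/eqP; ring.
have h2 : ft * ph <= 2^-1 * (1 + ft `^ lam) + 2^-1 * ph ^+ 2.
  have := sqr_le_powR ft0; have := sqr_ge0 (ft - ph); rewrite sqrrB; nra.
have h3 : ft * (Cs * D `^ be^-1) <= D / (4 * C1) + Ca * ft `^ lam.
  have Ce0 : 0 <= Cs / eta by rewrite divr_ge0// ltW.
  have := @conjugate_powR R (eta * D `^ be^-1) (Cs / eta * ft) be lam.
  move=> /(_ (mulr_ge0 (ltW eta0) (powR_ge0 _ _)) (mulr_ge0 Ce0 ft0) b0 l0 bl).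
  rewrite (powRM _ (ltW eta0)) ?powR_ge0// (powRM _ Ce0)// powRVK ?gt_eqF// etaE.
  have -> : eta * D `^ be^-1 * (Cs / eta * ft) = ft * (Cs * D `^ be^-1).
    by field; rewrite gt_eqF.
  move=> /le_trans; apply; rewrite le_eqVlt; apply/orP; left; apply/eqP.
  by rewrite /Ca; field; rewrite !gt_eqF.
have h4 : D / (4 * C1) <= 4^-1 * X + (4 * C1)^-1.
  rewrite ler_pdivrMr ?mulr_gt0//; apply: le_trans DX _.
  by rewrite le_eqVlt; apply/orP; left; apply/eqP; field; rewrite gt_eqF.
have p1 : 0 <= ft `^ lam by exact: powR_ge0.
have p2 : 0 <= ph ^+ 2 by exact: sqr_ge0.
have i0 : 0 < (4 * C1)^-1 by rewrite invr_gt0 mulr_gt0.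
apply: le_trans h1 _.
apply: (@le_trans _ _ (4^-1 * X + (4 * C1)^-1 + Ca * ft `^ lam + Cs * (2^-1 * (1 + ft `^ lam) + 2^-1 * ph ^+ 2))).
  by have := ler_wpM2l (ltW Cs0) h2; lra.
move: p1 p2 i0 Ca0 Cs0; move: (ft `^ lam) (ph ^+ 2) ((4 * C1)^-1) => a b c a0 b0' c0 Ca0 Cs0.
nra.
Qed.

(** By the Sobolev inequality a large ny forces a large D, hence a dissipation that
    outweighs the data. *)
Lemma kinetic_decay (Cp Cs C1 : R) : 0 < Cp -> 0 < Cs -> 0 < C1 -> exists2 C2 : R, 0 < C2 &
  forall D X ft ph ny dN, 0 <= D -> 0 <= X -> 0 <= ft -> 0 <= ph -> 0 <= ny ->
    D <= 1 + C1 * X -> ny <= Cs * (D `^ be^-1 + ph) ->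
    dN <= - (3 / 4 * X) + Cp * ph ^+ 2 + ft * ny ->
    C2 * (1 + ft `^ lam + ph ^+ 2) < ny `^ be -> dN <= - 1.
Proof.
move=> Cp0 Cs0 C10; have b0 : 0 < be by exact: lt_trans be1.
have [Ca Ca0 abs] := absorb_source Cs0 C10.
pose Cc := Cs `^ be * 2 `^ be * (2 + C1).
have Cc0 : 0 < Cc by rewrite !mulr_gt0 ?powR_gt0// addr_gt0.
(* Large enough for X / 2 to exceed (Cp + Ca + 1) (1 + g), by [h2] below. *)
exists (Cc * (2 * (Cp + Ca + 1) + 1)).
  by rewrite mulr_gt0// addr_gt0// mulr_gt0// !addr_gt0.
move=> D X ft ph ny dN D0 X0 ft0 ph0 ny0 DX nyle dNle big.
have h1 := abs D X ft ph ny D0 ft0 ph0 DX nyle.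
set g := ft `^ lam + ph ^+ 2.
have p1 : 0 <= ft `^ lam by exact: powR_ge0.
have p2 : 0 <= ph ^+ 2 by exact: sqr_ge0.
have g0 : 0 <= g by rewrite addr_ge0.
have h2 : ny `^ be <= Cc * (X + 1 + g).
  apply: (@le_trans _ _ ((Cs * (D `^ be^-1 + ph)) `^ be)).
    by apply: ge0_ler_powR; rewrite ?nnegrE ?(ltW b0)// mulr_ge0 ?addr_ge0 ?powR_ge0// ltW.
  rewrite powRM ?addr_ge0 ?powR_ge0 ?(ltW Cs0)// /Cc -!mulrA ler_wpM2l ?powR_ge0//.
  apply: le_trans (powRD_le _ _ _) _; rewrite ?powR_ge0 ?(ltW b0)//.
  rewrite powRVK ?gt_eqF// ler_wpM2l ?powR_ge0//.
  have := powR_le_sqr ph0 b0 (ltW be2); rewrite /g; nra.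
have h3 : (2 * (Cp + Ca + 1) + 1) * (1 + g) < X + 1 + g.
  rewrite -(ltr_pM2l Cc0) mulrA; apply: lt_le_trans h2.
  by move: big; rewrite addrA.
have h4 : Cp * ph ^+ 2 <= Cp * (1 + g).
  by rewrite ler_wpM2l ?(ltW Cp0)//; rewrite /g; lra.
have h5 : 1 + ft `^ lam + ph ^+ 2 = 1 + g by rewrite /g addrA.
rewrite h5 in h1.
move: h3 h1 h4 dNle g0; move: (Cp * ph ^+ 2) (ft * ny) => u v; nra.
Qed.

(** Here ny and nv stand for |y| and |y'|. In the sum of the two hypotheses the
    term - nv^2 absorbs the products that contain nv, and half of X remains on the
    left, which is at least E / 2. *)
Lemma energy_decay (Cp E X Q ft ph pht ny nv : R) : 0 <= Cp ->
  0 <= X -> E <= X -> 0 <= ft -> 0 <= ny -> 0 <= nv ->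
  X <= ft * ny + nv * ny + 4^-1 * X + Cp * ph ^+ 2 ->
  Q <= ft * nv - nv ^+ 2 + 4^-1 * X + Cp * pht ^+ 2 ->
  Q <= - (2^-1 * E) + (3 + 2 * Cp) * (ft ^+ 2 + ny ^+ 2 + ph ^+ 2 + pht ^+ 2).
Proof.
move=> Cp0 X0 EX ft0 ny0 nv0 h1 h2.
have e1 : ft * ny <= 2^-1 * (ft ^+ 2 + ny ^+ 2).
  by have := sqr_ge0 (ft - ny); rewrite sqrrB; lra.
have e2 : nv * ny <= 4^-1 * nv ^+ 2 + ny ^+ 2.
  by have := sqr_ge0 (2^-1 * nv - ny); rewrite sqrrB exprMn; lra.
have e3 : ft * nv <= 2^-1 * (ft ^+ 2 + nv ^+ 2).
  by have := sqr_ge0 (ft - nv); rewrite sqrrB; lra.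
have a1 : 0 <= ft ^+ 2 by exact: sqr_ge0.
have a2 : 0 <= ny ^+ 2 by exact: sqr_ge0.
have a3 : 0 <= Cp * ph ^+ 2 by rewrite mulr_ge0 ?sqr_ge0.
have a4 : 0 <= Cp * pht ^+ 2 by rewrite mulr_ge0 ?sqr_ge0.
have a5 : 0 <= ph ^+ 2 by exact: sqr_ge0.
have a6 : 0 <= pht ^+ 2 by exact: sqr_ge0.
have b1 : 0 <= Cp * ft ^+ 2 by rewrite mulr_ge0.
have b2 : 0 <= Cp * ny ^+ 2 by rewrite mulr_ge0.
rewrite !mulrDl !mulrDr; lra.
Qed.

End energy_inequalities.

Lemma energy_sum_le (R : realFieldType) (c a j i : R) : 0 <= c -> 0 <= a -> 0 <= j -> 0 <= i ->
  2 * c * a + j + c * i <= (2 * c + 1 + c) * (a + j + i).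
Proof.
move=> c0 a0 j0 i0; rewrite -subr_ge0.
have -> : (2 * c + 1 + c) * (a + j + i) - (2 * c * a + j + c * i) =
  (1 + c) * a + 3 * c * j + (2 * c + 1) * i by ring.
by rewrite !addr_ge0// mulr_ge0// ?addr_ge0// mulr_ge0.
Qed.

Section gradient_flow.
Context (R : realType) (be lam : R).
Hypotheses (be1 : 1 < be) (be2 : be < 2) (lam2 : 2 <= lam) (bl : be^-1 + lam^-1 = 1).

(** The part of the semidiscrete problem on which the estimates depend: y are the
    coordinates of the unknown, z those of the projected boundary data with
    derivative zeta, and J is a potential of Phi. D stands for the integral of
    |grad rho_h|^beta, and ft, ph, pht for the norms of the source, of phi and of
    phi_t. Stating J through convexity inequalities spares the differentiation of
    an integral. *)
Record gradient_flow (Cp Cs L : R) (Cd : R -> R) (k : nat) (Phi : 'rV[R]_k -> 'rV[R]_k)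
  (J : 'rV[R]_k -> R) (y z F zeta : R -> 'rV[R]_k) (D ft ph pht : R -> R) : Prop :=
 GradientFlow {
  gf_convex : forall p q, dotv (Phi p) (q - p) <= J q - J p ;
  gf_J_le : forall p, J p <= dotv (Phi p) p ;
  gf_J_ge : forall p, dotv (Phi p) p <= 2 * J p ;
  gf_X_ge0 : forall p, 0 <= dotv (Phi p) p ;
  gf_lip : forall p q, enorm (Phi q - Phi p) <= L * enorm (q - p) ;
  gf_D_ge0 : forall t, 0 <= t -> 0 <= D t ;
  gf_ft_ge0 : forall t, 0 <= t -> 0 <= ft t ;
  gf_ph_ge0 : forall t, 0 <= t -> 0 <= ph t ;
  gf_pht_ge0 : forall t, 0 <= t -> 0 <= pht t ;
  gf_D : forall del t, 0 < del -> 0 <= t ->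
    D t <= del + Cd del * dotv (Phi (y t + z t)) (y t + z t) ;
  gf_sobolev : forall t, 0 <= t -> enorm (y t) <= Cs * (D t `^ be^-1 + ph t) ;
  gf_z : forall t, 0 <= t -> dotv (Phi (y t + z t)) (z t) <=
    4^-1 * dotv (Phi (y t + z t)) (y t + z t) + Cp * ph t ^+ 2 ;
  gf_zeta : forall t, 0 <= t -> dotv (Phi (y t + z t)) (zeta t) <=
    4^-1 * dotv (Phi (y t + z t)) (y t + z t) + Cp * pht t ^+ 2 ;
  gf_F : forall t v, 0 <= t -> dotv (F t) v <= ft t * enorm v ;
  gf_cy : forall i, continuous (fun t => y t ord0 i) ;
  gf_cz : forall i, continuous (fun t => z t ord0 i) ;
  gf_cF : forall i, continuous (fun t => F t ord0 i) ;
  gf_czeta : forall i, continuous (fun t => zeta t ord0 i) ;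
  gf_dy : forall i (t : R), 0 < t -> is_derive t (1 : R) (fun t => y t ord0 i)
     (F t ord0 i - Phi (y t + z t) ord0 i) ;
  gf_dz : forall i (t : R), 0 < t -> is_derive t (1 : R) (fun t => z t ord0 i) (zeta t ord0 i) }.

Section one_flow.
Context (Cp Cs L : R) (Cd : R -> R) (k : nat) (Phi : 'rV[R]_k -> 'rV[R]_k)
  (J : 'rV[R]_k -> R) (y z F zeta : R -> 'rV[R]_k) (D ft ph pht : R -> R).
Hypothesis (GF : gradient_flow Cp Cs L Cd Phi J y z F zeta D ft ph pht).
Hypotheses (Cp0 : 0 < Cp) (Cs0 : 0 < Cs) (L0 : 0 <= L).

Let p t := y t + z t.
Let X t := dotv (Phi (p t)) (p t).
Let y' t := F t - Phi (p t).
Let Q t := dotv (Phi (p t)) (y' t + zeta t).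

Lemma gf_cp i : continuous (fun t => p t ord0 i).
Proof.
move=> t; rewrite /p; under eq_fun do rewrite mxE.
by apply: cvgD; [exact: (gf_cy GF)|exact: (gf_cz GF)].
Qed.

Lemma gf_dp i (t : R) : 0 < t -> is_derive t (1 : R) (fun t => p t ord0 i) ((y' t + zeta t) ord0 i).
Proof.
move=> t0; have h1 := gf_dy GF i t0; have h2 := gf_dz GF i t0.
have -> : (fun t => p t ord0 i) = (fun t => y t ord0 i) + (fun t => z t ord0 i).
  by apply/funext => s; rewrite /p mxE.
by apply: is_derive_eq; rewrite !mxE.
Qed.

Lemma continuous_dotv (u v : R -> 'rV[R]_k) :
  (forall i, continuous (fun t => u t ord0 i)) -> (forall i, continuous (fun t => v t ord0 i)) ->
  continuous (fun t => dotv (u t) (v t)).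
Proof.
move=> cu cv; apply: (sum_continuous (F := fun i t => u t ord0 i * v t ord0 i)) => i t.
by apply: cvgM; [exact: cu|exact: cv].
Qed.

Lemma gf_cPhi i : continuous (fun t => Phi (p t) ord0 i).
Proof.
move=> t; apply/cvgrPdist_lt => e e0.
have : (\sum_j `|p s ord0 j - p t ord0 j|) @[s --> t] --> 0.
  rewrite [X in _ --> X](_ : 0 = \sum_j `|p t ord0 j - p t ord0 j|); last first.
    by rewrite big1// => j _; rewrite subrr normr0.
  apply: (sum_continuous (F := fun j s => `|p s ord0 j - p t ord0 j|)) => j s.
  by apply: cvg_norm; apply: cvgB; [exact: gf_cp|exact: cvg_cst].
have L1 : 0 < L + 1 by rewrite ltr_wpDl.
move/cvgr0Pnorm_lt => /(_ (e / (L + 1)) (divr_gt0 e0 L1)).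
apply: filterS => s; rewrite ger0_norm ?sumr_ge0// ltr_pdivlMr// => hs.
apply: le_lt_trans hs.
rewrite distrC.
have -> : Phi (p s) ord0 i - Phi (p t) ord0 i = (Phi (p s) - Phi (p t)) ord0 i by rewrite !mxE.
apply: le_trans (coord_le_enorm _ _) _; apply: le_trans (gf_lip GF _ _) _.
rewrite mulrC; apply: ler_pM; rewrite ?enorm_ge0//; last by rewrite lerDl.
apply: le_trans (enorm_le_sum _) _.
by apply: ler_sum => j _; rewrite !mxE.
Qed.

(** The convexity inequality at p(s) and at p(t) and the Lipschitz bound for Phi
    squeeze J (p s) - J (p t) - Phi (p t) . (p s - p t) between 0 and
    L |p s - p t|^2, whose derivative at t is 0. *)
Lemma gf_dE (t : R) : 0 < t -> is_derive t (1 : R) (fun s => J (p s)) (Q t).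
Proof.
move=> t0.
pose V s := \sum_i (Phi (p t) ord0 i * (p s ord0 i - p t ord0 i)).
have dV : is_derive t (1 : R) V (Q t).
  have -> : V = \sum_i (Phi (p t) ord0 i \*: ((fun s => p s ord0 i) - cst (p t ord0 i))).
    apply/funext => s; rewrite /V fct_sumE; apply: eq_bigr => i _.
    by rewrite /= /GRing.scale/= !fctE.
  apply: is_derive_eq.
    apply: is_derive_sum => i; apply: is_deriveZ; apply: is_deriveB.
    exact: gf_dp.
  by apply: eq_bigr => i _; rewrite subr0.
pose U s := \sum_i (p s ord0 i - p t ord0 i) ^+ 2.
have dU : is_derive t (1 : R) U 0.
  have -> : U = \sum_i (((fun s => p s ord0 i) - cst (p t ord0 i)) ^+ 2 : R -> R).
    apply/funext => s; rewrite /U fct_sumE; apply: eq_bigr => i _.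
    by rewrite exprfctE !fctE.
  apply: is_derive_eq.
    apply: is_derive_sum => i; apply: is_deriveX; apply: is_deriveB.
    exact: gf_dp.
  by rewrite big1// => i _; rewrite !fctE subrr/= expr1 mulr0 scale0r.
have UE s : U s = enorm (p s - p t) ^+ 2.
  by rewrite sqr_enorm; apply: eq_bigr => i _; rewrite !mxE expr2.
have VE s : V s = dotv (Phi (p t)) (p s - p t).
  by apply: eq_bigr => i _; rewrite !mxE.
pose W s := J (p s) - J (p t) - V s.
have dW : is_derive t (1 : R) W 0.
  apply: (@is_derive1_squeeze R W U t L) => //.
  - move=> s; have W0 : 0 <= W s by rewrite /W VE subr_ge0 (gf_convex GF).
    rewrite ger0_norm// UE.
    have h := gf_convex GF (p s) (p t).
    have h2 : W s <= dotv (Phi (p s) - Phi (p t)) (p s - p t).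
      by rewrite /W VE dotvBl; move: h; rewrite !dotvBr; lra.
    apply: (le_trans h2); apply: le_trans (dotv_le _ _) _.
    by rewrite expr2 mulrA ler_wpM2r ?enorm_ge0// (gf_lip GF).
  - by rewrite /W /V subrr sub0r big1 ?oppr0// => i _; rewrite subrr mulr0.
  - by rewrite UE subrr enorm0 expr0n.
have -> : (fun s => J (p s)) = W + V + cst (J (p t)).
  by apply/funext => s; rewrite !fctE /W; ring.
by apply: is_derive_eq; rewrite add0r addr0.
Qed.

Let Nk t := 2^-1 * dotv (y t) (y t).

Lemma gf_dN (t : R) : 0 < t -> is_derive t (1 : R) Nk (dotv (y' t) (y t)).
Proof.
move=> t0.
have -> : Nk = 2^-1 \*: (\sum_i ((fun s => y s ord0 i) ^+ 2 : R -> R)).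
  apply/funext => s; rewrite -[RHS]/(2^-1 * (\sum_i ((fun s => y s ord0 i) ^+ 2 : R -> R)) s) fct_sumE.
  by congr (_ * _); apply: eq_bigr => i _; rewrite exprfctE expr2.
apply: is_derive_eq.
  apply: is_deriveZ; apply: is_derive_sum => i; apply: is_deriveX.
  exact: (gf_dy GF).
rewrite /GRing.scale/= mulr_sumr; apply: eq_bigr => i _.
by rewrite !mxE /= expr1; field.
Qed.

Lemma gf_cN : continuous Nk.
Proof.
by move=> t; apply: cvgMr; apply: continuous_dotv => i; exact: (gf_cy GF).
Qed.

(** Derivatives are only given for t > 0, but continuity is needed at 0 too. It
    comes from convexity, which squeezes J (p s) between
    J (p t) + Phi (p t) . (p s - p t) and J (p t) + Phi (p s) . (p s - p t). *)
Lemma gf_cE : continuous (fun s => J (p s)).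
Proof.
move=> t.
have cV : continuous (fun s => dotv (Phi (p t)) (p s - p t)).
  apply: continuous_dotv => i s; first exact: cvg_cst.
  under eq_fun do rewrite rowBE.
  by apply: cvgB; [exact: gf_cp|exact: cvg_cst].
have cV' : continuous (fun s => dotv (Phi (p s)) (p s - p t)).
  apply: continuous_dotv => i s; first exact: gf_cPhi.
  under eq_fun do rewrite rowBE.
  by apply: cvgB; [exact: gf_cp|exact: cvg_cst].
have E0 v : dotv v (p t - p t) = 0 :> R.
  by rewrite dotvBr subrr.
apply: (@squeeze_cvgr _ _ _ _ (fun s => J (p t) + dotv (Phi (p t)) (p s - p t))
   (fun s => J (p t) + dotv (Phi (p s)) (p s - p t))).
- near=> s; have := gf_convex GF (p t) (p s); have := gf_convex GF (p s) (p t).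
  rewrite !dotvBr => h1 h2.
  by apply/andP; split; lra.
- rewrite -[X in _ --> X]addr0 -{2}(E0 (Phi (p t))).
  by apply: cvgD; [exact: cvg_cst|exact: cV].
- rewrite -[X in _ --> X]addr0 -{2}(E0 (Phi (p t))).
  by apply: cvgD; [exact: cvg_cst|exact: cV'].
Unshelve. all: by end_near. Qed.

Lemma gf_cQ : continuous Q.
Proof.
apply: continuous_dotv => i t; first exact: gf_cPhi.
under eq_fun do rewrite rowDE rowBE.
apply: cvgD; last exact: (gf_czeta GF).
by apply: cvgB; [exact: (gf_cF GF)|exact: gf_cPhi].
Qed.

(** The equation tested with y = p - z. *)
Lemma gf_dN_le t : 0 <= t ->
  dotv (y' t) (y t) <= - (3 / 4 * X t) + Cp * ph t ^+ 2 + ft t * enorm (y t).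
Proof.
move=> t0; have hz := gf_z GF t0; have hF := gf_F GF (y t) t0.
have E : dotv (y' t) (y t) = dotv (F t) (y t) - X t + dotv (Phi (p t)) (z t).
  by rewrite /y' dotvBl /X {3}/p dotvDr; ring.
rewrite E; move: hz; rewrite -/(p t) -/(X t); lra.
Qed.

(** The equation tested with y bounds the dissipation X, and tested with y' it
    bounds the derivative Q of the energy. *)
Lemma gf_Q_le t : 0 <= t -> Q t <= - (2^-1 * J (p t)) +
  (3 + 2 * Cp) * (ft t ^+ 2 + enorm (y t) ^+ 2 + ph t ^+ 2 + pht t ^+ 2).
Proof.
move=> t0; have hz := gf_z GF t0; have hzt := gf_zeta GF t0.
apply: (@energy_decay _ _ _ (X t) _ _ _ _ _ (enorm (y' t))) => //.
- exact: ltW.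
- exact: (gf_X_ge0 GF).
- exact: (gf_J_le GF).
- exact: (gf_ft_ge0 GF).
- exact: enorm_ge0.
- exact: enorm_ge0.
- have E : X t = dotv (F t) (y t) - dotv (y' t) (y t) + dotv (Phi (p t)) (z t).
    by rewrite /y' dotvBl /X {2}/p dotvDr; ring.
  have hF := gf_F GF (y t) t0.
  have hy : - dotv (y' t) (y t) <= enorm (y' t) * enorm (y t).
    by have := dotv_le (- y' t) (y t); rewrite dotvNl enormN.
  rewrite {1}E; move: hz; rewrite -/(p t) -/(X t); lra.
- have E : Q t = dotv (F t) (y' t) - enorm (y' t) ^+ 2 + dotv (Phi (p t)) (zeta t).
    by rewrite sqr_enorm {2}/y' dotvBl /Q dotvDr; ring.
  have hF := gf_F GF (y' t) t0.
  rewrite {1}E; move: hzt; rewrite -/(p t) -/(X t); lra.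
Qed.

Context (C1 C2 : R).
Hypotheses (C10 : 0 < C1) (C20 : 0 < C2) (CdE : Cd 1 = C1) (Cdp : forall del, 0 < del -> 0 < Cd del).
Hypothesis kin : forall D X ft ph ny dN, 0 <= D -> 0 <= X -> 0 <= ft -> 0 <= ph -> 0 <= ny ->
    D <= 1 + C1 * X -> ny <= Cs * (D `^ be^-1 + ph) ->
    dN <= - (3 / 4 * X) + Cp * ph ^+ 2 + ft * ny ->
    C2 * (1 + ft `^ lam + ph ^+ 2) < ny `^ be -> dN <= - 1.

Let C3 := 3 + 2 * Cp.
Let kappa := 2 `^ (2 / be) * (1 + C2 `^ (2 / be)).
Let C4 := C3 * (1 + kappa).

Let C30 : 0 < C3. Proof. by rewrite addr_gt0 ?mulr_gt0. Qed.
Let kappa0 : 0 < kappa.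
Proof. by rewrite mulr_gt0 ?powR_gt0// addr_gt0// powR_gt0. Qed.
Let C40 : 0 < C4. Proof. by rewrite mulr_gt0// addr_gt0. Qed.
Let be0 : 0 < be. Proof. exact: lt_trans be1. Qed.

Let DX t : 0 <= t -> D t <= 1 + C1 * X t.
Proof. by move=> t0; have := gf_D GF ltr01 t0; rewrite CdE. Qed.

Let XJ t : X t <= 2 * J (p t). Proof. exact: (gf_J_ge GF). Qed.

Let J0 t : 0 <= J (p t).
Proof. by have := gf_X_ge0 GF (p t); have := XJ t; rewrite /X; lra. Qed.

Lemma gf_kinetic (t G : R) : 0 <= t -> ft t `^ lam + ph t ^+ 2 <= G ->
  2^-1 * (C2 * (1 + G)) `^ (2 / be) < Nk t -> dotv (y' t) (y t) <= - 1.
Proof.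
move=> t0 gG; rewrite /Nk ltr_pM2l ?invr_gt0// => big.
apply: (kin (gf_D_ge0 GF t0) (gf_X_ge0 GF (p t)) (gf_ft_ge0 GF t0) (gf_ph_ge0 GF t0)
  (enorm_ge0 (y t)) (DX t0) (gf_sobolev GF t0) (gf_dN_le t0)).
have g0 : 0 <= ft t `^ lam + ph t ^+ 2 by rewrite addr_ge0 ?powR_ge0 ?sqr_ge0.
apply: (@le_lt_trans _ _ (C2 * (1 + G))).
  by rewrite ler_wpM2l ?(ltW C20)// -addrA lerD2l.
have CG0 : 0 <= C2 * (1 + G) by rewrite mulr_ge0 ?(ltW C20)//; lra.
rewrite -sqr_enorm in big.
have : ((C2 * (1 + G)) `^ (2 / be)) `^ (be / 2) < (enorm (y t) ^+ 2) `^ (be / 2).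
  by rewrite ltr_powR_pos ?divr_gt0 ?powR_ge0 ?sqr_ge0.
rewrite -[X in X < _]powRrM (_ : 2 / be * (be / 2) = 1); last by field; rewrite gt_eqF.
rewrite powRr1// => /lt_le_trans; apply.
rewrite -powR_mulrn ?enorm_ge0// -powRrM mulrCA mulfV ?mulr1//.
Qed.

(** As 2 / be >= 1 and lam >= 2, a multiple of 1 + G^(2/be) bounds a^2 + c^2 and
    the part of b that comes from the data. *)
Lemma gf_rhs_le (G a b c d : R) : 0 <= G -> a `^ lam + c ^+ 2 <= G -> 0 <= a -> 0 <= d ->
  b <= d + (C2 * (1 + G)) `^ (2 / be) ->
  C3 * (a ^+ 2 + b + c ^+ 2) <= C4 * (1 + d + G `^ (2 / be)).
Proof.
move=> G0 gG a0 d0 bd.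
have q1 : 1 <= 2 / be by rewrite ler_pdivlMr// mul1r ltW.
have h1 : a ^+ 2 + c ^+ 2 <= (1 + G) `^ (2 / be).
  apply: (@le_trans _ _ (1 + G)); first by have := sqr_le_powR lam2 a0; lra.
  by apply: le1r_powR => //; lra.
have h2 : (1 + G) `^ (2 / be) <= 2 `^ (2 / be) * (1 + G `^ (2 / be)).
  have := @powRD_le _ 1 G (2 / be); rewrite powR1; apply => //.
  by rewrite divr_ge0// ltW.
have h3 : (C2 * (1 + G)) `^ (2 / be) = C2 `^ (2 / be) * (1 + G) `^ (2 / be).
  by rewrite powRM ?(ltW C20)//; lra.
rewrite /C4 -mulrA ler_wpM2l ?(ltW C30)//.
rewrite h3 in bd.
have pG : 0 <= G `^ (2 / be) by exact: powR_ge0.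
have p2 : 0 <= C2 `^ (2 / be) by exact: powR_ge0.
have h4 : (1 + C2 `^ (2 / be)) * (1 + G) `^ (2 / be) <= kappa * (1 + G `^ (2 / be)).
  rewrite /kappa mulrAC (mulrC _ (1 + _)) ler_wpM2l//; lra.
have h5 : a ^+ 2 + b + c ^+ 2 <= d + kappa * (1 + G `^ (2 / be)) by lra.
apply: (le_trans h5); have := ltW kappa0; move: d0 pG; move: (G `^ _) kappa => u v; nra.
Qed.

(** As Env is monotone, its value at time s is a barrier for |y|^2 on [0, s]; with
    this bound on |y|^2, Gronwall's lemma applies to the energy. *)
Lemma gf_energy_bound (Env : R -> R) t : 0 <= t ->
  (forall s s' : R, 0 <= s -> s <= s' -> Env s <= Env s') ->
  (forall s, 0 <= s -> ft s `^ lam + ph s ^+ 2 <= Env s) ->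
  measurable_fun (`[0, t]%classic : set R) Env ->
  measurable_fun (`[0, t]%classic : set R) pht ->
  ((D t)%:E <= (1 + 2 * C1 * (2 * C4 + 1 + C4))%:E *
   (1 + (enorm (y 0) ^+ 2)%:E + (J (p 0))%:E +
   \int[lebesgue_measure]_(s in `[0%R, t])
    (expR (- 2^-1 * (t - s)) * (pht s ^+ 2 + Env s `^ (2 / be)))%:E))%E.
Proof.
move=> t0 Emono Eg mE mpht.
have E0 s : 0 <= s -> 0 <= Env s.
  by move=> s0; apply: le_trans (Eg s s0); rewrite addr_ge0 ?powR_ge0 ?sqr_ge0.
have Ny s : 0 <= s -> enorm (y s) ^+ 2 <= enorm (y 0) ^+ 2 + (C2 * (1 + Env s)) `^ (2 / be).
  move=> s0.
  suff : Nk s <= 2^-1 * (enorm (y 0) ^+ 2 + (C2 * (1 + Env s)) `^ (2 / be)).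
    by rewrite /Nk ler_pM2l ?invr_gt0// -sqr_enorm.
  apply: (barrier s0 gf_cN gf_dN).
    move=> x /andP[x0 xs] big; apply: (@le_trans _ _ (-1)); last by rewrite oppr_le0.
    apply: (@gf_kinetic x (Env s)); first exact: ltW.
      by apply: le_trans (Eg x (ltW x0)) _; apply: Emono; apply: ltW.
    apply: le_lt_trans big; rewrite ler_pM2l ?invr_gt0// lerDr sqr_ge0//.
  by rewrite /Nk ler_pM2l ?invr_gt0// -sqr_enorm lerDl powR_ge0.
set A0 := 1 + enorm (y 0) ^+ 2.
have A00 : 0 <= A0 by rewrite addr_ge0 ?sqr_ge0.
pose r s := C4 * (pht s ^+ 2 + Env s `^ (2 / be)).
(* The shift removes the constant part C4 A0 of the right-hand side. *)
pose Et s := J (p s) - 2 * C4 * A0.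
have dEt (s : R) : 0 < s -> is_derive s (1 : R) Et (Q s).
  move=> /gf_dE ds; have -> : Et = (fun s => J (p s)) - cst (2 * C4 * A0) by [].
  by apply: is_derive_eq; rewrite subr0.
have cEt : continuous Et.
  by move=> s; apply: cvgB; [exact: gf_cE|exact: cvg_cst].
have mr : measurable_fun (`[0, t]%classic : set R) r.
  apply: measurable_funM => //; apply: measurable_funD.
    exact: measurable_funX.
  by apply: (measurableT_comp (measurable_powR _)).
have r0 s : 0 <= s -> 0 <= r s.
  by move=> s0; rewrite mulr_ge0 ?(ltW C40)// addr_ge0 ?sqr_ge0 ?powR_ge0.
have Qr s : 0 <= s -> Q s <= - (2^-1 * Et s) + r s.
  move=> s0; apply: le_trans (gf_Q_le s0) _.
  have h := gf_rhs_le (E0 s s0) (Eg s s0) (gf_ft_ge0 GF s0) (sqr_ge0 _) (Ny s s0).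
  have C34 : C3 * pht s ^+ 2 <= C4 * pht s ^+ 2.
    rewrite ler_wpM2r ?sqr_ge0// /C4 ler_peMr ?(ltW C30)//.
    by have := kappa0; lra.
  rewrite -/C3 mulrDr /Et /r /A0; lra.
have := gronwall_integral t0 cEt gf_cQ dEt mr r0 Qr.
set I := (\int[lebesgue_measure]_(s in _) (expR _ * (_ + _))%:E)%E.
have I0 : (0 <= I)%E.
  apply: integral_ge0 => s _.
  by rewrite lee_fin mulr_ge0 ?expR_ge0// addr_ge0 ?sqr_ge0 ?powR_ge0.
have -> : (\int[lebesgue_measure]_(s in `[0%R, t]) (expR (- 2^-1 * (t - s)) * r s)%:E = C4%:E * I)%E.
  rewrite /I -ge0_integralZl//.
  - by apply: eq_integral => s _; rewrite -EFinM mulrCA.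
  - apply/measurable_EFinP; apply: measurable_funM.
      apply: measurableT_comp => //; apply: measurable_funM => //.
      by apply: measurable_funB.
    apply: measurable_funD; first exact: measurable_funX.
    by apply: (measurableT_comp (measurable_powR _)).
  - by move=> s _; rewrite lee_fin mulr_ge0 ?expR_ge0// addr_ge0 ?sqr_ge0 ?powR_ge0.
  - by rewrite lee_fin ltW.
have Dt := DX t0; have XJt := XJ t.
case: I I0 => [I I0|_ _|//]; last first.
  rewrite !addey// gt0_muley ?leey// lte_fin.
  have c4 : 0 < 2 * C4 + 1 + C4 by have := C40; lra.
  by apply: addr_gt0 => //; apply: mulr_gt0 => //; apply: mulr_gt0.
rewrite -!EFinM -!EFinD !lee_fin => h.
have et : 0 <= expR (- 2^-1 * t) <= 1.
  rewrite expR_ge0/= -[leRHS]expR0 ler_expR; lra.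
have Jt : J (p t) <= 2 * C4 * A0 + J (p 0) + C4 * I.
  have h0 : expR (- 2^-1 * t) * Et 0 <= J (p 0).
    apply: (@le_trans _ _ (expR (- 2^-1 * t) * J (p 0))).
      rewrite ler_wpM2l ?expR_ge0// /Et lerBlDr lerDl.
      by apply: mulr_ge0 => //; apply: mulr_ge0 => //; exact: ltW.
    by apply: ler_piMl; [exact: J0|case/andP: et].
  by have := le_trans h (lerD h0 (lexx _)); rewrite /Et; lra.
rewrite lee_fin in I0.
have c1 : C1 * X t <= 2 * C1 * (2 * C4 * A0 + J (p 0) + C4 * I).
  apply: (@le_trans _ _ (C1 * (2 * (2 * C4 * A0 + J (p 0) + C4 * I)))).
    by rewrite ler_wpM2l ?(ltW C10)//; apply: (le_trans XJt); rewrite ler_wpM2l.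
  by rewrite mulrA (mulrC C1).
apply: (le_trans Dt); apply: le_trans (lerD (lexx 1) c1) _.
have a1 : 1 <= A0 by rewrite lerDl sqr_ge0.
rewrite -/A0.
have m : 2 * C4 * A0 + J (p 0) + C4 * I <= (2 * C4 + 1 + C4) * (A0 + J (p 0) + I).
  exact: energy_sum_le (ltW C40) A00 (J0 0) I0.
have S1 : 1 <= A0 + J (p 0) + I by have := J0 0; lra.
rewrite [leRHS]mulrDl mul1r; apply: lerD => //; rewrite -[leRHS]mulrA.
apply: ler_wpM2l m; exact: (mulr_ge0 _ (ltW C10)).
Qed.

(** [eventually_below] for the kinetic energy and then, |y|^2 being bounded, for
    the potential energy. *)
Lemma gf_limit_bound (G P T0 : R) : 0 <= T0 -> 0 <= G -> 0 <= P ->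
  (forall t, T0 <= t -> ft t `^ lam + ph t ^+ 2 <= G) ->
  (forall t, T0 <= t -> pht t ^+ 2 <= P) ->
  exists2 T1, T0 <= T1 & forall t, T1 <= t ->
    D t <= (1 + 4 * C1 * (2 * C4 + 1)) * (1 + P + G `^ (2 / be)).
Proof.
move=> T00 G0 P0 gG pP.
have [||T1 T01 NT1] := @eventually_below _ Nk (fun t => dotv (y' t) (y t)) T0 (2^-1 * (C2 * (1 + G)) `^ (2 / be)) 1 ltr01 gf_cN.
- by move=> t T0t; apply: gf_dN; exact: le_lt_trans T0t.
- move=> t T0t; apply: gf_kinetic; first by rewrite ltW// (le_lt_trans T00).
  by apply: gG; exact: ltW.
pose B := 2 * C4 * (1 + P + G `^ (2 / be)).
have pG : 0 <= G `^ (2 / be) by exact: powR_ge0.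
have c4 : 0 <= 2 * C4 by have := C40; lra.
have g4 : 0 <= 1 + P + G `^ (2 / be) by lra.
have B0 : 0 <= B by exact: mulr_ge0.
have [||T2 T12 ET2] := @eventually_below _ (fun s => J (p s)) Q T1 (2 * B + 2) 1 ltr01 gf_cE.
- by move=> t T0t; apply: gf_dE; apply: le_lt_trans T0t; exact: le_trans T01.
- move=> t T1t big; have T0t : T0 <= t by apply: le_trans T01 _; exact: ltW.
  have t0 : 0 <= t by exact: le_trans T0t.
  apply: le_trans (gf_Q_le t0) _.
  have := NT1 t (ltW T1t); rewrite /Nk ler_pM2l ?invr_gt0// -sqr_enorm => ny.
  have := gf_rhs_le G0 (gG t T0t) (gf_ft_ge0 GF t0) (lexx 0) (b := enorm (y t) ^+ 2).
  rewrite add0r addr0 => /(_ ny) h.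
  have C34 : C3 * pht t ^+ 2 <= C4 * P.
    apply: ler_pM; rewrite ?sqr_ge0 ?(ltW C30) ?pP// /C4 ler_peMr ?(ltW C30)//.
    by have := kappa0; lra.
  have : C4 * (1 + G `^ (2 / be)) + C4 * P <= B.
    rewrite /B; have : 0 <= C4 * (1 + P + G `^ (2 / be)) by rewrite mulr_ge0 ?(ltW C40).
    lra.
  rewrite -/C3 mulrDr; lra.
exists T2; first exact: le_trans T12.
move=> t T2t; have t0 : 0 <= t by rewrite (le_trans T00)// (le_trans T01)// (le_trans T12).
have := DX t0; have := XJ t; have := ET2 t T2t => h1 h2 h3.
have : C1 * X t <= C1 * (4 * B + 4) by rewrite ler_pM2l//; lra.
move=> h4; apply: (le_trans h3); apply: (le_trans (lerD (lexx 1) h4)).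
have : 0 <= C1 * (P + G `^ (2 / be)) by rewrite mulr_ge0 ?(ltW C10)// addr_ge0.
rewrite /B; lra.
Qed.

(** If |y|^2 stays above e then the Sobolev inequality bounds D, hence X, from
    below, and small data cannot balance the dissipation; so y tends to 0. The
    energy inequality then drives J to 0, hence X, and D <= delta + C_delta X is
    eventually as small as desired. *)
Lemma gf_limit0 : (forall e, 0 < e -> exists2 T, 0 <= T & forall t, T <= t -> ft t <= e) ->
  (forall e, 0 < e -> exists2 T, 0 <= T & forall t, T <= t -> ph t <= e) ->
  (forall e, 0 < e -> exists2 T, 0 <= T & forall t, T <= t -> pht t <= e) ->
  forall e, 0 < e -> exists2 T, 0 <= T & forall t, T <= t -> D t <= e.
Proof.
move=> lft lph lpht.
have lN e : 0 < e -> exists2 T, 0 <= T & forall t, T <= t -> enorm (y t) ^+ 2 <= e.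
  move=> e0; pose q := Num.sqrt e / (2 * Cs).
  have q0 : 0 < q by rewrite divr_gt0 ?sqrtr_gt0// mulr_gt0.
  pose m := q `^ be; have m0 : 0 < m by exact: powR_gt0.
  have m20 : 0 < m / 2 by rewrite divr_gt0.
  have Cm := Cdp m20; set cm := Cd (m / 2) in Cm.
  (* Data below eta leave D > m, absorb the source in X / 4, and cost at most
     half of the remaining dissipation, which exceeds m / (4 cm). *)
  pose eta := Num.min (Num.min 1 q) (Num.min (4 * Cs * C1)^-1 (m / (8 * cm * (Cp + 3 * Cs)))).
  have eta0 : 0 < eta.
    have d1 : 0 < 8 * cm * (Cp + 3 * Cs) by rewrite mulr_gt0 ?mulr_gt0// addr_gt0// mulr_gt0.
    by rewrite !lt_min ltr01 q0 invr_gt0 (divr_gt0 m0 d1) !mulr_gt0.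
  have [eta1 etaq etaC etam] : [/\ eta <= 1, eta <= q, eta <= (4 * Cs * C1)^-1 &
      eta <= m / (8 * cm * (Cp + 3 * Cs))].
    by split; rewrite /eta !ge_min lexx ?orbT.
  have [Ta Ta0 fta] := lft eta eta0; have [Tb Tb0 phb] := lph eta eta0.
  pose T0 := Num.max Ta Tb.
  have T00 : 0 <= T0 by rewrite le_max Ta0.
  have del0 : 0 < m / (8 * cm) by rewrite divr_gt0// mulr_gt0.
  have [||T1 T01 NT1] := @eventually_below _ Nk (fun t => dotv (y' t) (y t)) T0 (2^-1 * e) _ del0 gf_cN.
  - by move=> t T0t; apply: gf_dN; exact: le_lt_trans T0t.
  - move=> t T0t; rewrite /Nk ltr_pM2l ?invr_gt0// -sqr_enorm => big.
    have t0 : 0 <= t by rewrite ltW// (le_lt_trans T00).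
    have ta : ft t <= eta by apply: fta; apply: le_trans (ltW T0t); rewrite le_max lexx.
    have tb : ph t <= eta by apply: phb; apply: le_trans (ltW T0t); rewrite le_max lexx orbT.
    have ft0 := gf_ft_ge0 GF t0; have ph0 := gf_ph_ge0 GF t0; have D0 := gf_D_ge0 GF t0.
    have X0 : 0 <= X t := gf_X_ge0 GF (p t).
    have yb : Num.sqrt e < enorm (y t).
      rewrite -(@ltr_pXn2r _ 2) ?nnegrE ?sqrtr_ge0 ?enorm_ge0//.
      by rewrite sqr_sqrtr// ltW.
    have sob := gf_sobolev GF t0.
    have Dq : q < D t `^ be^-1.
      have : 2 * Cs * q < Cs * (D t `^ be^-1 + ph t).
        by apply: lt_le_trans sob; rewrite /q mulrC divfK// gt_eqF// mulr_gt0.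
      rewrite (mulrC 2) -mulrA ltr_pM2l//; lra.
    have Dm : m < D t.
      rewrite -(@ltr_powR_pos _ _ _ be^-1) ?invr_gt0 ?powR_ge0//.
      by rewrite /m -powRrM mulfV ?gt_eqF// powRr1// ltW.
    have hX := gf_D GF m20 t0; rewrite -/(p t) -/(X t) -/cm in hX.
    have Xm : m < 2 * cm * X t by lra.
    have D1 : D t `^ be^-1 <= 1 + D t.
      have [d1|d1] := leP (D t) 1.
        rewrite ler_wpDr// -[leRHS](_ : 1 `^ be^-1 = 1); last by rewrite powR1.
        by apply: ge0_ler_powR; rewrite ?nnegrE// invr_ge0 ltW.
      rewrite ler_wpDl//; apply: ler1_powR; first exact: ltW.
      by rewrite invf_le1// ltW.
    have hD := DX t0.
    have h1 : ft t * enorm (y t) <= 4^-1 * X t + 3 * Cs * eta.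
      apply: (@le_trans _ _ (ft t * (Cs * (3 + C1 * X t)))).
        by rewrite ler_wpM2l//; apply: le_trans sob _; rewrite ler_wpM2l ?(ltW Cs0)//; lra.
      have -> : ft t * (Cs * (3 + C1 * X t)) = ft t * (Cs * C1) * X t + 3 * Cs * ft t by ring.
      apply: lerD; last by rewrite ler_wpM2l// mulr_ge0// ltW.
      rewrite ler_wpM2r// -ler_pdivlMr ?mulr_gt0//; apply: (le_trans ta).
      by apply: (le_trans etaC); rewrite !invfM mulrA.
    have h2 : Cp * ph t ^+ 2 <= Cp * eta.
      rewrite ler_wpM2l ?(ltW Cp0)// expr2; nra.
    have h3 : (Cp + 3 * Cs) * eta <= m / (8 * cm).
      rewrite mulrC -ler_pdivlMr ?addr_gt0 ?mulr_gt0//.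
      by apply: (le_trans etam); rewrite !invfM !mulrA.
    have h4 : m / (4 * cm) < 2^-1 * X t.
      rewrite ltr_pdivrMr ?mulr_gt0//; lra.
    have h5 : m / (4 * cm) = 2 * (m / (8 * cm)) by field; rewrite gt_eqF.
    apply: le_trans (gf_dN_le t0) _; lra.
  exists T1; first exact: le_trans T01.
  by move=> t /NT1; rewrite /Nk ler_pM2l ?invr_gt0// -sqr_enorm.
have lE e : 0 < e -> exists2 T, 0 <= T & forall t, T <= t -> J (p t) <= e.
  move=> e0; pose eta := Num.min 1 (e / (16 * C3)).
  have eta0 : 0 < eta by rewrite lt_min ltr01 divr_gt0// mulr_gt0.
  have [eta1 etaC] : eta <= 1 /\ eta <= e / (16 * C3) by split; rewrite ge_min lexx ?orbT.
  have [Ta Ta0 fta] := lft eta eta0; have [Tb Tb0 phb] := lph eta eta0.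
  have [Tc Tc0 ptc] := lpht eta eta0; have [Td Td0 ntd] := lN eta eta0.
  pose T0 := Num.max (Num.max Ta Tb) (Num.max Tc Td).
  have T00 : 0 <= T0 by rewrite !le_max Ta0.
  have sq x : 0 <= x -> x <= eta -> x ^+ 2 <= eta by move=> x0 xe; rewrite expr2; nra.
  have e40 : 0 < e / 4 by rewrite divr_gt0.
  have [||T1 T01 ET1] := @eventually_below _ (fun s => J (p s)) Q T0 e _ e40 gf_cE.
  - by move=> t T0t; apply: gf_dE; apply: le_lt_trans T0t.
  - move=> t T0t big; have t0 : 0 <= t by rewrite ltW// (le_lt_trans T00).
    have := ltW T0t; rewrite !ge_max => /andP[/andP[tA tB] /andP[tC tD]].
    apply: le_trans (gf_Q_le t0) _.
    have : C3 * (ft t ^+ 2 + enorm (y t) ^+ 2 + ph t ^+ 2 + pht t ^+ 2) <= C3 * (4 * eta).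
      rewrite ler_pM2l//.
      have := sq _ (gf_ft_ge0 GF t0) (fta t tA); have := sq _ (gf_ph_ge0 GF t0) (phb t tB).
      have := sq _ (gf_pht_ge0 GF t0) (ptc t tC); have := ntd t tD; lra.
    have : C3 * (4 * eta) <= e / 4.
      rewrite mulrC -ler_pdivlMr// mulrC -ler_pdivlMr//.
      by apply: (le_trans etaC); rewrite le_eqVlt; apply/orP; left; apply/eqP; field; rewrite gt_eqF.
    rewrite -/C3; lra.
  by exists T1 => //; exact: le_trans T01.
move=> e e0; have e2 : 0 < e / 2 by rewrite divr_gt0.
have ce := Cdp e2; set c := Cd (e / 2) in ce.
have [T T0 ET] := lE (e / (4 * c)) (divr_gt0 e0 (mulr_gt0 (ltr0Sn _ _) ce)).
exists T => // t Tt; have t0 : 0 <= t by exact: le_trans Tt.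
have := gf_D GF e2 t0; rewrite -/(p t) -/(X t) -/c => /le_trans; apply.
have : c * X t <= c * (2 * (e / (4 * c))).
  by rewrite ler_pM2l//; have := XJ t; have := ET t Tt; lra.
have -> : c * (2 * (e / (4 * c))) = e / 2 by field; rewrite gt_eqF.
lra.
Qed.

End one_flow.

(** The constant is chosen before L and k: the Lipschitz constant and the
    dimension of the flow, which depend on the triangulation, do not enter it. *)
Theorem gradient_flow_estimates (Cp Cs : R) (Cd : R -> R) : 0 < Cp -> 0 < Cs ->
  (forall del, 0 < del -> 0 < Cd del) ->
  exists2 C : R, 0 < C & forall (L : R) (k : nat) (Phi : 'rV[R]_k -> 'rV[R]_k)
   (J : 'rV[R]_k -> R) (y z F zeta : R -> 'rV[R]_k) (D ft ph pht : R -> R),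
   0 <= L -> gradient_flow Cp Cs L Cd Phi J y z F zeta D ft ph pht ->
 [/\ forall (Env : R -> R) t, 0 <= t ->
  (forall s s' : R, 0 <= s -> s <= s' -> Env s <= Env s') ->
  (forall s, 0 <= s -> ft s `^ lam + ph s ^+ 2 <= Env s) ->
  measurable_fun (`[0, t]%classic : set R) Env ->
  measurable_fun (`[0, t]%classic : set R) pht ->
  ((D t)%:E <= C%:E *
   (1 + (enorm (y 0) ^+ 2)%:E + (J (y 0 + z 0)%R)%:E +
   \int[lebesgue_measure]_(s in `[0%R, t])
    (expR (- 2^-1 * (t - s)) * (pht s ^+ 2 + Env s `^ (2 / be)))%:E))%E,
  forall (G P T0 : R), 0 <= T0 -> 0 <= G -> 0 <= P ->
  (forall t, T0 <= t -> ft t `^ lam + ph t ^+ 2 <= G) ->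
  (forall t, T0 <= t -> pht t ^+ 2 <= P) ->
  exists2 T1, T0 <= T1 & forall t, T1 <= t -> D t <= C * (1 + P + G `^ (2 / be)) &
  (forall e, 0 < e -> exists2 T, 0 <= T & forall t, T <= t -> ft t <= e) ->
  (forall e, 0 < e -> exists2 T, 0 <= T & forall t, T <= t -> ph t <= e) ->
  (forall e, 0 < e -> exists2 T, 0 <= T & forall t, T <= t -> pht t <= e) ->
  forall e, 0 < e -> exists2 T, 0 <= T & forall t, T <= t -> D t <= e].
Proof.
move=> Cp0 Cs0 Cdp; have C10 := Cdp 1 ltr01.
have [C2 C20 kin] := kinetic_decay be1 be2 lam2 bl Cp0 Cs0 C10.
set C4 := (3 + 2 * Cp) * (1 + 2 `^ (2 / be) * (1 + C2 `^ (2 / be))).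
have C40 : 0 < C4.
  by rewrite mulr_gt0 ?addr_gt0 ?mulr_gt0 ?powR_gt0// addr_gt0// powR_gt0.
pose Ca := 1 + 2 * Cd 1 * (2 * C4 + 1 + C4).
pose Cb := 1 + 4 * Cd 1 * (2 * C4 + 1).
have Ca0 : 0 < Ca by rewrite addr_gt0// !mulr_gt0// !addr_gt0// mulr_gt0.
have Cb0 : 0 < Cb by rewrite addr_gt0// !mulr_gt0// !addr_gt0// mulr_gt0.
exists (Ca + Cb); first exact: addr_gt0.
move=> L k Phi J y z F zeta D ft ph pht L0 GF; split.
- move=> Env t t0 Emono Eg mE mpht.
  apply: le_trans (gf_energy_bound GF Cp0 L0 C10 C20 erefl kin t0 Emono Eg mE mpht) _.
  apply: lee_wpmul2r; last by rewrite lee_fin lerDl ltW.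
  apply: adde_ge0; last first.
    apply: integral_ge0 => s _.
    by rewrite lee_fin mulr_ge0 ?expR_ge0// addr_ge0 ?sqr_ge0 ?powR_ge0.
  rewrite -!EFinD lee_fin !addr_ge0 ?sqr_ge0//.
  by have := gf_X_ge0 GF (y 0 + z 0); have := gf_J_ge GF (y 0 + z 0); lra.
- move=> G P T0 T00 G0 P0 gG pP.
  have [T1 T01 h] := gf_limit_bound GF Cp0 L0 C10 C20 erefl kin T00 G0 P0 gG pP.
  exists T1 => // t T1t; apply: (le_trans (h t T1t)).
  by rewrite ler_wpM2r ?lerDr ?(ltW Ca0)// !addr_ge0// powR_ge0.
- by move=> h1 h2 h3; exact: (gf_limit0 GF Cp0 Cs0 L0 C10 erefl Cdp h1 h2 h3).
Qed.

End gradient_flow.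

(** * The Hoelder and Loomis-Whitney inequalities *)

Lemma weighted_AMGM (R : realType) (a b th : R) : (0 < th < 1) -> (0 <= a) -> (0 <= b) ->
  (a `^ th * b `^ (1 - th) <= th * a + (1 - th) * b).
Proof.
move=> /andP[th0 th1] a0 b0.
have t1 : (0 < 1 - th) by lra.
have := @conjugate_powR R (a `^ th) (b `^ (1 - th)) th^-1 (1 - th)^-1.
rewrite !powR_ge0 !invr_gt0 !invrK => /(_ isT isT th0 t1).
rewrite -!powRrM !mulfV ?gt_eqF// !powRr1// => /(_ _)/le_trans; apply; first lra.
by rewrite mulrC (mulrC b).
Qed.

Section hoelder_ereal.
Context d (T : measurableType d) (R : realType) (mu : {measure set T -> \bar R}).
Local Open Scope ereal_scope.

(** The weighted inequality of the means for f / F and g / G, F and G being the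
    integrals. Functions with values in [0, +oo] are needed since integrals over
    lines may be infinite. *)
Lemma ge0_hoelder (f g : T -> \bar R) (th : R) : (0 < th < 1)%R ->
  measurable_fun setT f -> measurable_fun setT g ->
  (forall x, 0 <= f x) -> (forall x, 0 <= g x) ->
  \int[mu]_x (f x `^ th * g x `^ (1 - th)) <=
  (\int[mu]_x f x) `^ th * (\int[mu]_x g x) `^ (1 - th).
Proof.
move=> th01 mf mg f0 g0; have /andP[th0 th1] := th01.
have t1 : (0 < 1 - th)%R by lra.
have F0 : 0 <= \int[mu]_x f x by exact: integral_ge0.
have G0 : 0 <= \int[mu]_x g x by exact: integral_ge0.
have mp (h : T -> \bar R) r : measurable_fun setT h -> measurable_fun setT (fun x => h x `^ r).
  by move=> mh; apply: (@measurableT_comp _ _ _ _ _ _ (@poweR R ^~ r)) => //; exact: measurable_poweR.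
have mfg : measurable_fun setT (fun x => f x `^ th * g x `^ (1 - th)).
  by apply: emeasurable_funM; exact: mp.
have zero (h k : T -> \bar R) r s : (0 < r)%R -> measurable_fun setT h -> measurable_fun setT k ->
   (forall x, 0 <= h x) ->
   \int[mu]_x h x = 0 -> \int[mu]_x (h x `^ r * k x `^ s) = 0.
  move=> r0 mh mk h0 ih0.
  have : ae_eq mu setT h (cst 0).
    apply/(ae_eq_integral_abs mu measurableT mh).
    by rewrite -[RHS]ih0; apply: eq_integral => x _; rewrite gee0_abs.
  move=> hae; rewrite (ae_eq_integral (cst 0)) ?integral0//.
    by apply: emeasurable_funM; exact: mp.
  apply: filterS hae => x /= hx _; rewrite hx//.
  by rewrite poweR0r ?mul0e// gt_eqF.
have [F00|F0n] := eqVneq (\int[mu]_x f x) 0.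
  by rewrite zero// mule_ge0 ?poweR_ge0.
have [G00|G0n] := eqVneq (\int[mu]_x g x) 0.
  under eq_integral do rewrite muleC.
  by rewrite zero// mule_ge0 ?poweR_ge0.
have Fp : 0 < \int[mu]_x f x by rewrite lt_neqAle eq_sym F0n.
have Gp : 0 < \int[mu]_x g x by rewrite lt_neqAle eq_sym G0n.
have [Foo|Ffin] := eqVneq (\int[mu]_x f x) +oo.
  by rewrite Foo poweRyr ?gt_eqF// gt0_mulye ?poweR_gt0// leey.
have [Goo|Gfin] := eqVneq (\int[mu]_x g x) +oo.
  by rewrite Goo poweRyr ?gt_eqF// gt0_muley ?poweR_gt0// leey.
have : \int[mu]_x f x \is a fin_num by rewrite ge0_fin_numE// lt_neqAle Ffin leey.
have : \int[mu]_x g x \is a fin_num by rewrite ge0_fin_numE// lt_neqAle Gfin leey.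
move=> /EFin_fin_numP[G GE] /EFin_fin_numP[F FE].
rewrite GE FE in Fp Gp F0 G0 *; rewrite !lte_fin in Fp Gp.
pose c1 := (th * (F `^ (th - 1) * G `^ (1 - th)))%R.
pose c2 := ((1 - th) * (F `^ th * G `^ (- th)))%R.
have c10 : (0 <= c1)%R by rewrite !mulr_ge0 ?powR_ge0// ltW.
have c20 : (0 <= c2)%R by rewrite !mulr_ge0 ?powR_ge0// ltW.
apply: (@le_trans _ _ (\int[mu]_x (c1%:E * f x + c2%:E * g x))).
  apply: ge0_le_integral => //.
  - by move=> x _; rewrite mule_ge0 ?poweR_ge0.
  - by apply: emeasurable_funD; apply: measurable_funeM.
  move=> x _; have := f0 x; have := g0 x.
  have c1p : (0 < c1)%R by rewrite !mulr_gt0 ?powR_gt0.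
  have c2p : (0 < c2)%R by rewrite !mulr_gt0 ?powR_gt0.
  case: (g x) => [b| |] //; case: (f x) => [a| |]// b0 a0; last 3 first.
  - by rewrite [c1%:E * _]gt0_muley// addye ?leey// -EFinM.
  - by rewrite [c2%:E * _]gt0_muley// addey ?leey// -EFinM.
  - by rewrite [c1%:E * _]gt0_muley// addye ?leey// gt0_muley.
  rewrite !poweR_EFin -!EFinM -EFinD lee_fin; rewrite !lee_fin in a0 b0.
  have := @weighted_AMGM _ (a / F)%R (b / G)%R th th01.
  move=> /(_ (divr_ge0 a0 (ltW Fp)) (divr_ge0 b0 (ltW Gp))) H.
  have -> : (a `^ th * b `^ (1 - th) =
    ((a / F) `^ th * (b / G) `^ (1 - th)) * (F `^ th * G `^ (1 - th)))%R.
    rewrite mulrACA -!powRM ?divr_ge0// ?ltW//.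
    by rewrite !divfK ?gt_eqF.
  have -> : (c1 * a + c2 * b = (th * (a / F) + (1 - th) * (b / G)) * (F `^ th * G `^ (1 - th)))%R.
    rewrite /c1 /c2 !powRB ?(gt_eqF Fp) ?(gt_eqF Gp) ?implybT// powRN !powRr1 ?(ltW Fp) ?(ltW Gp)//.
    have Gt : (G `^ th != 0)%R by rewrite gt_eqF// powR_gt0.
    have F1 : (F != 0)%R by rewrite gt_eqF.
    have G1 : (G != 0)%R by rewrite gt_eqF.
    by field; exact/and3P.
  by rewrite ler_wpM2r// mulr_ge0 ?powR_ge0.
rewrite ge0_integralD//; last 4 first.
- by move=> x _; rewrite mule_ge0.
- exact: measurable_funeM.
- by move=> x _; rewrite mule_ge0.
- exact: measurable_funeM.
rewrite !ge0_integralZl// ?lee_fin// GE FE !poweR_EFin -!EFinM -EFinD lee_fin.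
rewrite /c1 /c2 !powRB ?(gt_eqF Fp) ?(gt_eqF Gp) ?implybT// powRN !powRr1 ?(ltW Fp) ?(ltW Gp)//.
have Gt : (G `^ th != 0)%R by rewrite gt_eqF// powR_gt0.
have F1 : (F != 0)%R by rewrite gt_eqF. have G1 : (G != 0)%R by rewrite gt_eqF.
rewrite le_eqVlt; apply/orP; left; apply/eqP; field; exact/andP.
Qed.

Lemma prod_poweR (I : Type) (s : seq I) (f : I -> \bar R) r : (forall i, 0 <= f i) ->
  (\prod_(i <- s) f i) `^ r = \prod_(i <- s) (f i `^ r).
Proof.
move=> f0; elim: s => [|i s IH]; first by rewrite !big_nil poweR1r.
by rewrite !big_cons poweRM// ?IH//; apply: prode_ge0.
Qed.

Lemma emeasurable_prod (I : Type) (s : seq I) (f : I -> T -> \bar R) :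
  (forall i, measurable_fun setT (f i)) ->
  measurable_fun setT (fun x => \prod_(i <- s) f i x).
Proof.
move=> mf; elim: s => [|i s IH].
  by under eq_fun do rewrite big_nil; exact: measurable_cst.
by under eq_fun do rewrite big_cons; exact: emeasurable_funM.
Qed.

Lemma ge0_hoelder_prod m (b : 'I_m.+1 -> T -> \bar R) :
  (forall i, measurable_fun setT (b i)) -> (forall i x, 0 <= b i x) ->
  \int[mu]_x \prod_(i < m.+1) (b i x `^ m.+1%:R^-1) <=
  \prod_(i < m.+1) (\int[mu]_x b i x) `^ m.+1%:R^-1.
Proof.
elim: m b => [|m IH] b mb b0.
  under eq_integral do rewrite big_ord1 invr1 poweRe1//.
  by rewrite big_ord1 invr1 poweRe1// integral_ge0.
set th : R := (m.+2%:R^-1)%R.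
have th01 : (0 < th < 1)%R by rewrite invr_gt0 ltr0n/= invf_lt1 ?ltr0n// ltr1n.
have t1 : (m.+1%:R^-1 * (1 - th) = th)%R.
  have h1 : (m.+1%:R != 0 :> R)%R by rewrite pnatr_eq0.
  have h2 : (m.+2%:R != 0 :> R)%R by rewrite pnatr_eq0.
  have h3 : (m.+2%:R = m.+1%:R + 1 :> R)%R by rewrite -natr1.
  rewrite /th h3; rewrite h3 in h2; field; exact/andP.
have mp (h : T -> \bar R) r : measurable_fun setT h -> measurable_fun setT (fun x => h x `^ r).
  by move=> mh; apply: (@measurableT_comp _ _ _ _ _ _ (@poweR R ^~ r)) => //; exact: measurable_poweR.
have p0 x : 0 <= \prod_(i < m.+1) (b (lift ord0 i) x `^ m.+1%:R^-1).
  by apply: prode_ge0 => i _; exact: poweR_ge0.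
rewrite big_ord_recl.
under eq_integral => x _.
  rewrite big_ord_recl.
  have -> : \prod_(i < m.+1) (b (lift ord0 i) x `^ th) =
     (\prod_(i < m.+1) (b (lift ord0 i) x `^ m.+1%:R^-1)) `^ (1 - th).
    rewrite prod_poweR; last by move=> i; exact: poweR_ge0.
    by apply: eq_bigr => i _; rewrite -poweRrM t1.
  over.
apply: le_trans (ge0_hoelder th01 (mb ord0) _ (b0 ord0) p0) _.
  by apply: emeasurable_prod => i; exact: mp.
apply: lee_wpmul2l; first exact: poweR_ge0.
under [leRHS]eq_bigr do rewrite -t1 poweRrM.
rewrite -prod_poweR; last by move=> i; exact: poweR_ge0.
apply: gt0_ler_poweR; rewrite ?in_itv/= ?leey ?andbT//.
- by case/andP: th01 => _ ?; rewrite subr_ge0 ltW.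
- exact: integral_ge0.
- by apply: prode_ge0 => i _; exact: poweR_ge0.
- by apply: IH.
Qed.
End hoelder_ereal.

Section rowvec_tonelli.
Context (R : realType).
Local Open Scope ereal_scope.
Local Notation leb := (@lebesgue_measure R).
Local Notation mu n := (lebesgue_rowvec R n).

Lemma lebesgue_rowvecS_tonelli n (f : 'rV[R]_n.+1 -> \bar R) :
  measurable_fun setT f -> (forall x, 0 <= f x) ->
  \int[mu n.+1]_x f x = \int[leb]_s \int[mu n]_y f (rowvec_cons (s, y)).
Proof.
move=> mf f0.
transitivity (\int[leb \x mu n]_z f (rowvec_cons z)).
  rewrite -(@ge0_integral_pushforward _ _ (g_sigma_algebraType (R.-ocitv.-measurable) * 'rV[R]_n)%type _ R _ (@measurable_rowvec_cons R n) (leb \x mu n) setT f)//.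
by rewrite fubini_tonelli1// /fubini_F; apply: measurableT_comp => //; exact: measurable_rowvec_cons.
Qed.

Lemma lebesgue_rowvecS_tonelli_swap n (f : 'rV[R]_n.+1 -> \bar R) :
  measurable_fun setT f -> (forall x, 0 <= f x) ->
  \int[mu n.+1]_x f x = \int[mu n]_y \int[leb]_s f (rowvec_cons (s, y)).
Proof.
move=> mf f0; rewrite lebesgue_rowvecS_tonelli//.
apply: (@fubini_tonelli _ _ _ _ R leb (mu n) (f \o @rowvec_cons R n)) => [|z]; last exact: f0.
by apply: measurableT_comp => //; exact: measurable_rowvec_cons.
Qed.

Lemma lebesgue_rowvec0 (f : 'rV[R]_0 -> \bar R) : measurable_fun setT f ->
  \int[mu 0]_y f y = f 0%R.
Proof. by move=> mf; rewrite [LHS]integral_dirac//= diracT mul1e. Qed.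

Definition upd n (x : 'rV[R]_n) (i : 'I_n) (s : R) : 'rV[R]_n :=
  (\row_j if j == i then s else x ord0 j)%R.

Lemma upd_cons0 n (s t : R) (y : 'rV[R]_n) :
  upd (rowvec_cons (t, y)) ord0 s = rowvec_cons (s, y).
Proof.
apply/rowP => j; rewrite !mxE; case: (unliftP ord0 j) => [k ->|->].
  by rewrite eq_sym (negbTE (neq_lift _ _)).
by rewrite eqxx.
Qed.

Lemma upd_consS n (s t : R) (y : 'rV[R]_n) i :
  upd (rowvec_cons (t, y)) (lift ord0 i) s = rowvec_cons (t, upd y i s).
Proof.
apply/rowP => j; rewrite !mxE; case: (unliftP ord0 j) => [k ->|->].
  by rewrite (inj_eq lift_inj) /= mxE.
by rewrite (negbTE (neq_lift _ _)).
Qed.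

Lemma measurable_upd n i :
  measurable_fun setT (fun p : 'rV[R]_n * R => upd p.1 i p.2).
Proof.
apply: measurable_fun_rowvecP => j; case: (eqVneq j i) => [->|ji].
  by under eq_fun do rewrite mxE eqxx; exact: measurable_snd.
under eq_fun do rewrite mxE (negbTE ji).
by apply: (measurableT_comp (@measurable_rowvec_coord R n j)); exact: measurable_fst.
Qed.

(** The integral over the line through x parallel to the i-th axis; it does not
    depend on the i-th coordinate of x. *)
Definition lineint n (i : 'I_n) (G : 'rV[R]_n -> \bar R) (x : 'rV[R]_n) :=
  \int[leb]_s G (upd x i s).

Lemma lineint_ge0 n (i : 'I_n) G x : (forall x, 0 <= G x) -> 0 <= lineint i G x.
Proof. by move=> G0; exact: integral_ge0. Qed.

Lemma measurable_lineint n (i : 'I_n) G : measurable_fun setT G ->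
  (forall x, 0 <= G x) -> measurable_fun setT (lineint i G).
Proof.
move=> mG G0.
apply: (@measurable_fun_fubini_tonelli_F _ _ _ _ R leb (fun p : 'rV[R]_n * R => G (upd p.1 i p.2))) => //.
by apply: measurableT_comp => //; exact: measurable_upd.
Qed.

Lemma measurable_cons_slice n (G : 'rV[R]_n.+1 -> \bar R) s :
  measurable_fun setT G -> measurable_fun setT (fun y => G (rowvec_cons (s, y))).
Proof.
move=> mG; apply: (measurableT_comp mG).
apply: (measurableT_comp (@measurable_rowvec_cons R n)).
exact: measurable_pair1.
Qed.

(** Induction on the dimension. The integral in the direction of the first
    coordinate t does not depend on t: for fixed t, Hoelder's inequality separates
    it from the other factors, which the induction hypothesis bounds, and the
    generalised Hoelder inequality in t concludes. *)
Lemma loomis_whitney n (G : 'I_n.+2 -> 'rV[R]_n.+2 -> \bar R) :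
  (forall i, measurable_fun setT (G i)) -> (forall i x, 0 <= G i x) ->
  \int[mu n.+2]_x \prod_i (lineint i (G i) x `^ n.+1%:R^-1) <=
  \prod_i (\int[mu n.+2]_x G i x) `^ n.+1%:R^-1.
Proof.
have mp d (T : measurableType d) (h : T -> \bar R) r : measurable_fun setT h -> measurable_fun setT (fun x => h x `^ r).
  by move=> mh; apply: (@measurableT_comp _ _ _ _ _ _ (@poweR R ^~ r)) => //; exact: measurable_poweR.
elim: n G => [|n IH] G mG G0.
  rewrite invr1.
  under eq_integral do rewrite !big_ord_recl big_ord0 mule1 !poweRe1 ?lineint_ge0//.
  rewrite !big_ord_recl big_ord0 mule1 !poweRe1 ?integral_ge0//.
  rewrite [leLHS]lebesgue_rowvecS_tonelli; last 2 first.
  - by apply: emeasurable_funM; exact: measurable_lineint.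
  - by move=> x; rewrite mule_ge0// lineint_ge0.
  pose A y := \int[leb]_s G ord0 (rowvec_cons (s, y)).
  pose B t := \int[mu 1]_y G (lift ord0 ord0) (rowvec_cons (t, y)).
  have H s y : lineint ord0 (G ord0) (rowvec_cons (s, y)) *
     lineint (lift ord0 ord0) (G (lift ord0 ord0)) (rowvec_cons (s, y)) = A y * B s.
    congr *%E.
      by apply: eq_integral => t _; rewrite upd_cons0.
    rewrite /B lebesgue_rowvecS_tonelli; last 2 first.
    + exact: measurable_cons_slice.
    + by [].
    apply: eq_integral => t _; rewrite upd_consS.
    rewrite (lebesgue_rowvec0 (f := fun y' => G (lift ord0 ord0) (rowvec_cons (s, rowvec_cons (t, y'))))).
      congr (G _ (rowvec_cons (_, _))); apply/rowP => j; rewrite !ord1 !mxE/=.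
      by rewrite unlift_none.
    by apply: (measurable_cons_slice (G := fun z => G (lift ord0 ord0) (rowvec_cons (s, z)))); exact: measurable_cons_slice.
  have A0 y : 0 <= A y by exact: integral_ge0.
  have B0 y : 0 <= B y by exact: integral_ge0.
  have mA : measurable_fun setT A.
    apply: (@measurable_fun_fubini_tonelli_G _ _ _ _ R leb (G ord0 \o @rowvec_cons R 1)) => [|z]; last exact: G0.
    by apply: measurableT_comp => //; exact: measurable_rowvec_cons.
  have mB : measurable_fun setT B.
    apply: (@measurable_fun_fubini_tonelli_F _ _ _ _ R (mu 1) (G (lift ord0 ord0) \o @rowvec_cons R 1)) => [|z]; last exact: G0.
    by apply: measurableT_comp => //; exact: measurable_rowvec_cons.
  under eq_integral => s _.
    under eq_integral => y _ do rewrite H.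
    rewrite ge0_integralZr//.
    over.
  rewrite ge0_integralZl// ?integral_ge0//.
  rewrite [X in _ <= X * _]lebesgue_rowvecS_tonelli_swap//.
  by rewrite [X in _ <= _ * X]lebesgue_rowvecS_tonelli.
set th : R := (n.+2%:R^-1)%R.
have th01 : (0 < th < 1)%R by rewrite invr_gt0 ltr0n/= invf_lt1 ?ltr0n// ltr1n.
have t1 : (n.+1%:R^-1 * (1 - th) = th)%R.
  have h1 : (n.+1%:R != 0 :> R)%R by rewrite pnatr_eq0.
  have h2 : (n.+2%:R != 0 :> R)%R by rewrite pnatr_eq0.
  have h3 : (n.+2%:R = n.+1%:R + 1 :> R)%R by rewrite -natr1.
  rewrite /th h3; rewrite h3 in h2; field; exact/andP.
pose A y := \int[leb]_s G ord0 (rowvec_cons (s, y)).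
have A0 y : 0 <= A y by exact: integral_ge0.
have mA : measurable_fun setT A.
  apply: (@measurable_fun_fubini_tonelli_G _ _ _ _ R leb (G ord0 \o @rowvec_cons R n.+2)) => [|z]; last exact: G0.
  by apply: measurableT_comp => //; exact: measurable_rowvec_cons.
pose G' t i y := G (lift ord0 i) (rowvec_cons (t, y)).
have mG' t i : measurable_fun setT (G' t i) by exact: measurable_cons_slice.
pose b i t := \int[mu n.+2]_y G' t i y.
have b0 i t : 0 <= b i t by apply: integral_ge0 => y _; exact: G0.
have mb i : measurable_fun setT (b i).
  apply: (@measurable_fun_fubini_tonelli_F _ _ _ _ R (mu n.+2) (G (lift ord0 i) \o @rowvec_cons R n.+2)) => [|z]; last exact: G0.
  by apply: measurableT_comp => //; exact: measurable_rowvec_cons.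
have mprod : measurable_fun setT (fun x => \prod_i (lineint i (G i) x `^ th)).
  by apply: emeasurable_prod => i; apply: mp; exact: measurable_lineint.
have prod0 x : 0 <= \prod_i (lineint i (G i) x `^ th).
  by apply: prode_ge0 => i _; exact: poweR_ge0.
rewrite [leLHS]lebesgue_rowvecS_tonelli//.
rewrite big_ord_recl [X in _ <= X `^ _ * _]lebesgue_rowvecS_tonelli_swap// -/A.
apply: (@le_trans _ _ (\int[leb]_t ((\int[mu n.+2]_y A y) `^ th * \prod_i (b i t `^ th)))).
  apply: ge0_le_integral => //.
  - by move=> t _; exact: integral_ge0.
  - apply: (@measurable_fun_fubini_tonelli_F _ _ _ _ R (mu n.+2) ((fun x => \prod_i (lineint i (G i) x `^ th)) \o @rowvec_cons R n.+2)) => //=.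
    by apply: measurableT_comp => //; exact: measurable_rowvec_cons.
  - apply: emeasurable_funM => //; apply: emeasurable_prod => i; exact: (mp _ _ (b i) _ (mb i)).
  move=> t _.
  under eq_integral => y _.
    rewrite big_ord_recl.
    have -> : lineint ord0 (G ord0) (rowvec_cons (t, y)) = A y.
      by apply: eq_integral => s _; rewrite upd_cons0.
    have -> : \prod_(i < n.+2) lineint (lift ord0 i) (G (lift ord0 i)) (rowvec_cons (t, y)) `^ th =
       (\prod_(i < n.+2) (lineint i (G' t i) y `^ n.+1%:R^-1)) `^ (1 - th).
      rewrite prod_poweR; last by move=> i; exact: poweR_ge0.
      apply: eq_bigr => i _; rewrite -poweRrM t1; congr (_ `^ _).
      by apply: eq_integral => s _; rewrite upd_consS.
    over.
  apply: (le_trans (@ge0_hoelder _ _ R (mu n.+2) A _ th th01 mA _ A0 _)).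
  - apply: emeasurable_prod => i; apply: (mp _ _ (lineint i (G' t i))).
    by apply: measurable_lineint => // y; exact: G0.
  - by move=> y; apply: prode_ge0 => i _; exact: poweR_ge0.
  apply: lee_wpmul2l; first exact: poweR_ge0.
  under [leRHS]eq_bigr do rewrite -t1 poweRrM.
  rewrite -prod_poweR; last by move=> i; exact: poweR_ge0.
  apply: gt0_ler_poweR; rewrite ?in_itv/= ?leey ?andbT//.
  - by case/andP: th01 => _ ?; rewrite subr_ge0 ltW.
  - by apply: integral_ge0 => y _; apply: prode_ge0 => i _; exact: poweR_ge0.
  - by apply: prode_ge0 => i _; exact: poweR_ge0.
  - by apply: (IH (G' t)) => // i y; exact: G0.
rewrite ge0_integralZl//; last 3 first.
- by apply: emeasurable_prod => i; exact: (mp _ _ (b i) _ (mb i)).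
- by move=> t _; apply: prode_ge0 => i _; exact: poweR_ge0.
- exact: poweR_ge0.
apply: lee_wpmul2l; first exact: poweR_ge0.
apply: (le_trans (ge0_hoelder_prod leb mb b0)).
rewrite le_eqVlt; apply/orP; left; apply/eqP; apply: eq_bigr => i _.
by rewrite [in RHS]lebesgue_rowvecS_tonelli.
Qed.
End rowvec_tonelli.

(** * Boxes and slices *)

Section rowvec_topology.
Context (R : realType).

Lemma rowvec_ballP n (x y : 'rV[R]_n) e : 0 < e ->
  ball x e y <-> forall i, `|x ord0 i - y ord0 i| < e.
Proof.
move=> e0; split => [[_ xy] i|xy]; first exact: xy.
by split => // i j; rewrite ord1; exact: xy.
Qed.

Lemma coord_continuous_rowvec n (i : 'I_n) : continuous (fun x : 'rV[R]_n => x ord0 i).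
Proof. exact: coord_continuous. Qed.

Lemma rowvec_continuousP (T : topologicalType) n (f : T -> 'rV[R]_n) :
  (forall i, continuous (fun t => f t ord0 i)) -> continuous f.
Proof.
move=> cf t; apply/cvg_ballP => e e0.
have : \forall s \near t, forall i, ball (f t ord0 i) e (f s ord0 i).
  by apply: filter_forall => i; have /cvg_ballP := cf i t; apply.
by apply: filterS => s H; apply/rowvec_ballP => // i; exact: H.
Qed.

Definition obox n (a b : 'rV[R]_n) : set 'rV[R]_n :=
  [set x | forall i, a ord0 i < x ord0 i < b ord0 i].

Definition cbox n (a b : 'rV[R]_n) : set 'rV[R]_n :=
  [set x | forall i, a ord0 i <= x ord0 i <= b ord0 i].

Lemma measurable_obox n (a b : 'rV[R]_n) : measurable (obox a b).
Proof.
have -> : obox a b = \bigcap_(i in [set: 'I_n]) (@rowvec_coord R n i @^-1` `]a ord0 i, b ord0 i[%classic).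
  by apply/seteqP; split => y h i => [_|]; [rewrite /= in_itv/=; exact: h|have := h i Logic.I; rewrite /= in_itv].
apply: fin_bigcap_measurable => //.
by move=> i _; rewrite -[X in measurable X]setTI; apply: measurable_rowvec_coord.
Qed.

Lemma box_radius (a x y d e : R) : d < e / 2 -> `|a - x| < d ->
  a - d <= y <= a + d -> `|x - y| < e.
Proof.
by rewrite !ltr_norml => de /andP[h1 h2] /andP[h3 h4]; apply/andP; split; lra.
Qed.

(** Boxes with rational centres and half-widths 1/(k+1) are countably many. Asking
    that the closed boxes lie in U makes them supports of test functions. *)
Lemma open_bigcup_box n (U : set 'rV[R]_n) : open U ->
  exists B : nat -> set 'rV[R]_n, U = \bigcup_k B k /\
    forall k, B k = set0 \/ exists a b, B k = obox a b /\ cbox a b `<=` U.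
Proof.
move=> oU.
pose lo (p : 'rV[rat]_n * nat) : 'rV[R]_n := \row_i (ratr (p.1 ord0 i) - p.2.+1%:R^-1).
pose hi (p : 'rV[rat]_n * nat) : 'rV[R]_n := \row_i (ratr (p.1 ord0 i) + p.2.+1%:R^-1).
exists (fun k => if unpickle k is Some p then
  if `[< cbox (lo p) (hi p) `<=` U >] then obox (lo p) (hi p) else set0 else set0).
split; last first.
  move=> k; case: (unpickle k) => [p|]; last by left.
  by case: asboolP => h; [right; exists (lo p), (hi p)|left].
apply/seteqP; split => [x Ux|x [k _]]; last first.
  case: (unpickle k) => // p; case: asboolP => // h xb; apply: h => i.
  by have /andP[h1 h2] := xb i; rewrite !ltW.
have [e /= e0 eU] : exists2 e, 0 < e & ball x e `<=` U.
  by move: oU; rewrite openE => /(_ x Ux) /nbhs_ballP[e /= e0 eU]; exists e.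
have [k ke] : exists k, k.+1%:R^-1 < e / 2.
  have e20 : 0 < e / 2 by rewrite divr_gt0.
  exists (Num.truncn (e / 2)^-1); rewrite -[ltRHS]invrK ltf_pV2 ?posrE ?invr_gt0//.
  exact: truncnS_gt.
have k0 : 0 < k.+1%:R^-1 :> R by rewrite invr_gt0.
have /choice[c cx] : forall i, exists r : rat, `|ratr r - x ord0 i| < k.+1%:R^-1.
  move=> i; have /rat_in_itvoo[r] : x ord0 i - k.+1%:R^-1 < x ord0 i + k.+1%:R^-1.
    by rewrite ltrD2l gtrN.
  by rewrite in_itv/= => h; exists r; rewrite ltr_distl.
exists (pickle (\row_i c i, k)) => //; rewrite pickleK.
case: asboolP => h.
  move=> i; rewrite !mxE /=; have := cx i; rewrite ltr_distl => /andP[h1 h2].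
  by rewrite ltrBlDr h2 -ltrBlDr h1.
exfalso; apply: h => y qy; apply: eU.
apply/rowvec_ballP => // i; have := qy i; have := cx i; rewrite /lo /hi /= !mxE.
move: ke; apply: box_radius.
Qed.

Lemma open_measurable_rowvec n (U : set 'rV[R]_n) : open U -> measurable U.
Proof.
move=> /open_bigcup_box[B [-> hB]]; apply: bigcup_measurable => k _.
by have [->|[a [b [-> _]]]] := hB k; [exact: measurable0|exact: measurable_obox].
Qed.

Lemma closed_measurable_rowvec n (U : set 'rV[R]_n) : closed U -> measurable U.
Proof.
by move=> cU; rewrite -[U]setCK; apply: measurableC; apply: open_measurable_rowvec; exact: closed_openC.
Qed.

Lemma compact_measurable_rowvec n (K : set 'rV[R]_n) : compact K -> measurable K.
Proof.
by move=> cK; apply: closed_measurable_rowvec; apply: compact_closed.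
Qed.

Lemma continuous_measurable_rowvec n (f : 'rV[R]_n -> R) :
  continuous f -> measurable_fun setT f.
Proof.
move=> cf; apply: (measurability _ (RGenOInfty.measurableE R)) => //.
move=> _ [_ [a ->] <-]; rewrite setTI; apply: open_measurable_rowvec.
by apply: open_comp => // x _; exact: cf.
Qed.

Definition cube n (M : R) : set 'rV[R]_n := [set x | forall i, `|x ord0 i| <= M].

Arguments cube : clear implicits.

Lemma measurable_cube n M : measurable (cube n M).
Proof.
have -> : cube n M = \bigcap_(i in [set: 'I_n]) (@rowvec_coord R n i @^-1` `[- M, M]%classic).
  apply/seteqP; split => y h i => [_|]; first by rewrite /= in_itv/= -ler_norml; exact: h.
  by have := h i Logic.I; rewrite /= in_itv/= -ler_norml.
apply: fin_bigcap_measurable => //.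
by move=> i _; rewrite -[X in measurable X]setTI; apply: measurable_rowvec_coord.
Qed.

Lemma cube_lty n M : (lebesgue_rowvec R n (cube n M) < +oo)%E.
Proof.
elim: n => [|n IH]; first by rewrite /= /dirac indicE ltry.
have cE : @rowvec_cons R n @^-1` cube n.+1 M = `[- M, M]%classic `*` cube n M.
  apply/seteqP; split => [[s y] h|[s y] [/= h1 h2] i].
    split => /=; first by have := h ord0; rewrite mxE unlift_none /= in_itv/= ler_norml.
    by move=> i; have := h (lift ord0 i); rewrite mxE liftK.
  rewrite mxE; case: unliftP => [j|] _ /=; first exact: h2.
  by move: h1; rewrite in_itv/= ler_norml.
rewrite /= /rowvec_cons_measure /pushforward cE product_measure1E//; last exact: measurable_cube.
apply: lte_mul_pinfty => //.
rewrite ge0_fin_numE//.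
suff : (lebesgue_measure (`[(- M)%R, M]%classic : set R) < +oo)%E by [].
by rewrite lebesgue_measure_itv/=; case: ifP; rewrite ?ltry.
Qed.

Lemma bounded_sub_cube n (A : set 'rV[R]_n) : bounded_set A -> exists2 M, 0 < M & A `<=` cube n M.
Proof.
move=> /ex_strict_bound_gt0[M M0 AM]; exists M => //.
move=> x Ax i; apply: (@le_trans _ _ `|x|).
  have -> : `|x| = mx_norm x by [].
  by rewrite mx_normrE; apply: (@le_bigmax _ _ _ 0 (fun ij => `|x ij.1 ij.2|) (ord0, i)).
exact: ltW (AM x Ax).
Qed.

Lemma bounded_lty n (A : set 'rV[R]_n) : measurable A -> bounded_set A ->
  (lebesgue_rowvec R n A < +oo)%E.
Proof.
move=> mA /bounded_sub_cube[M _ AM]; apply: le_lt_trans (cube_lty n M).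
by apply: le_measure; rewrite ?inE//; exact: measurable_cube.
Qed.

Lemma compact_cube n (M : R) : compact (cube n M).
Proof.
apply: bounded_closed_compact.
  exists `|M|%R; split; first exact: num_real.
  move=> B MB x xM; rewrite /=; have -> : `|x|%R = mx_norm x by [].
  rewrite mx_normrE; apply: bigmax_le; first exact: le_trans (ltW MB).
  by move=> [j k] _ /=; rewrite ord1; apply: le_trans (xM k) _; apply: le_trans (ler_norm _) (ltW MB).
have -> : cube n M = \bigcap_(i in [set: 'I_n]) ((fun x : 'rV[R]_n => x ord0 i) @^-1` `[(- M)%R, M]%classic).
  apply/seteqP; split => y h i => [_|]; first by rewrite /= in_itv/= -ler_norml; exact: h.
  by have := h i Logic.I; rewrite /= in_itv/= -ler_norml.
apply: closed_bigI => i _; apply: preimage_closed; [by move=> x _; exact: coord_continuous_rowvec|exact: interval_closed].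
Qed.

Lemma compact_support_integrable n (f : 'rV[R]_n -> R) M : continuous f ->
  (forall x, ~ cube n M x -> f x = 0%R) -> (lebesgue_rowvec R n).-integrable setT (EFin \o f).
Proof.
move=> cf supp.
have cK := @compact_cube n M.
have bf : [bounded f x | x in cube n M].
  have : compact (f @` cube n M).
    by apply: continuous_compact => //; exact: continuous_subspaceT.
  by move=> /compact_bounded[B [Br hB]]; exists B; split => // C BC y My; apply: hB => //; exists y.
have mf := continuous_measurable_rowvec cf.
have mc := @measurable_cube n M.
have : (lebesgue_rowvec R n).-integrable (cube n M) (EFin \o f).
  apply: measurable_bounded_integrable => //; first exact: cube_lty.
  exact: measurable_funTS.
move/(integrable_mkcond _ mc); apply: eq_integrable => // x _.
rewrite patchE; case: ifPn => //; rewrite notin_setE => h.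
by rewrite /= supp.
Qed.

End rowvec_topology.
Arguments cube {R} n M.

Section slices.
Context (R : realType) (n : nat).
Implicit Types (f : 'rV[R]_n -> R) (x : 'rV[R]_n).

Lemma upd_shift x i s t : upd x i (t + s) = t *: delta_mx ord0 i + upd x i s.
Proof.
apply/rowP => j; rewrite !mxE eqxx/=.
by case: (j == i); rewrite ?mulr1// mulr0 add0r.
Qed.

Lemma upd_id x i : upd x i (x ord0 i) = x.
Proof. by apply/rowP => j; rewrite mxE; case: eqVneq => [->|]. Qed.

Lemma upd_same x i s : upd x i s ord0 i = s. Proof. by rewrite mxE eqxx. Qed.

Lemma continuous_upd x i : continuous (upd x i).
Proof.
apply: rowvec_continuousP => j; under eq_fun do rewrite mxE.
by case: eqVneq => _ s; [exact: cvg_id|exact: cvg_cst].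
Qed.

Lemma is_derive_slice f x i s : derivable f (upd x i s) (delta_mx ord0 i) ->
  is_derive s (1 : R) (fun s => f (upd x i s)) (pderiv i f (upd x i s)).
Proof.
move=> df; apply/is_derive1P.
have -> : (fun h => h^-1 * (f (upd x i (h + s)) - f (upd x i s))) =
  (fun h => h^-1 *: ((f \o shift (upd x i s)) (h *: delta_mx ord0 i) - f (upd x i s))).
  by apply/funext => h; rewrite upd_shift.
exact: df.
Qed.

End slices.

(** * The Gagliardo-Nirenberg-Sobolev inequality *)

Section signed_power.
Context (R : realType) (p : R).
Hypothesis p0 : 0 <= p.

(** The odd power of exponent p + 1: it is of class C^1, so that it can be composed
    with a function that changes sign. *)
Definition spow (u : R) : R := u * `|u| `^ p.

Lemma normr_spow u : `|spow u| = `|u| `^ (p + 1).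
Proof.
rewrite normrM (ger0_norm (powR_ge0 _ _)).
rewrite -(@mulr_powRB1 _ `|u| (p + 1))//; first by rewrite addrK.
by rewrite ltr_wpDl.
Qed.

Lemma spowN u : spow (- u) = - spow u.
Proof. by rewrite /spow normrN mulNr. Qed.

Lemma continuous_powR_norm : continuous (fun u : R => `|u| `^ p).
Proof.
have [->|pn0] := eqVneq p 0.
  by under eq_fun do rewrite powRr0; exact: cst_continuous.
by apply: powR_abs_continuous; rewrite lt_neqAle eq_sym pn0.
Qed.

Lemma is_derive_spow_pos (u : R) : 0 < u ->
  is_derive u (1 : R) spow ((p + 1) * `|u| `^ p).
Proof.
move=> u0.
apply: (@near_eq_is_derive _ _ _ (fun u : R => u `^ (p + 1))).
- near=> v.
  have v0 : 0 < v by near: v; exact: lt_nbhsr.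
  rewrite /spow gtr0_norm// -(@mulr_powRB1 _ v (p + 1)) ?ltW//; first by rewrite addrK.
  by rewrite ltr_wpDl.
- apply: is_derive_eq; first exact: is_derive1_powR.
  by rewrite addrK gtr0_norm.
Unshelve. all: by end_near. Qed.

Lemma is_derive_spow (u : R) : is_derive u (1 : R) spow ((p + 1) * `|u| `^ p).
Proof.
have [u0|u0|<-] := ltgtP 0 u; first exact: is_derive_spow_pos.
- have -> : spow = (-%R) \o (spow \o (-%R)).
    by apply/funext => v /=; rewrite spowN opprK.
  have h := @is_derive_spow_pos (- u); rewrite oppr_gt0 normrN in h.
  have d1 := h u0.
  have : is_derive u (1 : R) (spow \o (-%R)) ((p + 1) * `|u| `^ p * -1).
    by apply: is_derive1_comp.
  move=> d2; have -> : (-%R) \o (spow \o (-%R)) = - (spow \o (-%R)) :> (R -> R) by [].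
  by apply: is_derive_eq; rewrite mulrN1 opprK.
apply/is_derive1P.
have s0 : spow 0 = 0 by rewrite /spow mul0r.
rewrite s0 normr0.
have -> : (p + 1) * 0 `^ p = `|0 : R| `^ p.
  rewrite normr0; have [->|pn0] := eqVneq p 0; first by rewrite powRr0 add0r mulr1.
  by rewrite powR0// mulr0.
have := @continuous_powR_norm 0; move=> /cvg_within_filter h.
have hh : `|u| `^ p @[u --> (0 : R)^'] --> `|0 : R| `^ p := h _.
apply: cvg_trans hh; apply: near_eq_cvg; near=> h'.
rewrite addr0 subr0 /spow mulKf//.
by near: h'; exact: nbhs_dnbhs_neq.
Unshelve. all: by end_near. Qed.

End signed_power.

Section gagliardo_nirenberg_sobolev.
Context (R : realType).
Local Open Scope ereal_scope.
Local Notation mu n := (lebesgue_rowvec R n).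

Lemma lee_prod (I : Type) (s : seq I) (f g : I -> \bar R) :
  (forall i, 0 <= f i) -> (forall i, f i <= g i) ->
  \prod_(i <- s) f i <= \prod_(i <- s) g i.
Proof.
move=> f0 fg; elim: s => [|i s IH]; first by rewrite !big_nil.
by rewrite !big_cons; apply: lee_pmul => //; apply: prode_ge0.
Qed.

Lemma prode_poweR m (x : \bar R) : 0 <= x -> \prod_(i < m) x = x `^ m%:R.
Proof.
move=> x0; elim: m => [|m IH]; first by rewrite big_ord0 poweRe0.
rewrite big_ord_recr/= IH -natr1 poweRD ?poweRe1//.
by apply: add_neq0_poweRD_def; rewrite natr1 pnatr_eq0.
Qed.

Definition clgrad n (theta : 'rV[R]_n -> R) (x : 'rV[R]_n) : 'rV[R]_n :=
  (\row_i pderiv i theta x)%R.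

(** The functions of class C^1 with compact support, a class that contains the test
    functions and is closed under products. *)
Definition cC1 n (theta : 'rV[R]_n -> R) : Prop :=
  [/\ continuous theta, forall i x, derivable theta x (delta_mx ord0 i),
      forall i, continuous (pderiv i theta) &
      exists M : R, forall x, ~ cube n M x -> theta x = 0%R].

(** The fundamental theorem of calculus for [spow p] of theta on the line, from a
    point outside the support to x. *)
Lemma line_ineq n (theta : 'rV[R]_n -> R) (p : R) i x : (0 <= p)%R -> cC1 theta ->
  (`|theta x| `^ (p + 1))%:E <=
  lineint i (fun z => ((p + 1) * `|theta z| `^ p * `|pderiv i theta z|)%:E) x.
Proof.
move=> p0 [ct dt cdt [M0 supp0]].
have [M M0' supp] : exists2 M, (0 <= M)%R & forall x, ~ cube n M x -> theta x = 0%R.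
  exists `|M0|%R => // z nz; apply: supp0 => h; apply: nz => j.
  exact: le_trans (h j) (ler_norm _).
have p10 : (0 < p + 1)%R by rewrite ltr_wpDl.
have G0 z : 0 <= ((p + 1) * `|theta z| `^ p * `|pderiv i theta z|)%:E.
  by rewrite lee_fin mulr_ge0// mulr_ge0 ?powR_ge0// ltW.
have [cM|cM] := leP `|x ord0 i|%R M; last first.
  rewrite supp ?normr0 ?powR0 ?gt_eqF//; first exact: lineint_ge0.
  by move=> /(_ i); rewrite leNgt cM.
set c := x ord0 i in cM.
pose a := (- (M + 1))%R.
have ac : (a < c)%R.
  by move: cM; rewrite ler_norml => /andP[h _]; rewrite /a; apply: lt_le_trans h; rewrite ltrN2 ltrDl.
pose h s := theta (upd x i s).
pose f s := ((p + 1) * `|h s| `^ p * pderiv i theta (upd x i s))%R.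
have dh s : is_derive s (1%R : R) h (pderiv i theta (upd x i s)) by exact: is_derive_slice.
have dF s : is_derive s (1%R : R) (spow p \o h) (f s).
  by apply: is_derive1_comp; exact: is_derive_spow.
have ch : continuous h by move=> s; exact: is_derive1_continuous (dh s).
have cf : continuous f.
  move=> s; apply: cvgM.
    apply: cvgMr; apply: (@continuous_comp _ _ _ h (fun u => `|u| `^ p)%R); first exact: ch.
    exact: continuous_powR_norm.
  by apply: continuous_comp; [exact: continuous_upd|exact: cdt].
have FTC : \int[lebesgue_measure]_(s in `[a, c]) (f s)%:E = (spow p (theta x))%:E.
  rewrite (continuous_FTC2 (F := spow p \o h) ac).
  - rewrite /= {1}/h upd_id [X in _ - X%:E](_ : _ = 0%R) ?sube0//.
    rewrite /h supp ?[spow _ _]mul0r// => /(_ i); rewrite upd_same /a normrN ger0_norm ?addr_ge0//.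
    by rewrite leNgt ltrDl ltr01.
  - exact: continuous_subspaceT.
  - have cFh : continuous (spow p \o h) by move=> s; exact: is_derive1_continuous (dF s).
    split.
    + by move=> s _; case: (dF s).
    + by apply: cvg_at_right_filter; exact: cFh.
    + by apply: cvg_at_left_filter; exact: cFh.
  - by move=> s _; rewrite derive1E; case: (dF s).
have mf : measurable_fun setT f by exact: continuous_measurable_fun.
rewrite -(normr_spow p0) -abse_EFin -FTC.
apply: le_trans (le_abse_integral _ _ _) _ => //.
  by apply/measurable_EFinP; exact: measurable_funTS.
apply: (@le_trans _ _ (\int[lebesgue_measure]_s `|(f s)%:E|)).
  apply: ge0_subset_integral => //.
  by apply: measurableT_comp => //; exact/measurable_EFinP.
rewrite le_eqVlt; apply/orP; left; apply/eqP; apply: eq_integral => s _.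
rewrite abse_EFin /f !normrM (ger0_norm (powR_ge0 _ _)) (ger0_norm (ltW p10)).
by [].
Qed.

Lemma cC1_bounded n (theta : 'rV[R]_n -> R) : cC1 theta ->
  \int[mu n]_x (theta x ^+ 2)%:E < +oo.
Proof.
move=> [ct _ _ [M supp]].
have ct2 : continuous (fun x => theta x ^+ 2)%R.
  by move=> x; under eq_fun do rewrite expr2; have h := ct x; exact: (cvgM h h).
have /integrableP[_] : (mu n).-integrable setT (EFin \o (fun x => theta x ^+ 2)%R).
  by apply: (@compact_support_integrable _ _ _ M) => // x /supp ->; rewrite expr0n.
have mt2 : measurable_fun setT (EFin \o (fun x => theta x ^+ 2)%R).
  by apply/measurable_EFinP; exact: continuous_measurable_rowvec ct2.
apply: le_lt_trans; apply: ge0_le_integral => //.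
- by move=> x _; rewrite lee_fin sqr_ge0.
- exact: measurableT_comp mt2.
by move=> x _; rewrite lee_fin ler_norm.
Qed.

(** Gagliardo and Nirenberg's argument. The dimension is n + 2 and q is the
    exponent whose Sobolev conjugate is 2. [line_ineq] in every direction and
    [loomis_whitney] bound A = \int theta^2 by a power of the integrals of
    |theta|^p |grad theta|, and Hoelder's inequality bounds these by
    A^th B^(1/q); as A is finite, A^th can be divided out. *)
Lemma gns_inequality n (theta : 'rV[R]_n.+2 -> R) (q : R) :
  (q = 2 * (n%:R + 2) / (n%:R + 4))%R -> cC1 theta ->
  (\int[mu n.+2]_x (theta x ^+ 2)%:E) `^ 2^-1 <=
  2%:E * (\int[mu n.+2]_x (enorm (clgrad theta x) `^ q)%:E) `^ q^-1.
Proof.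
move=> qE th1; have [ct dt cdt _] := th1.
have Aoo := cC1_bounded th1.
have n0 : (0 <= n%:R :> R)%R by rewrite ler0n.
set A := \int[mu n.+2]_x (theta x ^+ 2)%:E in Aoo *.
set B := \int[mu n.+2]_x _.
(* (p + 1) (n + 2) / (n + 1) = 2, so that the product over the n + 2
   directions of the powers 1 / (n + 1) of |theta|^(p + 1) is theta^2; and
   (theta^2)^th = |theta|^p. *)
pose p : R := (n%:R / (n%:R + 2))%R.
pose th : R := (n%:R / (2 * (n%:R + 2)))%R.
have p0 : (0 <= p)%R by rewrite divr_ge0// addr_ge0.
have q0 : (0 < q)%R by rewrite qE divr_gt0 ?mulr_gt0// ltr_wpDl.
have qth : (q^-1 = 1 - th)%R by rewrite qE /th; field; lra.
have mt := continuous_measurable_rowvec ct.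
have mdt i := continuous_measurable_rowvec (cdt i).
have cgrad : continuous (fun x => enorm (clgrad theta x)).
  move=> x; apply: (@continuous_comp _ _ _ (fun x => \sum_i (clgrad theta x) ord0 i ^+ 2)%R Num.sqrt); last exact: sqrt_continuous.
  apply: (sum_continuous (F := fun i x => (clgrad theta x) ord0 i ^+ 2)%R) => i z.
  under eq_fun do rewrite mxE expr2.
  by have c := cdt i z; exact: (cvgM c c).
have mgrad := continuous_measurable_rowvec cgrad.
pose G i z := ((p + 1) * `|theta z| `^ p * `|pderiv i theta z|)%:E.
have p10 : (0 < p + 1)%R by rewrite ltr_wpDl.
have G0 i z : 0 <= G i z.
  by rewrite lee_fin mulr_ge0// mulr_ge0 ?powR_ge0// ltW.
have mt2 : measurable_fun setT (fun x => (theta x ^+ 2)%:E).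
  by apply/measurable_EFinP; exact: measurable_funX.
have mtp r : measurable_fun setT (fun z => `|theta z| `^ r)%R.
  apply: (measurableT_comp (measurable_powR _)).
  exact: (measurableT_comp (@normr_measurable R setT)).
have mG i : measurable_fun setT (G i).
  apply/measurable_EFinP; apply: measurable_funM; first exact: measurable_funM.
  exact: (measurableT_comp (@normr_measurable R setT)).
have mgq : measurable_fun setT (fun x => (enorm (clgrad theta x) `^ q)%:E).
  by apply/measurable_EFinP; apply: (measurableT_comp (measurable_powR _)).
have GB i : \int[mu n.+2]_x G i x <= (p + 1)%:E * (A `^ th * B `^ q^-1).
  rewrite /G; under eq_integral do rewrite -mulrA EFinM.
  have mm : measurable_fun setT (fun x => (`|theta x| `^ p * `|pderiv i theta x|)%:E).
    apply/measurable_EFinP; apply: measurable_funM; first exact: mtp.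
    exact: (measurableT_comp (@normr_measurable R setT)).
  rewrite ge0_integralZl ?lee_fin ?(ltW p10)//.
  apply: lee_wpmul2l; first by rewrite lee_fin ltW.
  have le_grad x : (`|pderiv i theta x| <= enorm (clgrad theta x))%R.
    by have := coord_le_enorm (clgrad theta x) i; rewrite mxE.
  (* In the plane p = 0 and q = 1, a case without interpolation. *)
  have [n00|nn0] := eqVneq n 0%N.
    have pE : p = 0%R by rewrite /p n00 mul0r.
    have thE : th = 0%R by rewrite /th n00 mul0r.
    have q1 : q = 1%R by move: qth; rewrite thE subr0 => /(congr1 GRing.inv); rewrite invrK invr1.
    rewrite thE poweRe0 mul1e /B q1 invr1 poweRe1; last by apply: integral_ge0 => x _; rewrite lee_fin powR_ge0.
    apply: ge0_le_integral => //; first by rewrite -q1.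
    by move=> x _; rewrite lee_fin pE powRr0 mul1r powRr1 ?enorm_ge0.
  have nn1 : (0 < n%:R :> R)%R by rewrite ltr0n lt0n.
  have th01 : (0 < th < 1)%R.
    by rewrite divr_gt0 ?mulr_gt0 ?addr_gt0//= ltr_pdivrMr ?mulr_gt0 ?addr_gt0//; lra.
  rewrite qth.
  have t20 x : 0 <= (theta x ^+ 2)%:E by rewrite lee_fin sqr_ge0.
  have g20 x : 0 <= (enorm (clgrad theta x) `^ q)%:E by rewrite lee_fin powR_ge0.
  apply: le_trans (@ge0_hoelder _ _ _ (mu n.+2) _ _ th th01 mt2 mgq t20 g20).
  - apply: ge0_le_integral => //.
    + apply: emeasurable_funM.
        apply: (@measurableT_comp _ _ _ _ _ _ (@poweR R ^~ th)); first exact: measurable_poweR.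
        by apply/measurable_EFinP; exact: measurable_funX.
      by apply: (@measurableT_comp _ _ _ _ _ _ (@poweR R ^~ (1 - th)%R)) => //; exact: measurable_poweR.
    move=> x _; rewrite !poweR_EFin -EFinM lee_fin -powRrM -qth mulfV ?gt_eqF// powRr1 ?enorm_ge0//.
    have -> : ((theta x ^+ 2) `^ th = `|theta x| `^ p)%R.
      rewrite -real_normK ?num_real// -powR_mulrn// -powRrM; congr (_ `^ _)%R.
      by rewrite /th /p; field; lra.
    by rewrite ler_wpM2l ?powR_ge0.
have A0 : 0 <= A by apply: integral_ge0 => x _; rewrite lee_fin sqr_ge0.
have B0 : 0 <= B by apply: integral_ge0 => x _; rewrite lee_fin powR_ge0.
have AQ : A <= ((p + 1)%:E * (A `^ th * B `^ q^-1)) `^ ((n%:R + 2) / (n%:R + 1)).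
  apply: (@le_trans _ _ (\int[mu n.+2]_x \prod_i (lineint i (G i) x `^ n.+1%:R^-1))).
    apply: ge0_le_integral => //.
    - by move=> x _; rewrite lee_fin sqr_ge0.
    - apply: emeasurable_prod => i.
      apply: (@measurableT_comp _ _ _ _ _ _ (@poweR R ^~ (n.+1%:R^-1)%R)); first exact: measurable_poweR.
      exact: measurable_lineint.
    move=> x _.
    apply: (@le_trans _ _ (\prod_(i < n.+2) ((`|theta x| `^ (p + 1))%:E `^ n.+1%:R^-1))).
      rewrite poweR_EFin prodEFin lee_fin prodr_const card_ord -[in leRHS]powR_mulrn ?powR_ge0//.
      rewrite -!powRrM -real_normK ?num_real// -[in leLHS]powR_mulrn//.
      rewrite le_eqVlt; apply/orP; left; apply/eqP; congr (_ `^ _)%R.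
      rewrite /p -!natr1; field.
      by rewrite -natrD; apply/andP; split; [rewrite natr1 pnatr_eq0|lra].
    apply: lee_prod => i; first exact: poweR_ge0.
    apply: gt0_ler_poweR; rewrite ?invr_ge0// ?in_itv/= ?leey ?andbT ?lee_fin ?powR_ge0//.
      exact: lineint_ge0.
    exact: line_ineq.
  apply: le_trans (loomis_whitney mG G0) _.
  apply: (@le_trans _ _ (\prod_(i < n.+2) (((p + 1)%:E * (A `^ th * B `^ q^-1)) `^ n.+1%:R^-1))).
    apply: lee_prod => i; first exact: poweR_ge0.
    apply: gt0_ler_poweR; rewrite ?invr_ge0// ?in_itv/= ?leey ?andbT//.
    - exact: integral_ge0.
    - by rewrite mule_ge0 ?lee_fin ?(ltW p10)// mule_ge0 ?poweR_ge0.
  set W := _ * _; have W0 : 0 <= W by rewrite mule_ge0 ?lee_fin ?(ltW p10)// mule_ge0 ?poweR_ge0.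
  rewrite le_eqVlt; apply/orP; left; apply/eqP.
  have -> : ((n%:R + 2) / (n%:R + 1) = n.+1%:R^-1 * n.+2%:R :> R)%R.
    by rewrite mulrC -!natr1; congr (_ * _)%R; ring.
  by rewrite poweRrM prode_poweR// poweR_ge0.
have p2 : (p + 1 <= 2)%R by rewrite /p; have : (n%:R / (n%:R + 2) <= 1 :> R)%R; [rewrite ler_pdivrMr; lra|lra].
have [A00|An0] := eqVneq A 0.
  by rewrite A00 poweR0r ?invr_eq0 ?pnatr_eq0// mule_ge0// poweR_ge0.
have [Boo|Bfin] := eqVneq B +oo.
  by rewrite Boo poweRyr ?invr_eq0 ?gt_eqF// gt0_muley ?leey// lte_fin.
have [a AE] : exists a, A = a%:E.
  by exists (fine A); rewrite fineK// ge0_fin_numE.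
have [b BE] : exists b, B = b%:E.
  by exists (fine B); rewrite fineK// ge0_fin_numE// ltey.
rewrite AE BE in A0 B0 An0 AQ *; rewrite !lee_fin in A0 B0.
have a0 : (0 < a)%R by rewrite lt_neqAle A0 andbT eq_sym.
have {}AQ : (a <= ((p + 1) * (a `^ th * b `^ q^-1)) `^ ((n%:R + 2) / (n%:R + 1)))%R := AQ.
rewrite !poweR_EFin -EFinM lee_fin.
pose r := ((n%:R + 1) / (n%:R + 2))%R : R.
have r0 : (0 <= r)%R by rewrite divr_ge0// addr_ge0.
have h1 : (a `^ r <= (p + 1) * (a `^ th * b `^ q^-1))%R.
  have W0 : (0 <= (p + 1) * (a `^ th * b `^ q^-1))%R.
    by rewrite mulr_ge0 ?(ltW p10)// mulr_ge0 ?powR_ge0.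
  have := @ge0_ler_powR _ r r0 _ _ _ _ AQ; rewrite !nnegrE => /(_ A0 (powR_ge0 _ _)).
  rewrite -powRrM (_ : _ / _ * r = 1)%R ?powRr1//.
  by rewrite /r; field; rewrite !gt_eqF//; lra.
have h2 : (a `^ r = a `^ th * a `^ 2^-1)%R.
  rewrite -powRD; last by rewrite (gt_eqF a0) implybT.
  by congr (_ `^ _)%R; rewrite /r /th; field; lra.
have h3 : (a `^ 2^-1 <= (p + 1) * b `^ q^-1)%R.
  rewrite -(@ler_pM2l _ (a `^ th)) ?powR_gt0// -h2; apply: le_trans h1 _.
  by rewrite mulrCA.
by apply: (le_trans h3); rewrite ler_wpM2r ?powR_ge0.
Qed.

End gagliardo_nirenberg_sobolev.

(** * Integration by parts *)

Section integration_by_parts.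
Context (R : realType).
Local Open Scope ereal_scope.
Local Notation leb := (@lebesgue_measure R).
Local Notation mu n := (lebesgue_rowvec R n).

(** Tonelli's theorem, in an order in which the i-th coordinate is integrated
    first. *)
Lemma integral_lineint_eq n (i : 'I_n) (F G : 'rV[R]_n -> \bar R) :
  measurable_fun setT F -> measurable_fun setT G ->
  (forall x, 0 <= F x) -> (forall x, 0 <= G x) ->
  (forall x, lineint i F x = lineint i G x) ->
  \int[mu n]_x F x = \int[mu n]_x G x.
Proof.
elim: n i F G => [[]//|n IH] i F G mF mG F0 G0 FG.
case: (unliftP ord0 i) FG => [j ->|->] FG.
  rewrite !lebesgue_rowvecS_tonelli//; apply: eq_integral => s _.
  apply: (IH j) => // [||y]; try exact: measurable_cons_slice.
  have := FG (rowvec_cons (s, y)); rewrite /lineint.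
  by under eq_integral do rewrite upd_consS; under [in RHS]eq_integral do rewrite upd_consS.
rewrite !lebesgue_rowvecS_tonelli_swap//; apply: eq_integral => y _.
have := FG (rowvec_cons (0%R, y)); rewrite /lineint.
by under eq_integral do rewrite upd_cons0; under [in RHS]eq_integral do rewrite upd_cons0.
Qed.

Lemma rowvec_hausdorff n : hausdorff_space 'rV[R]_n.
Proof. exact: norm_hausdorff. Qed.

Lemma pderiv_off_closed n (i : 'I_n) (K : set 'rV[R]_n) (f : 'rV[R]_n -> R) :
  closed K -> (forall x, ~ K x -> f x = 0%R) -> forall x, ~ K x -> pderiv i f x = 0%R.
Proof.
move=> cK f0 x nKx; rewrite /pderiv.
have : \forall y \near x, f y = cst 0%R y.
  have : open (~` K) by exact: closed_openC.
  by rewrite openE => /(_ x nKx); apply: filterS => y; exact: f0.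
by move=> /near_eq_derive ->; exact: derive_cst.
Qed.

(** On every line parallel to the i-th axis the derivative has integral 0, that is,
    its positive and negative parts have the same integral; for nonnegative
    functions this passes to the whole space by [integral_lineint_eq]. *)
Lemma integral_pderiv0 n (i : 'I_n) (h : 'rV[R]_n -> R) : cC1 h ->
  \int[mu n]_x (pderiv i h x)%:E = 0.
Proof.
move=> [ch dh cdh [M0 supp0]].
have [M M0' supp] : exists2 M, (0 < M)%R & forall x, ~ cube n M x -> h x = 0%R.
  exists (`|M0| + 1)%R => [|z nz]; first by rewrite ltr_wpDl.
  by apply: supp0 => k; apply: nz => j; apply: le_trans (k j) _; apply: le_trans (ler_norm _) _; rewrite lerDl.
have mdh := continuous_measurable_rowvec (cdh i).
have suppd x : ~ cube n M x -> pderiv i h x = 0%R.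
  by apply: pderiv_off_closed => //; apply: compact_closed; [exact: rowvec_hausdorff|exact: compact_cube].
have Idh := compact_support_integrable (cdh i) suppd.
have lines x : lineint i (EFin \o pderiv i h)^\+ x = lineint i (EFin \o pderiv i h)^\- x.
  pose f (s : R) : R := pderiv i h (upd x i s); pose H (s : R) : R := h (upd x i s).
  have dH s : is_derive s (1%R : R) H (f s) by exact: is_derive_slice.
  have cf : continuous f.
    by move=> s; apply: (@continuous_comp _ _ _ (upd x i) (pderiv i h)); [exact: continuous_upd|exact: cdh].
  have cH s : {for s, continuous H} by exact: is_derive1_continuous (dH s).
  have offM s : (M < `|s|)%R -> ~ cube n M (upd x i s).
    by move=> Mt /(_ i); rewrite upd_same leNgt Mt.
  rewrite /lineint.
  have mf : measurable_fun setT f by exact: continuous_measurable_fun.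
  pose a := (- (M + 1))%R; pose b := (M + 1)%R.
  have ab : (a < b)%R by rewrite /a /b; lra.
  have sub (g : R -> \bar R) : (forall s, f s = 0%R -> g s = 0) -> \int[leb]_s g s = \int[leb]_(s in `[a, b]) g s.
    move=> g0; rewrite [RHS]integral_mkcond; apply: eq_integral => s _.
    rewrite patchE; case: ifPn => //; rewrite notin_setE /= in_itv/= /a /b -ler_norml => /negP.
    by rewrite -ltNge => hs; rewrite g0// /f suppd//; apply: offM; apply: lt_trans hs; rewrite ltrDl.
  have FTC : \int[leb]_(s in `[a, b]) (f s)%:E = 0.
    rewrite (continuous_FTC2 (F := H) ab).
    - rewrite /H !supp ?sube0//; apply: offM; rewrite /a /b ?normrN ger0_norm; lra.
    - exact: continuous_subspaceT.
    - split.
      + by move=> s _; case: (dH s).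
      + by apply: cvg_at_right_filter; exact: cH.
      + by apply: cvg_at_left_filter; exact: cH.
    - by move=> s _; rewrite derive1E; case: (dH s).
  have If : leb.-integrable `[a, b] (EFin \o f).
    apply: continuous_compact_integrable; first exact: segment_compact.
    exact: continuous_subspaceT.
  have Ifm : \int[leb]_(s in `[a, b]) (EFin \o f)^\- s \is a fin_num.
    exact: integrable_neg_fin_num.
  have Ifp : \int[leb]_(s in `[a, b]) (EFin \o f)^\+ s \is a fin_num.
    exact: integrable_pos_fin_num.
  have {}FTC : \int[leb]_(s in `[a, b]) (EFin \o f)^\+ s = \int[leb]_(s in `[a, b]) (EFin \o f)^\- s.
    have : \int[leb]_(s in `[a, b]) (EFin \o f)^\+ s - \int[leb]_(s in `[a, b]) (EFin \o f)^\- s = 0.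
      by rewrite -integralE.
    by rewrite -(fineK Ifp) -(fineK Ifm) -EFinB => -[/eqP]; rewrite subr_eq0 => /eqP ->.
  transitivity (\int[leb]_(s in `[a, b]) (EFin \o f)^\+ s).
    transitivity (\int[leb]_s (EFin \o f)^\+ s); first by apply: eq_integral => s _; rewrite !funeposE.
    by apply: sub => s fs; rewrite funeposE /= fs maxxx.
  transitivity (\int[leb]_(s in `[a, b]) (EFin \o f)^\- s).
    exact: FTC.
  transitivity (\int[leb]_s (EFin \o f)^\- s); last by apply: eq_integral => s _; rewrite !funenegE.
  by apply/esym/sub => s fs; rewrite funenegE /= fs oppr0 maxxx.
rewrite integralE (@integral_lineint_eq _ i _ (EFin \o pderiv i h)^\-)//.
- by rewrite subee//; exact: integrable_neg_fin_num.
- by apply: measurable_funepos; exact/measurable_EFinP.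
- by apply: measurable_funeneg; exact/measurable_EFinP.
Qed.

Lemma pderivM n (i : 'I_n) (f g : 'rV[R]_n -> R) x :
  derivable f x (delta_mx ord0 i) -> derivable g x (delta_mx ord0 i) ->
  pderiv i (fun x => f x * g x)%R x = (f x * pderiv i g x + pderiv i f x * g x)%R.
Proof. by move=> df dg; rewrite /pderiv (@deriveM _ _ f g)// [X in (_ + X)%R]mulrC. Qed.

Lemma continuous_mul (T : topologicalType) (f g : T -> R) :
  continuous f -> continuous g -> continuous (fun x => f x * g x)%R.
Proof. by move=> cf cg x; have h := cf x; have h' := cg x; exact: (cvgM h h'). Qed.

Lemma continuous_add (T : topologicalType) (f g : T -> R) :
  continuous f -> continuous g -> continuous (fun x => f x + g x)%R.
Proof. by move=> cf cg x; have h := cf x; have h' := cg x; exact: (cvgD h h'). Qed.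

Lemma cC1M n (f g : 'rV[R]_n -> R) : cC1 f -> cC1 g -> cC1 (fun x => f x * g x)%R.
Proof.
move=> [cf df cdf [M fM]] [cg dg cdg _]; split.
- by move=> x; have h := cf x; have h' := cg x; exact: (cvgM h h').
- by move=> i x; apply: (@derivableM _ _ f g).
- move=> i; rewrite (_ : pderiv i _ = fun x => f x * pderiv i g x + pderiv i f x * g x)%R.
    by apply: continuous_add; exact: continuous_mul.
  by apply/funext => x; rewrite pderivM.
- by exists M => x /fM ->; rewrite mul0r.
Qed.

Lemma pderiv_flatten n (i : 'I_n) (s : seq 'I_n) : uniq s ->
  flatten [seq nseq (mi_unit i j) j | j <- s] = if i \in s then [:: i] else [::].
Proof.
elim: s => //= j s IH /andP[js /IH ->]; rewrite in_cons /mi_unit eq_sym.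
by case: eqVneq => //= ->; rewrite (negbTE js).
Qed.

Lemma mi_pderiv_unit n (i : 'I_n) (f : 'rV[R]_n -> R) :
  mi_pderiv (mi_unit i) f = pderiv i f.
Proof. by rewrite /mi_pderiv pderiv_flatten ?enum_uniq// mem_enum. Qed.

Lemma mi_pderiv0 n (f : 'rV[R]_n -> R) : mi_pderiv (fun=> 0%N) f = f.
Proof.
rewrite /mi_pderiv (_ : flatten _ = [::])//.
by elim: (enum 'I_n).
Qed.

Lemma mi_order_unit n (i : 'I_n) : mi_order (mi_unit i) = 1%N.
Proof.
rewrite /mi_order (bigD1 i)//= big1 /mi_unit ?eqxx// => j /negbTE ->//.
Qed.

Lemma mi_order0 n : mi_order ((fun=> 0%N) : multi_index n) = 0%N.
Proof. by rewrite /mi_order big1. Qed.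

Lemma mi_order_le1 n (al : multi_index n) : (mi_order al <= 1)%N ->
  al = (fun=> 0%N) \/ exists i, al = mi_unit i.
Proof.
move=> al1; have [h|/existsNP[i ai]] := pselect (forall i, al i = 0%N).
  by left; apply/funext.
right; exists i; apply/funext => j; move: al1.
have {}ai : (0 < al i)%N by rewrite lt0n; apply/eqP.
rewrite /mi_order (bigD1 i)//= /mi_unit; case: eqVneq => [->|ji].
  by move=> h; apply/eqP; rewrite eqn_leq ai andbT (leq_trans _ h)// leq_addr.
rewrite (bigD1 j)//= => h; apply/eqP; rewrite -leqn0 -(leq_add2l (al i)) addn0.
apply: leq_trans ai; apply: leq_trans h; by rewrite leq_add2l leq_addr.
Qed.

Lemma test_cC1 n (Omega : set 'rV[R]_n) (theta : 'rV[R]_n -> R) :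
  test_function Omega theta -> cC1 theta.
Proof.
move=> [sm [K [cK KO off]]]; split.
- by have [] := sm [::].
- by have [] := sm [::].
- by move=> i; have [] := sm [:: i].
- have /bounded_sub_cube[M _ KM] := compact_bounded cK.
  by exists M => x nx; apply: off => /KM.
Qed.

Lemma test_support n (Omega : set 'rV[R]_n) (theta : 'rV[R]_n -> R) :
  test_function Omega theta -> forall x, ~ Omega x -> theta x = 0%R.
Proof. by move=> [_ [K [_ KO off]]] x nx; apply: off => /KO. Qed.

Lemma test_pderiv_support n (Omega : set 'rV[R]_n) (theta : 'rV[R]_n -> R) i :
  test_function Omega theta -> forall x, ~ Omega x -> pderiv i theta x = 0%R.
Proof.
move=> [_ [K [cK KO off]]] x nx; apply: (@pderiv_off_closed _ i K) => //.
  by apply: compact_closed => //; exact: rowvec_hausdorff.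
by move=> /KO.
Qed.

Lemma continuous_loc_integrable n (Omega : set 'rV[R]_n) (u : 'rV[R]_n -> R) :
  open Omega -> continuous u -> loc_integrable Omega u.
Proof.
move=> oO cu; have mu_ := continuous_measurable_rowvec cu; split.
  exact: measurable_funTS.
move=> K cK _; have mK := compact_measurable_rowvec cK.
apply: measurable_bounded_integrable => //.
- by apply: bounded_lty => //; exact: compact_bounded.
- exact: measurable_funTS.
have : compact (u @` K).
  by apply: continuous_compact => //; exact: continuous_subspaceT.
move=> /compact_bounded[B [Br hB]]; exists B; split => // C BC y My; apply: hB => //; exists y => //.
Qed.

Lemma Rintegral_off n (Omega : set 'rV[R]_n) (f : 'rV[R]_n -> R) :
  (forall x, ~ Omega x -> f x = 0%R) ->
  (\int[mu n]_(x in Omega) f x = \int[mu n]_x f x)%R.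
Proof.
move=> h; rewrite /Rintegral; congr fine; rewrite [LHS]integral_mkcond.
apply: eq_integral => x _; rewrite patchE; case: ifPn => //; rewrite notin_setE => /h.
by rewrite /= => ->.
Qed.

(** Integration by parts: the derivative of the product with another test function
    has integral 0. *)
Lemma test_wderiv1 n (Omega : set 'rV[R]_n) (theta : 'rV[R]_n -> R) i :
  open Omega -> test_function Omega theta ->
  is_wderiv Omega (mi_unit i) theta (pderiv i theta).
Proof.
move=> oO th; have c1 := test_cC1 th; have [ct dt cdt _] := c1; split.
- exact: continuous_loc_integrable.
- exact: continuous_loc_integrable.
move=> eta te; have c2 := test_cC1 te; have [ce de cde [M eM]] := c2.
rewrite mi_pderiv_unit mi_order_unit expr1 mulN1r.
rewrite (@Rintegral_off n Omega (fun x => theta x * pderiv i eta x)%R); last first.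
  by move=> x nx; rewrite (test_support th)// mul0r.
rewrite (@Rintegral_off n Omega (fun x => pderiv i theta x * eta x)%R); last first.
  by move=> x nx; rewrite (test_support te)// mulr0.
have cK := @compact_cube R n M.
have sd x : ~ cube n M x -> pderiv i eta x = 0%R.
  by apply: pderiv_off_closed => //; apply: compact_closed; first exact: rowvec_hausdorff.
have I1 : (mu n).-integrable setT (EFin \o (fun x => theta x * pderiv i eta x)%R).
  apply: (@compact_support_integrable _ _ _ M) => [x|x nx]; last by rewrite sd// mulr0.
  by have h := ct x; have h' := cde i x; exact: (cvgM h h').
have I2 : (mu n).-integrable setT (EFin \o (fun x => pderiv i theta x * eta x)%R).
  apply: (@compact_support_integrable _ _ _ M) => [x|x nx]; last by rewrite eM// mulr0.
  by have h := cdt i x; have h' := ce x; exact: (cvgM h h').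
apply/eqP; rewrite -addr_eq0 -RintegralD//; apply/eqP.
rewrite /Rintegral -[RHS]/(fine 0); congr fine.
rewrite -(integral_pderiv0 i (cC1M c1 c2)); apply: eq_integral => x _.
by rewrite pderivM.
Qed.

Lemma wderiv0_id n (Omega : set 'rV[R]_n) (u : 'rV[R]_n -> R) :
  loc_integrable Omega u -> is_wderiv Omega (fun=> 0%N) u u.
Proof.
move=> lu; split=> // theta th.
by rewrite mi_pderiv0 mi_order0 expr0 mul1r.
Qed.
End integration_by_parts.

(** * The du Bois-Reymond lemma *)

Section one_variable_bumps.
Context (R : realType).

(** The flat exponential exp(- c / x), times powers of 1 / x so that derivatives
    are combinations of functions of the same family. *)
Definition flatexp (c : R) (k : nat) (x : R) : R :=
  if 0 < x then x ^- k * expR (- (c / x)) else 0.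

Lemma flatexp_ge0 c k x : 0 <= flatexp c k x.
Proof.
by rewrite /flatexp; case: ifPn => // x0; rewrite mulr_ge0 ?expR_ge0// invr_ge0 exprn_ge0 ?ltW.
Qed.

Lemma flatexp_le1 c x : 0 < c -> flatexp c 0 x <= 1.
Proof.
move=> c0; rewrite /flatexp; case: ifPn => // x0.
by rewrite expr0 invr1 mul1r -expR0 ler_expR oppr_le0 divr_ge0 ?ltW.
Qed.

(** The exponential dominates every power; the exponent 2 on the right makes the
    function differentiable at 0 with derivative 0. *)
Lemma flatexp_le_sqr c k : 0 < c -> exists2 C, 0 < C & forall x, flatexp c k x <= C * x ^+ 2.
Proof.
move=> c0; pose m : R := k.+2%:R.
have m0 : 0 < m by rewrite ltr0n.
exists ((m / c) ^+ k.+2) => [|x]; first by rewrite exprn_gt0// divr_gt0.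
rewrite /flatexp; case: ifPn => [x0|_]; last first.
  by rewrite mulr_ge0 ?sqr_ge0// exprn_ge0// divr_ge0 ?ltW.
have cx0 : 0 < c / x / m by rewrite divr_gt0// divr_gt0.
have h : expR (- (c / x)) <= (m * x / c) ^+ k.+2.
  have -> : - (c / x) = - (c / x / m) * m by rewrite mulNr mulfVK ?gt_eqF.
  rewrite mulrC expRM_natl; apply: lerXn2r; rewrite ?nnegrE ?expR_ge0//.
    by rewrite divr_ge0 ?ltW// mulr_gt0.
  rewrite expRN -[leRHS]invrK lef_pV2 ?posrE ?expR_gt0 ?invr_gt0//; last by rewrite divr_gt0// mulr_gt0.
  apply: le_trans (expR_ge1Dx _); have -> : (m * x / c)^-1 = c / x / m.
    by field; rewrite !gt_eqF.
  by rewrite lerDr.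
apply: le_trans (ler_wpM2l _ h) _; first by rewrite invr_ge0 exprn_ge0// ltW.
have -> : m * x / c = m / c * x by field; rewrite gt_eqF.
rewrite exprMn mulrCA; apply: ler_wpM2l; first by rewrite exprn_ge0// divr_ge0 ?ltW.
have : x ^+ k * x ^+ 2 = x ^+ k.+2 by rewrite -exprD addn2.
by move=> <-; rewrite mulKf//; apply: expf_neq0; rewrite gt_eqF.
Qed.

Lemma is_derive_flatexp c k x : 0 < c ->
  is_derive x (1 : R) (flatexp c k) (c * flatexp c k.+2 x - k%:R * flatexp c k.+1 x).
Proof.
move=> c0; have [x0|x0|x0] := ltgtP 0 x.
- have near_x : \forall y \near x, y ^- k * expR (- (c / y)) = flatexp c k y.
    near=> y; rewrite /flatexp ifT//; near: y; exact: lt_nbhsr.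
  apply: near_eq_is_derive near_x _.
  rewrite /flatexp x0.
  have dV : is_derive x (1 : R) (fun y : R => y^-1) (- x ^- 2).
    by apply: is_derive_eq; first (apply: is_deriveV; rewrite gt_eqF//); rewrite scaler1//.
  have dVk : is_derive x (1 : R) (fun y : R => y ^- k) (- (k%:R * x ^- k.+1)).
    case: k => [|k].
      have -> : (fun y : R => y ^- 0) = cst 1 by apply/funext => y; rewrite expr0 invr1.
      by rewrite mul0r oppr0; exact: is_derive_cst.
    have -> : (fun y : R => y ^- k.+1) = (fun y : R => y^-1) ^+ k.+1.
      by apply/funext => y; rewrite fctE exprVn.
    apply: is_derive_eq.
    rewrite /GRing.scale /= mulrN; congr (- _); rewrite -!exprVn !exprS expr0; ring.
  have dE : is_derive x (1 : R) (fun y : R => expR (- (c / y))) (c * x ^- 2 * expR (- (c / x))).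
    apply: is_derive_eq.
    by rewrite /GRing.scale/=; ring.
  apply: is_derive_eq.
  rewrite /GRing.scale /= -!exprVn !exprS; ring.
- have near_x : \forall y \near x, cst 0 y = flatexp c k y.
    near=> y; rewrite /flatexp ifF//; apply/negbTE; rewrite -leNgt ltW//; near: y.
    exact: lt_nbhsl.
  apply: near_eq_is_derive near_x _; rewrite /flatexp !ifF ?mulr0 ?subr0.
  all: try by apply/negbTE; rewrite -leNgt ltW.
  exact: is_derive_cst.
rewrite -x0 /flatexp ltxx !mulr0 subr0; apply/is_derive1P.
have [C C0 hC] := flatexp_le_sqr k c0.
apply/cvgr0Pnorm_le => e e0; near=> h.
rewrite addr0 ltxx subr0 -/(flatexp c k h).
have h0 : h != 0 by near: h; exact: nbhs_dnbhs_neq.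
rewrite normrM normfV ler_pdivrMl ?normr_gt0// ger0_norm ?flatexp_ge0//.
apply: le_trans (hC h) _; rewrite -real_normK ?num_real// expr2 mulrA mulrC.
rewrite ler_wpM2l// mulrC -ler_pdivlMr//.
by near: h; apply: dnbhs0_le; rewrite divr_gt0.
Unshelve. all: by end_near. Qed.

(** An algebra that is closed under derivation, so that differentiability of its
    members means smoothness. *)
Inductive flatfun : (R -> R) -> Prop :=
| flatfun_exp c k a b : 0 < c -> flatfun (fun x => flatexp c k (a * x + b))
| flatfun_add f g : flatfun f -> flatfun g -> flatfun (fun x => f x + g x)
| flatfun_scale r f : flatfun f -> flatfun (fun x => r * f x)
| flatfun_mul f g : flatfun f -> flatfun g -> flatfun (fun x => f x * g x).

Lemma flatfun_derive f : flatfun f -> exists2 g, flatfun g & forall x, is_derive x (1 : R) f (g x).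
Proof.
elim=> {f} [c k a b c0|f g _ [f' nf df] _ [g' ng dg]|r f _ [f' nf df]|f g nf0 [f' nf df] ng0 [g' ng dg]].
- exists (fun x => a * (c * flatexp c k.+2 (a * x + b) + - k%:R * flatexp c k.+1 (a * x + b))).
    apply: flatfun_scale; apply: flatfun_add; apply: flatfun_scale; exact: flatfun_exp.
  move=> x.
  have dl : is_derive x (1 : R) (fun x => a * x + b) a.
    by apply: is_derive_eq; rewrite /GRing.scale/= mulr1 addr0.
  have := @is_derive1_comp _ (flatexp c k) (fun x => a * x + b) x _ _ (is_derive_flatexp k (a * x + b) c0) dl.
  by rewrite mulrC mulNr.
- by exists (fun x => f' x + g' x) => [|x]; [exact: flatfun_add|apply: is_deriveD].
- exists (fun x => r * f' x) => [|x]; first exact: flatfun_scale.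
  by apply: (@is_deriveZ _ _ _ f).
- exists (fun x => f x * g' x + g x * f' x) => [|x].
    by apply: flatfun_add; exact: flatfun_mul.
  exact: (@is_deriveM _ _ f g).
Qed.

Lemma flatfun_continuous f : flatfun f -> continuous f.
Proof. by move=> /flatfun_derive[g _ df] x; exact: is_derive1_continuous (df x). Qed.

End one_variable_bumps.

Section products.
Context (R : realType) (n : nat).

Definition prodf (psi : 'I_n -> R -> R) (x : 'rV[R]_n) : R := \prod_i psi i (x ord0 i).

Lemma prodf_continuous psi : (forall i, flatfun (psi i)) -> continuous (prodf psi).
Proof.
move=> npsi; rewrite /prodf.
elim: (index_enum 'I_n) => [|i s IH].
  rewrite (_ : (fun _ => _) = cst 1); first exact: cst_continuous.
  by apply/funext => x; rewrite big_nil.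
under eq_fun do rewrite big_cons.
apply: continuous_mul => // x.
apply: (@continuous_comp _ _ _ (fun x : 'rV[R]_n => x ord0 i) (psi i)).
  exact: coord_continuous_rowvec.
exact: flatfun_continuous.
Qed.

Lemma prodf_pderiv psi j g : (forall x, is_derive x (1 : R) (psi j) (g x)) ->
  forall x, is_derive x (delta_mx ord0 j) (prodf psi) (prodf (fun i => if i == j then g else psi i) x).
Proof.
move=> dg x; set v := delta_mx _ _; pose P := \prod_(i | i != j) psi i (x ord0 i).
have key : (fun h : R => h^-1 *: ((prodf psi \o shift x) (h *: v) - prodf psi x)) @ 0^'
   --> prodf (fun i => if i == j then g else psi i) x.
  have -> : prodf (fun i => if i == j then g else psi i) x = P * g (x ord0 j).
    rewrite /prodf (bigD1 j)//= eqxx mulrC; congr (_ * _).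
    by apply: eq_bigr => i /negbTE ->.
  have -> : (fun h : R => h^-1 *: ((prodf psi \o shift x) (h *: v) - prodf psi x)) =
     (fun h => P * (h^-1 * (psi j (h + x ord0 j) - psi j (x ord0 j)))).
    apply/funext => h; rewrite /= /prodf (bigD1 j)//= [in X in _ - X](bigD1 j)//= -/P.
    rewrite (eq_bigr (fun i => psi i (x ord0 i))) -/P; last first.
      by move=> i /negbTE ij; rewrite !mxE ij mulr0 add0r.
    by rewrite !mxE !eqxx mulr1 /GRing.scale/=; ring.
  by apply: cvgMr; exact/is_derive1P.
by apply: DeriveDef; [apply/cvg_ex; eexists; exact: key|exact: cvg_lim key].
Qed.

(** A partial derivative of a product of functions of one variable each replaces
    one of the factors by its derivative. *)
Lemma prodf_smooth psi : (forall i, flatfun (psi i)) -> smooth (prodf psi).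
Proof.
move=> npsi s.
have [psi' npsi' ->] : exists2 psi', (forall i, flatfun (psi' i)) & pderivs s (prodf psi) = prodf psi'.
  elim: s => [|j s [psi' npsi' /= ->]]; first by exists psi.
  have [g ng dg] := flatfun_derive (npsi' j).
  exists (fun i => if i == j then g else psi' i) => [i|]; first by case: ifP.
  by apply/funext => x; case: (prodf_pderiv dg x).
split; first exact: prodf_continuous.
by move=> i x; have [g ng dg] := flatfun_derive (npsi' i); case: (prodf_pderiv dg x).
Qed.

End products.

Section fundamental_lemma.
Context (R : realType) (n : nat) (Omega : set 'rV[R]_n).
Local Notation mu := (lebesgue_rowvec R n).
Implicit Types (a b : 'rV[R]_n).

(** Smooth functions that increase to the indicator of the open box as m grows. *)
Definition box_bump a b (m : nat) : 'rV[R]_n -> R :=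
  prodf (fun i s => flatexp m.+1%:R^-1 0 (1 * s + - a ord0 i) *
                    flatexp m.+1%:R^-1 0 (-1 * s + b ord0 i)).

Lemma box_bumpE a b m x : box_bump a b m x =
  \prod_i (flatexp m.+1%:R^-1 0 (x ord0 i - a ord0 i) * flatexp m.+1%:R^-1 0 (b ord0 i - x ord0 i)).
Proof.
apply: eq_bigr => i _; rewrite mul1r mulN1r; congr (_ * flatexp _ _ _).
by rewrite addrC.
Qed.

Lemma box_bump_off a b m x : ~ obox a b x -> box_bump a b m x = 0.
Proof.
rewrite box_bumpE => nx.
have [i /negP hi] : exists i, ~ (a ord0 i < x ord0 i < b ord0 i) by exact/existsNP.
rewrite (bigD1 i)//= (_ : _ * _ = 0) ?mul0r// /flatexp !subr_gt0.
by move: hi; rewrite negb_and => /orP[/negbTE ->|/negbTE ->]; rewrite ?mulr0 !mul0r.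
Qed.

Lemma box_bump_itv a b m x : 0 <= box_bump a b m x <= 1.
Proof.
have c0 : 0 < m.+1%:R^-1 :> R by rewrite invr_gt0.
rewrite box_bumpE; apply/andP; split.
  by apply: prodr_ge0 => i _; rewrite mulr_ge0// flatexp_ge0.
have h i : 0 <= flatexp m.+1%:R^-1 0 (x ord0 i - a ord0 i) * flatexp m.+1%:R^-1 0 (b ord0 i - x ord0 i) <= 1.
  by rewrite mulr_ge0 ?flatexp_ge0// mulr_ile1 ?flatexp_ge0 ?flatexp_le1.
by apply: prodr_ile1 => i _; rewrite h.
Qed.

Lemma flatexp_cvg1 (x : R) : 0 < x -> flatexp m.+1%:R^-1 0 x @[m --> \oo] --> (1 : R).
Proof.
move=> x0.
have -> : (fun m => flatexp m.+1%:R^-1 0 x) = (fun m => expR (- (harmonic m / x))).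
  by apply/funext => m; rewrite /flatexp x0 expr0 invr1 mul1r.
rewrite -(@expR0 R); apply: (@cvg_comp _ _ _ (fun m => - (harmonic m / x)) expR); last exact: continuous_expR.
rewrite -oppr0 -(mul0r x^-1); apply: cvgN; apply: cvgMl; exact: cvg_harmonic.
Qed.

Lemma prod_cvg (I : Type) (s : seq I) (f : nat -> I -> R) (l : I -> R) :
  (forall i, f m i @[m --> \oo] --> l i) ->
  \prod_(i <- s) f m i @[m --> \oo] --> \prod_(i <- s) l i.
Proof.
move=> fl; elim: s => [|i s IH].
  rewrite big_nil (_ : (fun _ => _) = cst 1); first exact: cvg_cst.
  by apply/funext => m; rewrite big_nil.
under eq_fun do rewrite big_cons.
by rewrite big_cons; exact: cvgM.
Qed.

Lemma box_bump_cvg a b x : obox a b x -> box_bump a b m x @[m --> \oo] --> (1 : R).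
Proof.
move=> xb.
suff : (fun m => box_bump a b m x) @ \oo --> \prod_(i < n) (1 : R) by rewrite big1.
have -> : (fun m => box_bump a b m x) = (fun m => \prod_i
    (flatexp m.+1%:R^-1 0 (x ord0 i - a ord0 i) * flatexp m.+1%:R^-1 0 (b ord0 i - x ord0 i))).
  by apply/funext => m; rewrite box_bumpE.
apply: (@prod_cvg _ _ (fun m i => flatexp m.+1%:R^-1 0 (x ord0 i - a ord0 i) * flatexp m.+1%:R^-1 0 (b ord0 i - x ord0 i)) (fun=> 1)).
move=> i; have /andP[h1 h2] := xb i.
have e1 := @flatexp_cvg1 (x ord0 i - a ord0 i); have e2 := @flatexp_cvg1 (b ord0 i - x ord0 i).
rewrite !subr_gt0 in e1 e2.
by have h := cvgM (e1 h1) (e2 h2); rewrite mulr1 in h; exact: h.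
Qed.

Lemma closed_cbox a b : closed (cbox a b).
Proof.
have -> : cbox a b = \bigcap_(i in [set: 'I_n]) ((fun x : 'rV[R]_n => x ord0 i) @^-1` `[a ord0 i, b ord0 i]%classic).
  by apply/seteqP; split => y h i => [_|]; [rewrite /= in_itv/=; exact: h|have := h i Logic.I; rewrite /= in_itv].
apply: closed_bigI => i _; apply: preimage_closed; [by move=> x _; exact: coord_continuous_rowvec|exact: interval_closed].
Qed.

Lemma compact_cbox a b : compact (cbox a b).
Proof.
apply: (@subclosed_compact _ _ (cube n (\sum_i (`|a ord0 i| + `|b ord0 i|)))).
- exact: closed_cbox.
- exact: compact_cube.
move=> x xb i; have /andP[h1 h2] := xb i.
rewrite (bigD1 i)//=; set S := \sum_(_ | _) _.
have S0 : 0 <= S by apply: sumr_ge0 => j _; rewrite addr_ge0.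
have := ler_norm (b ord0 i); have := ler_norm (- a ord0 i); rewrite normrN.
have := normr_ge0 (a ord0 i); have := normr_ge0 (b ord0 i).
by rewrite ler_norml; move=> *; apply/andP; split; lra.
Qed.

Lemma obox_sub_cbox a b : obox a b `<=` cbox a b.
Proof. by move=> x h i; have /andP[h1 h2] := h i; rewrite !ltW. Qed.

Lemma box_bump_test a b m : cbox a b `<=` Omega -> test_function Omega (box_bump a b m).
Proof.
move=> abO; split.
  apply: prodf_smooth => i; have c0 : 0 < m.+1%:R^-1 :> R by rewrite invr_gt0.
  by apply: flatfun_mul; exact: flatfun_exp.
exists (cbox a b); split => //; first exact: compact_cbox.
by move=> x nx; apply: box_bump_off => /obox_sub_cbox.
Qed.

Variable v : 'rV[R]_n -> R.
Hypothesis lv : loc_integrable Omega v.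
Hypothesis v0 : forall theta, test_function Omega theta ->
  \int[mu]_(x in Omega) (v x * theta x) = 0.
Hypothesis oO : open Omega.

Lemma obox_integrable a b : cbox a b `<=` Omega -> mu.-integrable (obox a b) (EFin \o v).
Proof.
move=> abO; apply: (integrableS (compact_measurable_rowvec (@compact_cbox a b))).
- exact: measurable_obox.
- exact: obox_sub_cbox.
by have [_] := lv; apply => //; exact: compact_cbox.
Qed.

(** Dominated convergence for the test functions [box_bump a b m]. *)
Lemma obox_integral0 a b : cbox a b `<=` Omega ->
  (\int[mu]_(x in obox a b) (v x)%:E = 0)%E.
Proof.
move=> abO; have iv := obox_integrable abO; have mD := measurable_obox a b.
have mv : measurable_fun (obox a b) v by apply/measurable_EFinP; exact: measurable_int iv.
have mb m : measurable_fun (obox a b) (box_bump a b m).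
  by apply: measurable_funTS; apply: continuous_measurable_rowvec; have [c _ _ _] := test_cC1 (box_bump_test m abO).
have Ob : obox a b `<=` Omega by exact: subset_trans (@obox_sub_cbox a b) abO.
have mvb m : measurable_fun (obox a b) (fun x => (v x * box_bump a b m x)%:E).
  by apply/measurable_EFinP; exact: measurable_funM.
have mabs : measurable_fun (obox a b) (fun x => `|v x|%:E).
  by apply/measurable_EFinP; exact: measurableT_comp.
have iabs : mu.-integrable (obox a b) (fun x => `|v x|%:E).
  by apply: eq_integrable (integrable_abse iv) => //.
have dom m x : obox a b x -> (`|(v x * box_bump a b m x)%:E| <= `|v x|%:E)%E.
  move=> _; rewrite abse_EFin lee_fin normrM ler_piMr//.
  by have /andP[h0 h1] := box_bump_itv a b m x; rewrite ger0_norm.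
have Im m : (\int[mu]_(x in obox a b) (v x * box_bump a b m x)%:E = 0)%E.
  have im : mu.-integrable (obox a b) (fun x => (v x * box_bump a b m x)%:E).
    apply: le_integrable iabs => // x Dx.
    by rewrite [leRHS]gee0_abs ?lee_fin//; exact: dom.
  rewrite -[LHS]fineK; last exact: integrable_fin_num.
  congr EFin; rewrite -[RHS](v0 (box_bump_test m abO)) /Rintegral; congr fine.
  rewrite [LHS]integral_mkcond [RHS]integral_mkcond; apply: eq_integral => x _.
  rewrite !patchE; case: ifPn => [xD|]; first by rewrite mem_set//; apply: Ob; rewrite inE in xD.
  rewrite notin_setE => /box_bump_off xb; case: ifPn => // _; by rewrite xb mulr0.
have [_ _ h] : [/\ mu.-integrable (obox a b) (EFin \o v),
    ([sequence \int[mu]_(x in obox a b) `|(v x * box_bump a b m x)%:E - (EFin \o v) x|]_m @ \oo --> 0)%E &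
    ([sequence \int[mu]_(x in obox a b) (v x * box_bump a b m x)%:E]_m @ \oo -->
     \int[mu]_(x in obox a b) (EFin \o v) x)%E].
  apply: (@dominated_convergence _ _ _ mu _ mD _ _ (fun x => `|v x|%:E)) => //.
  - exact/measurable_EFinP.
  - apply: aeW => x Dx; apply: cvg_EFin; first by apply: nearW.
    rewrite -[X in _ --> X]mulr1; apply: cvgMr; exact: box_bump_cvg.
  - by apply: aeW => x m; exact: dom.
have h0 : ([sequence \int[mu]_(x in obox a b) (v x * box_bump a b m x)%:E]_m @ \oo --> 0)%E.
  rewrite (_ : [sequence _]_m = cst 0%E); first exact: cvg_cst.
  by apply/funext => m /=; rewrite Im.
exact: cvg_unique h h0.
Qed.

Lemma obox_setI a b a' b' : obox a b `&` obox a' b' =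
  obox (\row_i Num.max (a ord0 i) (a' ord0 i)) (\row_i Num.min (b ord0 i) (b' ord0 i)).
Proof.
apply/seteqP; split => x; last first.
  by move=> h; split => i; have := h i; rewrite !mxE gt_max lt_min => /andP[/andP[h1 h2] /andP[h3 h4]]; apply/andP.
by move=> [h h'] i; rewrite !mxE gt_max lt_min; have /andP[-> ->] := h i; have /andP[-> ->] := h' i.
Qed.

Lemma measurable_obox_generated : @measurable _ 'rV[R]_n = <<s range (fun p => obox p.1 p.2) >>.
Proof.
set G := range _; apply/seteqP; split; last first.
  apply: smallest_sub; first exact: sigma_algebra_measurable.
  by move=> _ [[a b] _ <-]; exact: measurable_obox.
apply: smallest_sub; first exact: smallest_sigma_algebra.
rewrite -bigcup_seq; apply: bigcup_sub => i _ B [C mC <-]; rewrite setTI.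
suff : <<s @RGenOInfty.G R >> `<=` [set C : set R | <<s G >> (@rowvec_coord R n i @^-1` C)].
  by apply; have := RGenOInfty.measurableE R => E; move: mC; rewrite [X in X C](E : measurable = _).
apply: smallest_sub.
  split => /=; first by rewrite preimage_set0; exact: sigma_algebra0.
  - by move=> D sD; rewrite setTD preimage_setC; exact: sigma_algebraC.
  - by move=> F sF; rewrite preimage_bigcup; exact: sigma_algebra_bigcup.
move=> _ [x ->] /=.
rewrite (_ : _ @^-1` _ = \bigcup_m obox (\row_j if j == i then x else - m%:R) (\row_j m%:R)).
  by apply: sigma_algebra_bigcup => m; apply: sub_sigma_algebra; eexists (_, _).
apply/seteqP; split => y.
  rewrite /= in_itv/= andbT => xy.
  exists (Num.truncn (\sum_j `|y ord0 j|)).+1 => // j; rewrite !mxE.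
  have : `|y ord0 j| < (Num.truncn (\sum_j `|y ord0 j|)).+1%:R.
    apply: le_lt_trans (truncnS_gt _); rewrite (bigD1 j)//= lerDl.
    by apply: sumr_ge0.
  rewrite ltr_norml => /andP[h1 ->]; rewrite andbT; case: eqVneq => [->|//].
  exact: xy.
by move=> [m _ /(_ i)]; rewrite !mxE eqxx => /andP[h _]; rewrite /= in_itv/= andbT.
Qed.

(** The integral of v vanishes on the boxes contained in the given one, hence by
    Dynkin's theorem on all its measurable subsets. *)
Lemma obox_ae0 a b : cbox a b `<=` Omega -> ae_eq mu (obox a b) (EFin \o v) (cst 0%E).
Proof.
move=> abO; have mD := measurable_obox a b; have iv := obox_integrable abO.
have mv := measurable_int _ iv.
have key A : measurable A -> (\int[mu]_(x in obox a b `&` A) (v x)%:E = 0)%E.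
  move=> mA; have : <<s range (fun p : 'rV[R]_n * 'rV[R]_n => obox p.1 p.2) >> A.
    by rewrite -measurable_obox_generated.
  apply: (@dynkin_induction _ _ _ (fun A => \int[mu]_(x in obox a b `&` A) (v x)%:E = 0)%E measurable_obox_generated).
  - by move=> _ _ [p _ <-] [q _ <-]; rewrite obox_setI; eexists (_, _).
  - by rewrite setIT; exact: obox_integral0.
  - move=> _ [[a' b'] _ <-]; rewrite obox_setI; set lo := \row_i _; set hi := \row_i _.
    have [lohi|/existsNP[i /negP]] := pselect (forall i, lo ord0 i <= hi ord0 i); last first.
      rewrite -ltNge => hl; rewrite (_ : obox lo hi = set0) ?integral_set0//.
      by apply/seteqP; split => // x /(_ i)/andP[h1 h2]; have := lt_trans (lt_trans h1 h2) hl; rewrite ltxx.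
    have [[x xlh]|ne] := pselect (exists x, obox lo hi x); last first.
      rewrite (_ : obox lo hi = set0) ?integral_set0//.
      by apply/seteqP; split => // x xx; apply: ne; exists x.
    apply: obox_integral0; apply: subset_trans abO => y yl i.
    have /andP[h1 h2] := yl i; move: h1 h2; rewrite !mxE ge_max le_min.
    by move=> /andP[-> _] /andP[-> _].
  - move=> S mS IS.
    have : (\int[mu]_(x in obox a b) (v x)%:E = 0)%E by exact: obox_integral0.
    have UE : obox a b = (obox a b `&` S) `|` (obox a b `&` ~` S) by rewrite -setIUr setUCr setIT.
    rewrite [in X in X -> _]UE integral_setU ?IS ?add0e//.
    + exact: measurableI.
    + by apply: measurableI => //; exact: measurableC.
    + by rewrite -UE.
    + by apply/disj_setPS => x [[_ xS] [_]].
  - move=> F mF tF IF; rewrite setI_bigcupr integral_bigcup.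
    + by apply: eseries0 => i _ _; exact: IF.
    + by apply: trivIset_setIl.
    + by move=> k; exact: measurableI.
    + rewrite -setI_bigcupr; apply: integrableS iv => //.
      by apply: measurableI => //; exact: bigcupT_measurable.
apply: integral_ae_eq => //.
move=> A AD mA; rewrite integral_cst// mul0e.
by rewrite -[A](setIidr AD); exact: key.
Qed.

(** The du Bois-Reymond lemma: Omega is a countable union of boxes, on each of
    which v vanishes almost everywhere. *)
Lemma test_integral0_ae : ae_eq mu Omega v (cst 0).
Proof.
have [B [OB hB]] := open_bigcup_box oO.
have : mu.-negligible (\bigcup_k (B k `&` [set x | v x <> 0])).
  apply: negligible_bigcup => k; have [->|[a [b [-> abO]]]] := hB k.
    by rewrite set0I; exact: negligible_set0.
  apply: negligibleS (obox_ae0 abO) => x [xab vx] /=.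
  by move=> /(_ xab)[].
apply: negligibleS => x /= /not_implyP[Ox vx].
by move: Ox; rewrite {1}OB => -[k _ Bk]; exists k.
Qed.

End fundamental_lemma.

(** * Square integrable functions *)

Section square_integrable.
Context d (T : measurableType d) (R : realType) (mu : {measure set T -> \bar R}) (D : set T).
Hypothesis mD : measurable D.
Implicit Types (u v w : T -> R).

Definition sqint u := measurable_fun D u /\ mu.-integrable D (EFin \o (fun x => u x ^+ 2)).

Definition ip u v : R := \int[mu]_(x in D) (u x * v x).

Definition nm u : R := Num.sqrt (ip u u).

Lemma sqint_measurable u : sqint u -> measurable_fun D u. Proof. by case. Qed.

Lemma sqint_mul u v : sqint u -> sqint v ->
  mu.-integrable D (EFin \o (fun x => u x * v x)).
Proof.
move=> [m1 i1] [m2 i2]; have i := integrableD mD i1 i2.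
apply: (le_integrable mD _ _ i).
  by apply/measurable_EFinP; exact: measurable_funM.
move=> x Dx; rewrite /= lee_fin [leRHS]ger0_norm ?addr_ge0 ?sqr_ge0//.
rewrite ler_norml; have := sqr_ge0 (u x + v x); have := sqr_ge0 (u x - v x).
by have := sqr_ge0 (u x); have := sqr_ge0 (v x); rewrite !expr2 => *; apply/andP; split; nra.
Qed.

Lemma sqint_lin a b u v : sqint u -> sqint v -> sqint (fun x => a * u x + b * v x).
Proof.
move=> su sv; have [m1 i1] := su; have [m2 i2] := sv; split.
  by apply: measurable_funD; exact: measurable_funM.
have i := integrableD mD (integrableD mD (integrableZl mD (a ^+ 2) i1) (integrableZl mD (b ^+ 2) i2))
  (integrableZl mD (2 * a * b) (sqint_mul su sv)).
apply: eq_integrable i => // x _; rewrite /= -!EFinM -!EFinD; congr EFin; ring.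
Qed.

Lemma sqint_scale a u : sqint u -> sqint (fun x => a * u x).
Proof.
move=> su; rewrite (_ : (fun _ => _) = fun x => a * u x + 0 * u x); first exact: sqint_lin.
by apply/funext => x; rewrite mul0r addr0.
Qed.

Lemma sqint_add u v : sqint u -> sqint v -> sqint (fun x => u x + v x).
Proof.
move=> su sv; rewrite (_ : (fun _ => _) = fun x => 1 * u x + 1 * v x); first exact: sqint_lin.
by apply/funext => x; rewrite !mul1r.
Qed.

Lemma sqint_sub u v : sqint u -> sqint v -> sqint (fun x => u x - v x).
Proof.
move=> su sv; rewrite (_ : (fun _ => _) = fun x => 1 * u x + -1 * v x); first exact: sqint_lin.
by apply/funext => x; rewrite mul1r mulN1r.
Qed.

Lemma sqint0 : sqint (fun=> 0).
Proof.
split; first exact: measurable_cst.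
by under eq_fun do rewrite expr0n /=; exact: integrable0.
Qed.

Lemma sqint_sum (I : Type) (s : seq I) (a : I -> R) (u : I -> T -> R) :
  (forall i, sqint (u i)) -> sqint (fun x => \sum_(i <- s) a i * u i x).
Proof.
move=> su; elim: s => [|i s IH].
  by under eq_fun do rewrite big_nil; exact: sqint0.
by under eq_fun do rewrite big_cons; apply: sqint_add => //; exact: sqint_scale.
Qed.

Lemma ipC u v : ip u v = ip v u.
Proof. by apply: eq_Rintegral => x _; rewrite mulrC. Qed.

Lemma ip_lin a b u v w : sqint u -> sqint v -> sqint w ->
  ip (fun x => a * u x + b * v x) w = a * ip u w + b * ip v w.
Proof.
move=> su sv sw; rewrite /ip -!RintegralZl//; try exact: sqint_mul.
rewrite -RintegralD//.
- by apply: eq_Rintegral => x _; ring.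
- exact: integrableZl (sqint_mul su sw).
- exact: integrableZl (sqint_mul sv sw).
Qed.

Lemma ipZl a u w : sqint u -> sqint w -> ip (fun x => a * u x) w = a * ip u w.
Proof.
move=> su sw; rewrite (_ : (fun _ => _) = fun x => a * u x + 0 * u x).
  by rewrite ip_lin// mul0r addr0.
by apply/funext => x; rewrite mul0r addr0.
Qed.

Lemma ipDl u v w : sqint u -> sqint v -> sqint w ->
  ip (fun x => u x + v x) w = ip u w + ip v w.
Proof.
move=> su sv sw; rewrite (_ : (fun _ => _) = fun x => 1 * u x + 1 * v x).
  by rewrite ip_lin// !mul1r.
by apply/funext => x; rewrite !mul1r.
Qed.

Lemma ipBl u v w : sqint u -> sqint v -> sqint w ->
  ip (fun x => u x - v x) w = ip u w - ip v w.
Proof.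
move=> su sv sw; rewrite (_ : (fun _ => _) = fun x => 1 * u x + -1 * v x).
  by rewrite ip_lin// mul1r mulN1r.
by apply/funext => x; rewrite mul1r mulN1r.
Qed.

Lemma ip0l w : ip (fun=> 0) w = 0.
Proof.
rewrite /ip; under eq_Rintegral do rewrite mul0r.
by rewrite Rintegral_cst// mul0r.
Qed.

Lemma ip_sum (I : Type) (s : seq I) (a : I -> R) (u : I -> T -> R) w :
  (forall i, sqint (u i)) -> sqint w ->
  ip (fun x => \sum_(i <- s) a i * u i x) w = \sum_(i <- s) a i * ip (u i) w.
Proof.
move=> su sw; elim: s => [|i s IH].
  by rewrite big_nil; under eq_fun do rewrite big_nil; exact: ip0l.
rewrite big_cons -IH -ipZl// -ipDl//; try exact: sqint_scale; try exact: sqint_sum.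
by under eq_fun do rewrite big_cons.
Qed.

Lemma ip_ge0 u : 0 <= ip u u.
Proof. by apply: Rintegral_ge0 => x _; rewrite -expr2 sqr_ge0. Qed.

Lemma sqr_nm u : nm u ^+ 2 = ip u u.
Proof. by rewrite sqr_sqrtr// ip_ge0. Qed.

Lemma nm_ge0 u : 0 <= nm u. Proof. exact: sqrtr_ge0. Qed.

Lemma ip_sqr_lin a b u v : sqint u -> sqint v ->
  ip (fun x => a * u x + b * v x) (fun x => a * u x + b * v x) =
  a ^+ 2 * ip u u + 2 * a * b * ip u v + b ^+ 2 * ip v v.
Proof.
move=> su sv; rewrite ip_lin//; last exact: sqint_lin.
set w := fun x => a * u x + b * v x.
rewrite (ipC u w) (ipC v w) /w !ip_lin// (ipC v u); ring.
Qed.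

Lemma ip_sqr_le u v : sqint u -> sqint v -> ip u v ^+ 2 <= ip u u * ip v v.
Proof.
move=> su sv; apply: quadratic_disc; first exact: ip_ge0.
move=> r; have := ip_ge0 (fun x => r * u x + 1 * v x); rewrite ip_sqr_lin//.
by congr (0 <= _); ring.
Qed.

Lemma ip_le u v : sqint u -> sqint v -> `|ip u v| <= nm u * nm v.
Proof.
move=> su sv; rewrite -sqrtrM ?ip_ge0// -sqrtr_sqr ler_sqrt ?mulr_ge0 ?ip_ge0//.
exact: ip_sqr_le.
Qed.

Lemma nmD u v : sqint u -> sqint v -> nm (fun x => u x + v x) <= nm u + nm v.
Proof.
move=> su sv; rewrite -(@ler_pXn2r _ 2) ?nnegrE ?addr_ge0 ?nm_ge0//.
rewrite sqr_nm (_ : (fun _ => _) = fun x => 1 * u x + 1 * v x); last first.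
  by apply/funext => x; rewrite !mul1r.
rewrite ip_sqr_lin// sqrrD !sqr_nm.
have := le_trans (ler_norm _) (ip_le su sv); rewrite -mulr_natl; lra.
Qed.

Lemma nmZ a u : sqint u -> nm (fun x => a * u x) = `|a| * nm u.
Proof.
move=> su; rewrite /nm ipZl//; last exact: sqint_scale.
by rewrite ipC ipZl// mulrA -expr2 sqrtrM ?sqr_ge0// sqrtr_sqr.
Qed.

Lemma nmB u v : sqint u -> sqint v -> nm (fun x => u x - v x) <= nm u + nm v.
Proof.
move=> su sv; rewrite -(mul1r (nm v)) -(normrN1 R) -nmZ//.
have := nmD su (sqint_scale (-1) sv); congr (nm _ <= _).
by apply/funext => x; rewrite mulN1r.
Qed.

Lemma sqint_ae u v : measurable_fun D v -> ae_eq mu D u v -> sqint u -> sqint v.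
Proof.
move=> mv uv [m_ i]; split => //; move/integrableP: i => [_ i].
have m2 : measurable_fun D (EFin \o (fun x => v x ^+ 2)).
  by apply/measurable_EFinP; exact: measurable_funX.
apply/integrableP; split => //; apply: le_lt_trans i; rewrite le_eqVlt; apply/orP; left; apply/eqP.
apply: ae_eq_integral => //.
- exact: measurableT_comp.
- by apply: measurableT_comp => //; apply/measurable_EFinP; exact: measurable_funX.
by apply: filterS uv => x h Dx /=; rewrite h.
Qed.

Lemma Rintegral_ae u v : measurable_fun D u -> measurable_fun D v ->
  ae_eq mu D u v -> \int[mu]_(x in D) u x = \int[mu]_(x in D) v x.
Proof.
move=> m1 m2 uv; congr fine; apply: ae_eq_integral => //.
- exact/measurable_EFinP.
- exact/measurable_EFinP.
by apply: filterS uv => x h Dx /=; rewrite h.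
Qed.

Lemma ip_ae u u' v v' : measurable_fun D u -> measurable_fun D u' ->
  measurable_fun D v -> measurable_fun D v' ->
  ae_eq mu D u u' -> ae_eq mu D v v' -> ip u v = ip u' v'.
Proof.
move=> mu1 mu2 mv1 mv2 uu vv; apply: Rintegral_ae.
- exact: measurable_funM.
- exact: measurable_funM.
by apply: filterS2 uu vv => x h1 h2 Dx; rewrite h1// h2.
Qed.

Lemma nm_ae u v : measurable_fun D u -> measurable_fun D v -> ae_eq mu D u v -> nm u = nm v.
Proof. by move=> m1 m2 uv; congr Num.sqrt; exact: ip_ae. Qed.

Lemma ip_eq0 u : sqint u -> ip u u = 0 -> ae_eq mu D u (cst 0).
Proof.
move=> su; have [m_ i] := su; rewrite /ip /Rintegral => u0.
have : (\int[mu]_(x in D) `|(u x * u x)%:E| = 0)%E.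
  under eq_integral => x _ do rewrite gee0_abs ?lee_fin -?expr2 ?sqr_ge0//.
  have := integrable_fin_num mD i.
  move=> /fineK <-; congr EFin; rewrite -[RHS]u0; congr fine.
move=> /ae_eq_integral_abs h; have := h mD.
move=> {}h; have : ae_eq mu D (fun x => (u x * u x)%:E) (cst 0%E).
  by apply/h => //; apply/measurable_EFinP; exact: measurable_funM.
apply: filterS => x h' Dx; have /eqP := h' Dx.
by rewrite /= eqe mulf_eq0 orbb => /eqP.
Qed.

Lemma sqint_bounded u c : (mu D < +oo)%E -> measurable_fun D u ->
  (forall x, D x -> `|u x| <= c) -> sqint u.
Proof.
move=> Doo m_ uc; split => //; apply: measurable_bounded_integrable => //.
  exact: measurable_funX.
exists (c ^+ 2); split; first exact: num_real.
move=> B cB x Dx /=; rewrite normrX; apply: le_trans (ltW cB).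
by rewrite lerXn2r ?nnegrE ?(le_trans (normr_ge0 (u x)))//; exact: uc.
Qed.

Lemma sqint_integrable u : (mu D < +oo)%E -> sqint u -> mu.-integrable D (EFin \o u).
Proof.
move=> Doo su.
have s1 : sqint (fun=> 1) by apply: (@sqint_bounded _ 1) => //= *; rewrite normr1.
by have := sqint_mul su s1; apply: eq_integrable => // x _; rewrite /= mulr1.
Qed.

Lemma sqint_le u v : measurable_fun D u -> (forall x, D x -> `|u x| <= `|v x|) -> sqint v -> sqint u.
Proof.
move=> m_ uv [mv i]; split => //; apply: (le_integrable mD _ _ i).
  by apply/measurable_EFinP; exact: measurable_funX.
move=> x Dx; rewrite /= lee_fin !normrX lerXn2r ?nnegrE//; exact: uv.
Qed.

(** Hoelder's inequality against the constant 1. *)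
Lemma power_mean (h : T -> R) (p r : R) : 0 < p -> p < r -> measurable_fun D h -> (forall x, D x -> 0 <= h x) ->
  (\int[mu]_(x in D) (h x `^ p)%:E <=
   (\int[mu]_(x in D) (h x `^ r)%:E) `^ (p / r) * mu D `^ (1 - p / r))%E.
Proof.
move=> p0 pr mh h0; have r0 := lt_trans p0 pr.
have th : 0 < p / r < 1 by rewrite divr_gt0//= ltr_pdivrMr// mul1r.
have mhr s : measurable_fun D (fun x => (h x `^ s)%:E).
  by apply/measurable_EFinP; exact: (measurableT_comp (measurable_powR _)).
have m1 : measurable_fun setT ((fun x => (h x `^ r)%:E) \_ D).
  exact/(measurable_restrictT _ mD).
have m2 : measurable_fun setT ((fun x => 1%:E : \bar R) \_ D).
  by apply/(measurable_restrictT _ mD); exact: measurable_cst.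
have n1 x : (0 <= ((fun x => (h x `^ r)%:E) \_ D) x)%E.
  by rewrite patchE; case: ifP => // _; rewrite lee_fin powR_ge0.
have n2 x : (0 <= ((fun x => 1%:E : \bar R) \_ D) x)%E.
  by rewrite patchE; case: ifP => // _; rewrite lee_fin.
have := @ge0_hoelder _ _ _ mu _ _ _ th m1 m2 n1 n2.
rewrite -!integral_mkcond integral_cst// mul1e => /(le_trans _); apply.
rewrite [leLHS]integral_mkcond le_eqVlt; apply/orP; left; apply/eqP; apply: eq_integral => x _.
rewrite !patchE; case: ifPn => [|_].
  rewrite inE => Dx; rewrite poweR_EFin poweR_EFin -EFinM powR1 mulr1; congr EFin.
  by rewrite -powRrM mulrCA mulfV ?gt_eqF// mulr1.
by rewrite poweR0r ?mul0e// gt_eqF//; case/andP: th.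
Qed.

End square_integrable.

(** * Weak derivatives and Sobolev spaces *)

Section weak_derivatives.
Context (R : realType) (n : nat) (Omega : set 'rV[R]_n).
Hypothesis oO : open Omega.
Local Notation mu := (lebesgue_rowvec R n).
Local Notation mO := (open_measurable_rowvec oO).
Implicit Types (u v : 'rV[R]_n -> R) (al : multi_index n).

Lemma test_pderivs s theta : test_function Omega theta ->
  continuous (pderivs s theta) /\
  exists K, [/\ compact K, K `<=` Omega & forall x, ~ K x -> pderivs s theta x = 0].
Proof.
move=> [sm [K [cK KO off]]]; split; first by have [] := sm s.
exists K; split => //; elim: s => [|i s IH] //= x nx.
apply: (@pderiv_off_closed _ _ i K) => //.
by apply: compact_closed => //; exact: rowvec_hausdorff.
Qed.

Lemma loc_integrable_mul v g K : loc_integrable Omega v -> continuous g -> compact K ->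
  K `<=` Omega -> (forall x, ~ K x -> g x = 0) ->
  mu.-integrable Omega (EFin \o (fun x => v x * g x)).
Proof.
move=> [mv iv] cg cK KO off; have mK := compact_measurable_rowvec cK.
have mg := continuous_measurable_rowvec cg.
have [C C0 hC] : exists2 C, 0 < C & forall x, K x -> `|g x| < C.
  have : compact (g @` K) by apply: continuous_compact => //; exact: continuous_subspaceT.
  by move=> /compact_bounded/ex_strict_bound_gt0[C C0 h]; exists C => // x xM; apply: h; exists x.
have iK : mu.-integrable K (EFin \o (fun x => v x * g x)).
  apply: (le_integrable mK _ _ (integrableZl mK C (iv _ cK KO))).
    apply/measurable_EFinP; apply: measurable_funM; last exact: measurable_funTS.
    exact: (measurable_funS mO KO mv).
  move=> x Kx; rewrite /= lee_fin !normrM mulrC ler_wpM2r// (gtr0_norm C0) ltW//.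
  exact: hC.
apply/(integrable_mkcond _ mO); move/(integrable_mkcond _ mK): iK.
apply: eq_integrable => // x _; rewrite !patchE.
case: ifPn => [xK|]; first by rewrite mem_set//; apply: KO; rewrite inE in xK.
by rewrite notin_setE => /off; case: ifPn => // _ /= ->; rewrite mulr0.
Qed.

Lemma loc_integrable_lin a b u v : loc_integrable Omega u -> loc_integrable Omega v ->
  loc_integrable Omega (fun x => a * u x + b * v x).
Proof.
move=> [mu1 iu] [mv iv]; split.
  by apply: measurable_funD; exact: measurable_funM.
move=> K cK KO; have mK := compact_measurable_rowvec cK.
have := integrableD mK (integrableZl mK a (iu _ cK KO)) (integrableZl mK b (iv _ cK KO)).
by apply: eq_integrable.
Qed.

Lemma Rintegral_lin a b (f g : 'rV[R]_n -> R) :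
  mu.-integrable Omega (EFin \o f) -> mu.-integrable Omega (EFin \o g) ->
  \int[mu]_(x in Omega) (a * f x + b * g x) =
  a * \int[mu]_(x in Omega) f x + b * \int[mu]_(x in Omega) g x.
Proof.
move=> i1 i2; have m := mO; rewrite -!RintegralZl// RintegralD//.
- exact: integrableZl i1.
- exact: integrableZl i2.
Qed.

Lemma is_wderiv_lin al a b u v u' v' :
  is_wderiv Omega al u u' -> is_wderiv Omega al v v' ->
  is_wderiv Omega al (fun x => a * u x + b * v x) (fun x => a * u' x + b * v' x).
Proof.
move=> [lu lu' hu] [lv lv' hv]; split; try exact: loc_integrable_lin.
move=> theta th.
have [c0 [K [cK KO off]]] := test_pderivs [::] th.
have [c1 [K1 [cK1 KO1 off1]]] := test_pderivs (flatten [seq nseq (al i) i | i <- enum 'I_n]) th.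
have i0 w : loc_integrable Omega w -> mu.-integrable Omega (EFin \o (fun x => w x * theta x)).
  by move=> lw; exact: (loc_integrable_mul lw c0 cK KO off).
have i1 w : loc_integrable Omega w -> mu.-integrable Omega (EFin \o (fun x => w x * mi_pderiv al theta x)).
  by move=> lw; exact: (loc_integrable_mul lw c1 cK1 KO1 off1).
transitivity (a * \int[mu]_(x in Omega) (u x * mi_pderiv al theta x) +
              b * \int[mu]_(x in Omega) (v x * mi_pderiv al theta x)).
  rewrite -Rintegral_lin; [|exact: i1|exact: i1].
  by apply: eq_Rintegral => x _; ring.
rewrite hu// hv//.
transitivity ((-1) ^+ mi_order al * (a * \int[mu]_(x in Omega) (u' x * theta x) +
              b * \int[mu]_(x in Omega) (v' x * theta x))); first by ring.
congr (_ * _); rewrite -Rintegral_lin; [|exact: i0|exact: i0].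
by apply: eq_Rintegral => x _; ring.
Qed.

(** The difference is orthogonal to all test functions. *)
Lemma is_wderiv_unique al u v v' :
  is_wderiv Omega al u v -> is_wderiv Omega al u v' -> ae_eq mu Omega v v'.
Proof.
move=> h h'; have := is_wderiv_lin 1 (-1) h h'; move: h h' => [_ lv _] [_ lv' _] [_ l hw].
have zero theta : test_function Omega theta ->
    \int[mu]_(x in Omega) ((1 * v x + -1 * v' x) * theta x) = 0.
  move=> th; have := hw theta th.
  under eq_Rintegral do rewrite mul1r mulN1r subrr mul0r.
  rewrite Rintegral_cst ?mul0r; last exact: mO.
  move=> /eqP; rewrite eq_sym mulf_eq0 => /orP[|/eqP//].
  by rewrite expf_eq0 oppr_eq0 oner_eq0 andbF.
have := test_integral0_ae l zero oO.
apply: filterS => x h Ox; have := h Ox; rewrite mul1r mulN1r /= => /eqP.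
by rewrite subr_eq0 => /eqP.
Qed.

Lemma wderivP al u v : is_wderiv Omega al u v -> is_wderiv Omega al u (wderiv Omega al u).
Proof. by move=> h; apply: xgetPex; exists v. Qed.

(** [wderiv] is an arbitrary representative, so that identities between weak
    derivatives hold almost everywhere only. *)
Lemma wderiv_ae al u v : is_wderiv Omega al u v -> ae_eq mu Omega (wderiv Omega al u) v.
Proof. by move=> h; exact: is_wderiv_unique (wderivP h) h. Qed.

End weak_derivatives.

Section Lq_norms.
Context (R : realType) (n : nat) (Omega : set 'rV[R]_n).
Hypothesis oO : open Omega.
Local Notation mu := (lebesgue_rowvec R n).
Local Notation mO := (open_measurable_rowvec oO).
Local Notation sqi := (sqint mu Omega).
Local Notation nrm := (nm mu Omega).
Implicit Types (u v : 'rV[R]_n -> R) (al : multi_index n).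

Lemma LqnormE (q : R) u : q != 0 ->
  Lqnorm Omega q%:E u = ((\int[mu]_(x in Omega) (`|u x| `^ q)%:E) `^ q^-1)%E.
Proof.
move=> q0; rewrite /Lqnorm unlock; congr (_ `^ _)%E; rewrite [RHS]integral_mkcond.
apply: eq_integral => x _; rewrite /= !patchE; case: ifPn => // _.
by rewrite (_ : (point : R) = 0)// normr0 powR0.
Qed.

Lemma Lqnorm2E u : Lqnorm Omega 2%:E u = ((\int[mu]_(x in Omega) (u x ^+ 2)%:E) `^ 2^-1)%E.
Proof.
rewrite LqnormE ?pnatr_eq0//; congr (_ `^ _)%E; apply: eq_integral => x _.
by rewrite powR_mulrn// real_normK ?num_real.
Qed.

Lemma Lqspace2P u : Lqspace Omega 2%:E u <-> sqi u.
Proof.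
rewrite /Lqspace Lqnorm2E /sqint; set I := (\int[mu]_(x in Omega) _)%E.
have I0 : (0 <= I)%E by apply: integral_ge0 => x _; rewrite lee_fin sqr_ge0.
have aux : (I `^ 2^-1 < +oo)%E = (I < +oo)%E.
  move: I I0 => [r||]// _; first by rewrite poweR_EFin !ltry.
  by rewrite poweRyr ?ltxx// invr_eq0 pnatr_eq0.
split => -[m_ h]; split => //.
  apply/integrableP; split; first by apply/measurable_EFinP; exact: measurable_funX.
  under eq_integral do rewrite abse_EFin ger0_norm ?sqr_ge0//.
  by rewrite -/I -aux.
move/integrableP: h => [_].
under eq_integral do rewrite /= ger0_norm ?sqr_ge0//.
by rewrite -/I aux.
Qed.

Lemma Lqnorm2_nm u : sqi u -> Lqnorm Omega 2%:E u = (nrm u)%:E.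
Proof.
move=> [m_ i]; rewrite Lqnorm2E -(fineK (integrable_fin_num mO i)) poweR_EFin; congr EFin.
rewrite /nm -powR12_sqrt ?ip_ge0//; congr (_ `^ _).
Qed.

Lemma inner_ip u v : inner Omega u v = ip mu Omega u v. Proof. by []. Qed.

Lemma sqint_loc_integrable u : sqi u -> loc_integrable Omega u.
Proof.
move=> su; split; first exact: sqint_measurable su.
move=> K cK KO; have mK := compact_measurable_rowvec cK.
apply: (sqint_integrable mK).
  by apply: bounded_lty => //; exact: compact_bounded.
have [m_ i] := su; split; first exact: (measurable_funS mO KO m_).
exact: (integrableS mO).
Qed.

Lemma test_sqint theta : test_function Omega theta -> sqi theta.
Proof.
move=> th; have c1 := test_cC1 th; have [ct _ _ _] := c1.
split; first by apply: measurable_funTS; exact: continuous_measurable_rowvec.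
apply/integrableP; split.
  apply/measurable_EFinP; apply: measurable_funX; apply: measurable_funTS.
  exact: continuous_measurable_rowvec.
apply: le_lt_trans (cC1_bounded c1).
under [leLHS]eq_integral do rewrite /= ger0_norm ?sqr_ge0//.
apply: ge0_subset_integral => //; first exact: mO.
- by apply/measurable_EFinP; apply: measurable_funX; exact: continuous_measurable_rowvec.
- by move=> x _; rewrite lee_fin sqr_ge0.
Qed.

Lemma test_pderiv_sqint theta i : test_function Omega theta -> sqi (pderiv i theta).
Proof.
move=> th; have [ct _ cd _] := test_cC1 th.
have [_ [K [cK KO off]]] := @test_pderivs _ _ Omega [:: i] _ th.
split; first by apply: measurable_funTS; exact: continuous_measurable_rowvec.
have cd2 := continuous_mul (cd i) (cd i).
have [M _ KM] := bounded_sub_cube (compact_bounded cK).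
have : mu.-integrable setT (EFin \o (fun x => pderiv i theta x * pderiv i theta x)).
  apply: (@compact_support_integrable _ _ _ M) => // x nx.
  by rewrite [pderiv i theta x](off x) ?mul0r// => /KM.
move=> /(integrableS measurableT mO) h; apply: eq_integrable (h _) => //; first exact: mO.
Qed.

End Lq_norms.

Section sobolev_spaces.
Context (R : realType) (n : nat) (Omega : set 'rV[R]_n).
Hypothesis oO : open Omega.
Local Notation mu := (lebesgue_rowvec R n).
Local Notation mO := (open_measurable_rowvec oO).
Local Notation sqi := (sqint mu Omega).
Local Notation nrm := (nm mu Omega).
Local Notation H1 := (sobolev Omega 1 2%:E).
Local Notation wd i := (wderiv Omega (mi_unit i)).
Implicit Types (u v : 'rV[R]_n -> R) (al : multi_index n).

Lemma sobolev_sqint m u : sobolev Omega m 2%:E u -> sqi u.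
Proof.
move=> hu; have [|v wv /Lqspace2P sv] := hu (fun=> 0%N); first by rewrite mi_order0.
have [lu _ _] := wv.
have uv := is_wderiv_unique oO wv (wderiv0_id lu).
by apply: (sqint_ae mO _ uv sv); case: lu.
Qed.

Lemma sobolev_wderiv m al u : sobolev Omega m 2%:E u -> (mi_order al <= m)%N ->
  is_wderiv Omega al u (wderiv Omega al u) /\ sqi (wderiv Omega al u).
Proof.
move=> hu /hu[v wv /Lqspace2P sv]; have w := wderivP wv; split => //.
apply: (sqint_ae mO _ _ sv); first by case: w => _ [].
exact: is_wderiv_unique wv w.
Qed.

Lemma sobolev_wd i u : H1 u -> is_wderiv Omega (mi_unit i) u (wd i u) /\ sqi (wd i u).
Proof. by move=> /sobolev_wderiv; apply; rewrite mi_order_unit. Qed.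

Lemma wderiv0_ae u : sqi u -> ae_eq mu Omega (wderiv Omega (fun=> 0%N) u) u.
Proof. by move=> /(sqint_loc_integrable oO)/wderiv0_id; exact: wderiv_ae. Qed.

Lemma sobolevI u : sqi u -> (forall i, exists2 v, is_wderiv Omega (mi_unit i) u v & sqi v) -> H1 u.
Proof.
move=> su h al /mi_order_le1[->|[i ->]].
  exists u; first by apply: wderiv0_id; exact: sqint_loc_integrable.
  exact/Lqspace2P.
by have [v wv sv] := h i; exists v => //; exact/Lqspace2P.
Qed.

Lemma sobolev_lin a b u v : H1 u -> H1 v -> H1 (fun x => a * u x + b * v x).
Proof.
move=> hu hv; apply: sobolevI; first exact: (sqint_lin mO a b (sobolev_sqint hu) (sobolev_sqint hv)).
move=> i; have [wu su] := sobolev_wd i hu; have [wv sv] := sobolev_wd i hv.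
exists (fun x => a * wd i u x + b * wd i v x); first exact: is_wderiv_lin.
exact: (sqint_lin mO).
Qed.

Lemma wd_lin i a b u v : H1 u -> H1 v ->
  ae_eq mu Omega (wd i (fun x => a * u x + b * v x)) (fun x => a * wd i u x + b * wd i v x).
Proof.
move=> hu hv; have [wu su] := sobolev_wd i hu; have [wv sv] := sobolev_wd i hv.
by apply: wderiv_ae => //; exact: is_wderiv_lin.
Qed.

Lemma test_sobolev theta : test_function Omega theta -> H1 theta.
Proof.
move=> th; apply: sobolevI; first exact: test_sqint.
move=> i; exists (pderiv i theta); first exact: test_wderiv1.
exact: test_pderiv_sqint.
Qed.

Lemma test_wd i theta : test_function Omega theta -> ae_eq mu Omega (wd i theta) (pderiv i theta).
Proof. by move=> th; apply: wderiv_ae => //; exact: test_wderiv1. Qed.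

Lemma test_lin a b theta eta : test_function Omega theta -> test_function Omega eta ->
  test_function Omega (fun x => a * theta x + b * eta x).
Proof.
move=> [s1 [K1 [cK1 KO1 off1]]] [s2 [K2 [cK2 KO2 off2]]].
have E s : pderivs s (fun x => a * theta x + b * eta x) =
    (fun x => a * pderivs s theta x + b * pderivs s eta x).
  elim: s => [|i s /= ->]//; apply/funext => x.
  rewrite /pderiv.
  have [_ d1] := s1 s; have [_ d2] := s2 s.
  rewrite (@deriveD _ _ _ (fun x => a * pderivs s theta x) (fun x => b * pderivs s eta x)).
  - by congr (_ + _); [exact: (@deriveZ _ _ _ (pderivs s theta))|exact: (@deriveZ _ _ _ (pderivs s eta))].
  - exact: (@derivableZ _ _ _ (pderivs s theta)).
  - exact: (@derivableZ _ _ _ (pderivs s eta)).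
split.
  move=> s; rewrite E; have [c1 d1] := s1 s; have [c2 d2] := s2 s; split.
    by apply: continuous_add; apply: continuous_mul => //; exact: cst_continuous.
  move=> i x; apply: (@derivableD _ _ _ (fun x => a * pderivs s theta x) (fun x => b * pderivs s eta x)).
  - exact: (@derivableZ _ _ _ (pderivs s theta)).
  - exact: (@derivableZ _ _ _ (pderivs s eta)).
exists (K1 `|` K2); split; first exact: compactU.
- by move=> x [/KO1|/KO2].
- move=> x /not_orP[n1 n2]; rewrite off1// off2//; ring.
Qed.

Definition h1norm u : R := Num.sqrt (\sum_(al : {ffun 'I_n -> 'I_2} | (mi_order (mi_of al) <= 1)%N)
   nrm (wderiv Omega (mi_of al) u) ^+ 2).

Lemma sobnorm_h1norm u : H1 u -> sobnorm Omega 1 2%:E u = (h1norm u)%:E.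
Proof.
move=> hu; rewrite /sobnorm /h1norm.
rewrite (eq_bigr (fun al : {ffun 'I_n -> 'I_2} => (nrm (wderiv Omega (mi_of al) u) ^+ 2)%:E)); last first.
  move=> al h; rewrite (Lqnorm2_nm oO); last by case: (sobolev_wderiv hu h).
  by rewrite poweR_EFin powR_mulrn// nm_ge0.
rewrite sumEFin poweR_EFin powR12_sqrt//.
by apply: sumr_ge0 => al _; rewrite sqr_ge0.
Qed.

Lemma h1norm_ge0 u : 0 <= h1norm u. Proof. exact: sqrtr_ge0. Qed.

Lemma nm_le_h1norm (al : {ffun 'I_n -> 'I_2}) u : (mi_order (mi_of al) <= 1)%N ->
  nrm (wderiv Omega (mi_of al) u) <= h1norm u.
Proof.
move=> h; rewrite -(ger0_norm (nm_ge0 _ _ _)) -sqrtr_sqr /h1norm ler_sqrt.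
  by rewrite (bigD1 al)//= lerDl; apply: sumr_ge0 => be _; rewrite sqr_ge0.
by apply: sumr_ge0 => be _; rewrite sqr_ge0.
Qed.

Definition ffun_unit (i : 'I_n) : {ffun 'I_n -> 'I_2} := [ffun j => inord (j == i)].

Lemma mi_of_unit i : mi_of (ffun_unit i) = mi_unit i.
Proof. by apply/funext => j; rewrite /mi_of ffunE inordK//; case: (j == i). Qed.

Lemma mi_of_0 : mi_of ([ffun=> ord0] : {ffun 'I_n -> 'I_2}) = (fun=> 0%N).
Proof. by apply/funext => j; rewrite /mi_of ffunE. Qed.

Lemma wd_le_h1norm i u : nrm (wd i u) <= h1norm u.
Proof.
have := @nm_le_h1norm (ffun_unit i) u; rewrite mi_of_unit mi_order_unit; exact.
Qed.

Lemma nm_le_h1norm0 u : sqi u -> nrm u <= h1norm u.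
Proof.
move=> su; have := @nm_le_h1norm [ffun=> ord0] u; rewrite mi_of_0 mi_order0 => /(_ isT).
have wu := wderiv0_ae su.
rewrite (nm_ae mO _ _ wu)//; last exact: sqint_measurable su.
by have [_ [] ] := wderivP (wderiv0_id (sqint_loc_integrable oO su)).
Qed.

(** Together with [wd_le_h1norm] and [nm_le_h1norm0], this translates approximation
    for the Sobolev norm into approximation of the function and of each of its
    derivatives. *)
Lemma h1norm_le u c : H1 u -> 0 <= c -> nrm u <= c -> (forall i, nrm (wd i u) <= c) ->
  h1norm u <= Num.sqrt #|{ffun 'I_n -> 'I_2}|%:R * c.
Proof.
move=> hu c0 hc hwd; rewrite /h1norm -[X in _ * X](ger0_norm c0) -sqrtr_sqr -sqrtrM ?ler0n//.
rewrite ler_sqrt ?mulr_ge0 ?ler0n ?sqr_ge0// mulr_natl.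
apply: (@le_trans _ _ (\sum_(al : {ffun 'I_n -> 'I_2} | (mi_order (mi_of al) <= 1)%N) c ^+ 2)).
  apply: ler_sum => al /mi_order_le1[->|[i ->]].
    rewrite lerXn2r ?nnegrE ?nm_ge0//; have su := sobolev_sqint hu.
    rewrite (nm_ae mO _ _ (wderiv0_ae su))//; last exact: sqint_measurable su.
    by have [_ [] ] := wderivP (wderiv0_id (sqint_loc_integrable oO su)).
  by rewrite lerXn2r ?nnegrE ?nm_ge0.
rewrite sumr_const; apply: ler_wpMn2l; first exact: sqr_ge0.
exact: max_card.
Qed.

Lemma H10P u : H10 Omega u <-> H1 u /\ forall eps, 0 < eps -> exists theta,
  [/\ test_function Omega theta, nrm (fun x => u x - theta x) < eps &
      forall i, nrm (fun x => wd i u x - pderiv i theta x) < eps].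
Proof.
have key theta : H1 u -> test_function Omega theta ->
  [/\ H1 (u \- theta), sqi (u \- theta) & forall i,
    nrm (wd i (u \- theta)) = nrm (fun x => wd i u x - pderiv i theta x)].
  move=> hu th; have ht := test_sobolev th.
  have E : u \- theta = fun x => 1 * u x + -1 * theta x.
    by apply/funext => x; rewrite mul1r mulN1r.
  have h : H1 (u \- theta) by rewrite E; exact: sobolev_lin.
  split => //; first exact: sobolev_sqint h.
  move=> i; apply: (nm_ae mO).
  - by have [_ /sqint_measurable] := sobolev_wd i h.
  - apply: measurable_funB; first by have [_ /sqint_measurable] := sobolev_wd i hu.
    exact: sqint_measurable (test_pderiv_sqint oO i th).
  rewrite E; apply: filterS2 (wd_lin i 1 (-1) hu ht) (test_wd i th) => x h1 h2 Ox.
  by rewrite h1// h2//; ring.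
split=> -[hu h]; split => // eps eps0.
  have [theta th] := h _ eps0; have [k1 k2 k3] := key _ hu th.
  rewrite sobnorm_h1norm// lte_fin => lt; exists theta; split => //.
    by apply: le_lt_trans lt; exact: nm_le_h1norm0.
  by move=> i; rewrite -k3; apply: le_lt_trans lt; exact: wd_le_h1norm.
pose c := eps / (Num.sqrt #|{ffun 'I_n -> 'I_2}|%:R + 1).
have q0 : 0 <= Num.sqrt #|{ffun 'I_n -> 'I_2}|%:R :> R by exact: sqrtr_ge0.
have c0 : 0 < c by rewrite divr_gt0// ltr_wpDl.
have [theta [th h1 h2]] := h _ c0; have [k1 k2 k3] := key _ hu th.
exists theta => //; rewrite sobnorm_h1norm// lte_fin.
apply: le_lt_trans (h1norm_le k1 (ltW c0) (ltW h1) _) _.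
  by move=> i; rewrite k3; exact/ltW/h2.
by rewrite /c mulrA ltr_pdivrMr ?ltr_wpDl// mulrC ltr_pM2l// ltrDl.
Qed.

Lemma H10_lin a b u v : H10 Omega u -> H10 Omega v -> H10 Omega (fun x => a * u x + b * v x).
Proof.
move=> /H10P[hu hu'] /H10P[hv hv']; apply/H10P; split; first exact: sobolev_lin.
move=> eps eps0; pose c := eps / (`|a| + `|b| + 1).
have ab0 : 0 < `|a| + `|b| + 1 by rewrite ltr_wpDl// addr_ge0.
have c0 : 0 < c by rewrite divr_gt0.
have [th1 [t1 u1 d1]] := hu' _ c0; have [th2 [t2 u2 d2]] := hv' _ c0.
exists (fun x => a * th1 x + b * th2 x).
have bound w1 w2 : sqi w1 -> sqi w2 -> nrm w1 < c -> nrm w2 < c ->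
    nrm (fun x => a * w1 x + b * w2 x) < eps.
  move=> s1 s2 l1 l2; apply: le_lt_trans (nmD mO (sqint_scale mO a s1) (sqint_scale mO b s2)) _.
  rewrite !(nmZ mO)//; apply: (@le_lt_trans _ _ (`|a| * c + `|b| * c)).
    by apply: lerD; apply: ler_wpM2l => //; exact: ltW.
  by rewrite -mulrDl /c mulrA ltr_pdivrMr// mulrC ltr_pM2l// ltrDl.
split; first exact: test_lin.
- have := bound _ _ (sqint_sub mO (sobolev_sqint hu) (test_sqint oO t1))
    (sqint_sub mO (sobolev_sqint hv) (test_sqint oO t2)) u1 u2.
  by congr (nrm _ < _); apply/funext => x; ring.
move=> i; have [_ su] := sobolev_wd i hu; have [_ sv] := sobolev_wd i hv.
have pE x : pderiv i (fun x => a * th1 x + b * th2 x) x = a * pderiv i th1 x + b * pderiv i th2 x.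
  have [_ e1 _ _] := test_cC1 t1; have [_ e2 _ _] := test_cC1 t2.
  rewrite /pderiv (@deriveD _ _ _ (fun x => a * th1 x) (fun x => b * th2 x)).
  - by congr (_ + _); [exact: (@deriveZ _ _ _ th1)|exact: (@deriveZ _ _ _ th2)].
  - exact: (@derivableZ _ _ _ th1).
  - exact: (@derivableZ _ _ _ th2).
have s1 := test_pderiv_sqint oO i t1; have s2 := test_pderiv_sqint oO i t2.
have := bound _ _ (sqint_sub mO su s1) (sqint_sub mO sv s2) (d1 i) (d2 i).
congr (_ < _); apply: (nm_ae mO).
- exact: (sqint_measurable (sqint_lin mO a b (sqint_sub mO su s1) (sqint_sub mO sv s2))).
- apply: measurable_funB.
    by have [_ /sqint_measurable] := sobolev_wd i (sobolev_lin a b hu hv).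
  rewrite (_ : pderiv i _ = fun x => a * pderiv i th1 x + b * pderiv i th2 x); last exact/funext.
  exact: (sqint_measurable (sqint_lin mO a b s1 s2)).
apply: filterS (wd_lin i a b hu hv) => x e Ox; rewrite e// pE; ring.
Qed.

End sobolev_spaces.

(** * The Sobolev embedding of H^1_0 *)

Section vector_fields.
Context d (T : measurableType d) (R : realType) (mu : {measure set T -> \bar R}) (D : set T).
Hypothesis mD : measurable D.
Implicit Types (u v : T -> R).

Lemma measurable_dotv n (F G : T -> 'rV[R]_n) : (forall i, measurable_fun D (fun x => F x ord0 i)) ->
  (forall i, measurable_fun D (fun x => G x ord0 i)) -> measurable_fun D (fun x => dotv (F x) (G x)).
Proof.
move=> mF mG; rewrite /dotv.
exact: (measurable_sum (h := fun i x => F x ord0 i * G x ord0 i) _ (fun i => measurable_funM (mF i) (mG i))).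
Qed.

Lemma measurable_enorm n (F : T -> 'rV[R]_n) : (forall i, measurable_fun D (fun x => F x ord0 i)) ->
  measurable_fun D (fun x => enorm (F x)).
Proof.
move=> mF; rewrite /enorm; apply: (@measurableT_comp _ _ _ _ _ _ (@Num.sqrt R)).
  by apply: continuous_measurable_fun; exact: sqrt_continuous.
exact: (measurable_sum (h := fun i x => F x ord0 i ^+ 2) _ (fun i => measurable_funX 2 (mF i))).
Qed.

Lemma sqint_enorm n (F : T -> 'rV[R]_n) : (forall i, sqint mu D (fun x => F x ord0 i)) ->
  sqint mu D (fun x => enorm (F x)).
Proof.
move=> sF; split; first by apply: measurable_enorm => i; case: (sF i).
have := integrable_sum mD (index_enum 'I_n) (P := xpredT) (fun i _ => (sF i).2).
apply: eq_integrable => // x _; rewrite /= sumEFin sqr_enorm; congr EFin; apply: eq_bigr => i _; rewrite expr2.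
Qed.

Lemma Rintegral_sum (I : Type) (s : seq I) (f : I -> T -> R) :
  (forall i, mu.-integrable D (EFin \o f i)) ->
  \int[mu]_(x in D) (\sum_(i <- s) f i x) = \sum_(i <- s) \int[mu]_(x in D) f i x.
Proof.
move=> fi; elim: s => [|i s IH].
  by rewrite big_nil; under eq_Rintegral do rewrite big_nil; rewrite Rintegral_cst// mul0r.
rewrite big_cons -IH -RintegralD//.
  by apply: eq_Rintegral => x _; rewrite big_cons.
have := integrable_sum mD s (P := xpredT) (fun i _ => fi i).
by apply: eq_integrable => // x _; rewrite /= sumEFin.
Qed.

Lemma sqr_nm_enorm n (F : T -> 'rV[R]_n) : (forall i, sqint mu D (fun x => F x ord0 i)) ->
  nm mu D (fun x => enorm (F x)) ^+ 2 = \sum_i nm mu D (fun x => F x ord0 i) ^+ 2.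
Proof.
move=> sF; rewrite sqr_nm; under eq_bigr do rewrite sqr_nm.
rewrite /ip -Rintegral_sum; last by move=> i; exact: (sqint_mul mD).
by apply: eq_Rintegral => x _; rewrite -expr2 sqr_enorm.
Qed.

Lemma powR_integrable (g : T -> R) be : (mu D < +oo)%E -> sqint mu D g -> (forall x, 0 <= g x) ->
  0 < be -> be <= 2 -> mu.-integrable D (EFin \o (fun x => g x `^ be)).
Proof.
move=> Doo [mg ig] g0 be0 be2.
have i1 : mu.-integrable D (EFin \o (fun=> 1 : R)).
  apply: measurable_bounded_integrable => //.
  by exists 1; split; [exact: num_real|move=> B B1 x _; rewrite /= normr1 ltW].
apply: (le_integrable mD _ _ (integrableD mD i1 ig)).
  by apply/measurable_EFinP; exact: (measurableT_comp (measurable_powR _)).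
move=> x Dx; rewrite /= lee_fin !ger0_norm ?powR_ge0 ?addr_ge0 ?sqr_ge0//.
exact: powR_le_sqr.
Qed.

Lemma Rpower_mean (g : T -> R) (p r : R) : (mu D < +oo)%E -> sqint mu D g -> (forall x, 0 <= g x) ->
  0 < p -> p <= r -> r <= 2 ->
  \int[mu]_(x in D) (g x `^ p) <=
  (\int[mu]_(x in D) (g x `^ r)) `^ (p / r) * fine (mu D) `^ (1 - p / r).
Proof.
move=> Doo sg g0 p0; rewrite le_eqVlt => /predU1P[<- p2|pr r2].
  rewrite mulfV ?gt_eqF// subrr powRr0 mulr1 powRr1//.
  by apply: Rintegral_ge0 => x _; exact: powR_ge0.
have r0 := lt_trans p0 pr.
have ip_ := powR_integrable Doo sg g0 p0 (le_trans (ltW pr) r2).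
have ir := powR_integrable Doo sg g0 r0 r2.
have Df : mu D \is a fin_num by rewrite ge0_fin_numE.
rewrite -lee_fin EFinM -!poweR_EFin !fineK ?integrable_fin_num//.
by apply: power_mean => //; case: sg.
Qed.

End vector_fields.

Section sobolev_embedding.
Context (R : realType) (n : nat) (Omega : set 'rV[R]_n).
Hypothesis oO : open Omega.
Local Notation mu := (lebesgue_rowvec R n).
Local Notation mO := (open_measurable_rowvec oO).
Local Notation sqi := (sqint mu Omega).
Local Notation nrm := (nm mu Omega).
Local Notation H1 := (sobolev Omega 1 2%:E).
Local Notation wd i := (wderiv Omega (mi_unit i)).
Implicit Types (u v : 'rV[R]_n -> R).

Lemma wgradE u x i : wgrad Omega u x ord0 i = wd i u x. Proof. by rewrite mxE. Qed.

Lemma sqint_wgrad_coord u i : H1 u -> sqi (fun x => wgrad Omega u x ord0 i).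
Proof.
move=> hu; under eq_fun do rewrite wgradE.
by have [_] := sobolev_wd oO i hu.
Qed.

Lemma sqint_grad u : H1 u -> sqi (fun x => enorm (wgrad Omega u x)).
Proof. by move=> hu; apply: (sqint_enorm mO) => i; exact: sqint_wgrad_coord. Qed.

Lemma nm_grad_le u : H1 u -> nrm (fun x => enorm (wgrad Omega u x)) ^+ 2 <= n%:R * h1norm Omega u ^+ 2.
Proof.
move=> hu; rewrite (sqr_nm_enorm mO) => [|i]; last exact: sqint_wgrad_coord.
have -> : n%:R * h1norm Omega u ^+ 2 = \sum_(i < n) h1norm Omega u ^+ 2.
  by rewrite sumr_const card_ord mulr_natl.
apply: ler_sum => i _.
rewrite lerXn2r ?nnegrE ?nm_ge0 ?h1norm_ge0//; under eq_fun do rewrite wgradE.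
exact: wd_le_h1norm.
Qed.

Lemma wgrad_lin a b u v : H1 u -> H1 v ->
  ae_eq mu Omega (wgrad Omega (fun x => a * u x + b * v x))
    (fun x => a *: wgrad Omega u x + b *: wgrad Omega v x).
Proof.
move=> hu hv.
have h : \forall x \ae mu, forall i : 'I_n, Omega x ->
    wd i (fun x => a * u x + b * v x) x = a * wd i u x + b * wd i v x.
  apply: filter_forall => i; exact: wd_lin.
apply: filterS h => x h Ox; apply/rowP => i; rewrite wgradE h//.
by rewrite !mxE.
Qed.

Lemma clgradE theta (x : 'rV[R]_n) i : clgrad theta x ord0 i = pderiv i theta x.
Proof. by rewrite mxE. Qed.

Lemma sqint_clgrad theta : test_function Omega theta -> sqi (fun x => enorm (clgrad theta x)).
Proof.
move=> th; apply: (sqint_enorm mO) => i; under eq_fun do rewrite clgradE.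
exact: test_pderiv_sqint.
Qed.

End sobolev_embedding.

Section embedding.
Context (R : realType) (m : nat) (Omega : set 'rV[R]_m.+2).
Hypothesis oO : open Omega.
Hypothesis bO : bounded_set Omega.
Local Notation n := m.+2.
Local Notation mu := (lebesgue_rowvec R n).
Local Notation mO := (open_measurable_rowvec oO).
Local Notation sqi := (sqint mu Omega).
Local Notation nrm := (nm mu Omega).
Local Notation H1 := (sobolev Omega 1 2%:E).
Local Notation wd i := (wderiv Omega (mi_unit i)).
Variable be : R.
Hypotheses (be1 : 1 < be) (be2 : be < 2) (beq : 2 * (m%:R + 2) / (m%:R + 4) <= be).

Lemma Omega_lty : (mu Omega < +oo)%E.
Proof. by apply: bounded_lty => //; exact: mO. Qed.

Local Notation G F := (\int[mu]_(x in Omega) (enorm (F x) `^ be)).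

(** On a set of finite measure the exponent 2n/(n+2) of [gns_inequality] can be
    raised to be, by comparison of power means. *)
Lemma test_embedding : exists2 C, 0 < C & forall theta, test_function Omega theta ->
  nrm theta <= C * G (clgrad theta) `^ be^-1.
Proof.
pose q : R := 2 * (m%:R + 2) / (m%:R + 4).
have m0 : 0 <= m%:R :> R by rewrite ler0n.
have be0 : 0 < be := lt_trans ltr01 be1.
have q0 : 0 < q by rewrite divr_gt0 ?mulr_gt0// ltr_wpDl.
pose K := (fine (mu Omega) `^ (1 - q / be)) `^ q^-1.
have K0 : 0 <= K by exact: powR_ge0.
exists (2 * (K + 1)); first by rewrite mulr_gt0// ltr_wpDl.
move=> theta th; have c1 := test_cC1 th.
have G0 : 0 <= G (clgrad theta) by apply: Rintegral_ge0 => x _; exact: powR_ge0.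
have sg := sqint_clgrad oO th; have st := test_sqint oO th.
have ig := powR_integrable mO Omega_lty sg (fun=> enorm_ge0 _) q0 (le_trans beq (ltW be2)).
have gns := gns_inequality (erefl q) c1.
have E1 : (\int[mu]_x (theta x ^+ 2)%:E = (nrm theta ^+ 2)%:E)%E.
  rewrite sqr_nm /ip /Rintegral.
  transitivity (\int[mu]_(x in Omega) (theta x ^+ 2)%:E)%E.
    rewrite [RHS]integral_mkcond; apply: eq_integral => x _; rewrite patchE; case: ifPn => //.
    by rewrite notin_setE => /(test_support th) ->; rewrite expr0n.
  by rewrite -(fineK (integrable_fin_num mO st.2)).
have E2 : (\int[mu]_x (enorm (clgrad theta x) `^ q)%:E =
    (\int[mu]_(x in Omega) (enorm (clgrad theta x) `^ q))%:E)%E.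
  rewrite /Rintegral (fineK (integrable_fin_num mO ig)) [RHS]integral_mkcond.
  apply: eq_integral => x _; rewrite patchE; case: ifPn => //; rewrite notin_setE => nx.
  rewrite (_ : clgrad theta x = 0) ?enorm0 ?powR0 ?gt_eqF//.
  by apply/rowP => i; rewrite clgradE (test_pderiv_support _ th)// mxE.
rewrite E1 E2 in gns.
have := Rpower_mean mO Omega_lty sg (fun=> enorm_ge0 _) q0 beq (ltW be2).
set A := \int[mu]_(x in Omega) (enorm (clgrad theta x) `^ q) in gns * => hA.
have {}gns : (nrm theta ^+ 2) `^ 2^-1 <= 2 * A `^ q^-1 := gns.
rewrite (sqr_powR_half (nm_ge0 _ _ _)) in gns.
apply: le_trans gns _; rewrite -mulrA ler_pM2l//.
have A0 : 0 <= A by apply: Rintegral_ge0 => x _; exact: powR_ge0.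
have qi : 0 <= q^-1 by rewrite invr_ge0 ltW.
apply: (@le_trans _ _ ((G (clgrad theta) `^ (q / be) * fine (mu Omega) `^ (1 - q / be)) `^ q^-1)).
  by apply: ge0_ler_powR => //; rewrite nnegrE// mulr_ge0 ?powR_ge0.
rewrite powRM ?powR_ge0// -powRrM -/K mulrC (_ : q / be / q = be^-1); last first.
  by rewrite mulrAC mulfV ?gt_eqF// mul1r.
by rewrite ler_wpM2r ?powR_ge0// lerDl.
Qed.

(** For every s > \int |grad v|^be there is a test function theta so close to v
    that the embedding for theta bounds the norm of v by a fixed multiple of
    s^(1/be); then s tends to the integral. *)
Lemma H10_embedding : exists2 C, 0 < C & forall v, H10 Omega v ->
  nrm v <= C * G (wgrad Omega v) `^ be^-1.
Proof.
have [C1 C10 emb] := test_embedding.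
have be0 : 0 < be := lt_trans ltr01 be1.
have bei : 0 < be^-1 by rewrite invr_gt0.
pose K := fine (mu Omega) `^ (1 - be / 2).
have K0 : 0 <= K by exact: powR_ge0.
exists (1 + C1 * 8 `^ be^-1); first by rewrite addr_gt0// mulr_gt0// powR_gt0.
move=> v /(H10P oO)[hv app]; set A := G (wgrad Omega v).
have sgv := sqint_grad oO hv.
have A0 : 0 <= A by apply: Rintegral_ge0 => x _; exact: powR_ge0.
have key s : A < s -> nrm v <= (1 + C1 * 8 `^ be^-1) * s `^ be^-1.
  move=> As; have s0 := le_lt_trans A0 As.
  pose c := (s / (K + 1)) `^ be^-1.
  have K10 : 0 < K + 1 by rewrite ltr_wpDl.
  have c0 : 0 < c by rewrite powR_gt0// divr_gt0.
  pose eps := c / n%:R.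
  have eps0 : 0 < eps by rewrite divr_gt0// ltr0n.
  have [theta [th hu hd]] := app _ eps0.
  have st := test_sqint oO th; have sv := sobolev_sqint oO hv.
  pose W x := wgrad Omega v x - clgrad theta x.
  have WE x i : W x ord0 i = wd i v x - pderiv i theta x by rewrite !mxE.
  have sWi i : sqi (fun x => W x ord0 i).
    under eq_fun do rewrite WE.
    by apply: (sqint_sub mO); [have [_] := sobolev_wd oO i hv|exact: test_pderiv_sqint].
  have sW : sqi (fun x => enorm (W x)) by apply: (sqint_enorm mO).
  have nW : nrm (fun x => enorm (W x)) <= c.
    rewrite -(@ler_pXn2r _ 2) ?nnegrE ?nm_ge0 ?(ltW c0)// (sqr_nm_enorm mO)//.
    apply: (@le_trans _ _ (\sum_(i < n) eps ^+ 2)).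
      apply: ler_sum => i _; rewrite lerXn2r ?nnegrE ?nm_ge0 ?(ltW eps0)//.
      by under eq_fun do rewrite WE; exact/ltW/hd.
    rewrite sumr_const card_ord -mulr_natr /eps exprMn -mulrA ger_pMr ?exprn_gt0//.
    by rewrite exprVn -[X in _ * X]invrK -invfM invf_le1 ?expr2 -?mulrA ?divff ?mulr1 ?pnatr_eq0// ?ler1n// ltr0n.
  have B1 : \int[mu]_(x in Omega) (enorm (W x) `^ be) <= s.
    have := Rpower_mean mO Omega_lty sW (fun=> enorm_ge0 _) be0 (ltW be2) (lexx 2).
    under [X in X `^ _]eq_Rintegral do rewrite powR_mulrn ?enorm_ge0// expr2.
    rewrite -/(ip mu Omega (fun x => enorm (W x)) (fun x => enorm (W x))) -sqr_nm -/K => h.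
    apply: le_trans h _; rewrite -powR_mulrn ?nm_ge0// -powRrM (_ : 2 * (be / 2) = be); last by field.
    apply: (@le_trans _ _ (c `^ be * K)).
      by rewrite ler_wpM2r//; apply: ge0_ler_powR; rewrite ?nnegrE ?nm_ge0 ?(ltW c0) ?(ltW be0).
    rewrite /c powRVK ?gt_eqF ?divr_ge0 ?(ltW s0) ?(ltW K10)//.
    by rewrite mulrAC ler_pdivrMr// ler_pM2l// lerDl.
  have iW := powR_integrable mO Omega_lty sW (fun=> enorm_ge0 _) be0 (ltW be2).
  have iv := powR_integrable mO Omega_lty sgv (fun=> enorm_ge0 _) be0 (ltW be2).
  have B2 : G (clgrad theta) <= 8 * s.
    apply: (@le_trans _ _ (4 * (A + \int[mu]_(x in Omega) (enorm (W x) `^ be)))); last first.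
      by have := lerD (ltW As) B1; lra.
    rewrite -RintegralD//; last exact: mO.
    have is_ := integrableD mO iv iW.
    rewrite -RintegralZl//; last exact: mO.
    apply: le_Rintegral; first exact: mO.
    - exact: (powR_integrable mO Omega_lty (sqint_clgrad oO th) (fun=> enorm_ge0 _) be0 (ltW be2)).
    - exact: (integrableZl mO 4 is_).
    move=> x Ox; set a := enorm (wgrad _ _ x); set b := enorm (W x).
    have a0 : 0 <= a by exact: enorm_ge0.
    have b0 : 0 <= b by exact: enorm_ge0.
    have cab : enorm (clgrad theta x) <= a + b.
      have -> : clgrad theta x = wgrad Omega v x - W x by rewrite /W opprB addrC subrK.
      by apply: le_trans (enormD _ _) _; rewrite enormN.
    apply: (@le_trans _ _ ((a + b) `^ be)).
      by apply: powR_mono cab; [exact: ltW|exact: enorm_ge0].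
    apply: le_trans (powRD_le a0 b0 (ltW be0)) _; rewrite ler_wpM2r ?addr_ge0 ?powR_ge0//.
    rewrite (_ : 4 = 2 `^ 2); last by rewrite powR_mulrn// expr2 -natrM.
    by apply: ler_powR; [rewrite ler1n|exact: ltW].
  have csle : c <= s `^ be^-1.
    apply: ge0_ler_powR; rewrite ?nnegrE ?(ltW bei) ?divr_ge0 ?(ltW s0) ?(ltW K10)//.
    by rewrite ler_pdivrMr// ler_peMr ?(ltW s0)// lerDr.
  have epsc : eps <= c by rewrite /eps ler_pdivrMr ?ltr0n// ler_peMr ?(ltW c0)// ler1n.
  have vE : v = fun x => (v x - theta x) + theta x by apply/funext => x; rewrite subrK.
  rewrite {1}vE; apply: le_trans (nmD mO (sqint_sub mO sv st) st) _.
  rewrite mulrDl mul1r; apply: lerD; first by apply: le_trans (ltW hu) _; exact: le_trans epsc csle.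
  apply: le_trans (emb _ th) _; rewrite -mulrA ler_pM2l// -powRM//; last exact: ltW.
  apply: powR_mono B2; first exact: ltW.
  by apply: Rintegral_ge0 => x _; exact: powR_ge0.
set C := 1 + _ in key *.
have C0 : 0 < C by rewrite /C addr_gt0// mulr_gt0// powR_gt0.
have N0 : 0 <= nrm v / C by rewrite divr_ge0 ?nm_ge0 ?ltW.
rewrite mulrC -ler_pdivrMr//.
suff : (nrm v / C) `^ be <= A.
  move=> h; have := ge0_ler_powR (ltW bei); move=> /(_ ((nrm v / C) `^ be) A).
  rewrite !nnegrE powR_ge0 => /(_ isT A0 h).
  by rewrite -powRrM mulfV ?gt_eqF// powRr1.
apply/ler_addgt0Pr => e e0.
have As : A < A + e by rewrite ltrDl.
have := key _ As; rewrite mulrC -ler_pdivrMr// => h.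
rewrite -[leRHS](@powRVK _ _ be) ?gt_eqF ?addr_ge0 ?(ltW e0)//.
by apply: ge0_ler_powR; rewrite ?nnegrE ?(ltW be0) ?powR_ge0.
Qed.

End embedding.

(** * Orthonormal bases of the finite element space *)

Section finite_element_space.
Context (R : realType) (n : nat) (Omega : set 'rV[R]_n).
Hypothesis oO : open Omega.
Context (Th : triangulation Omega) (r : nat).
Local Notation mu := (lebesgue_rowvec R n).
Local Notation mO := (open_measurable_rowvec oO).
Local Notation sqi := (sqint mu Omega).
Local Notation nrm := (nm mu Omega).
Local Notation ip := (ip mu Omega).
Local Notation W := (fespace Th r).
Implicit Types (u v : 'rV[R]_n -> R).

Lemma polyfun_lin a b (p q : 'rV[R]_n -> R) : polyfun r p -> polyfun r q ->
  polyfun r (fun x => a * p x + b * q x).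
Proof.
move=> [c pE] [e qE]; exists (fun al => a * c al + b * e al) => x.
rewrite pE qE !mulr_sumr -big_split; apply: eq_bigr => al _ /=; ring.
Qed.

Lemma fespace_lin a b u v : W u -> W v -> W (fun x => a * u x + b * v x).
Proof.
move=> [cu u0 hu pu] [cv v0 hv pv]; split.
- by apply: continuous_add; apply: continuous_mul => //; exact: cst_continuous.
- by move=> x nx; rewrite u0// v0// !mulr0 addr0.
- exact: H10_lin.
move=> T; have [p pp up] := pu T; have [q qq vq] := pv T.
exists (fun x => a * p x + b * q x); first exact: polyfun_lin.
by move=> x xT; rewrite up// vq.
Qed.

Lemma fespace_H10 u : W u -> H10 Omega u. Proof. by case. Qed.

Lemma fespace_sobolev u : W u -> sobolev Omega 1 2%:E u. Proof. by case=> _ _ []. Qed.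

Lemma fespace_sqint u : W u -> sqi u.
Proof. by move=> /fespace_sobolev; exact: sobolev_sqint. Qed.

Lemma fespace_sum (I : Type) (s : seq I) (a : I -> R) (w : I -> 'rV[R]_n -> R) v :
  W v -> (forall i, W (w i)) -> W (fun x => \sum_(i <- s) a i * w i x).
Proof.
move=> Wv Ww; elim: s => [|i s IH].
  have := fespace_lin 0 0 Wv Wv; congr (W _); apply/funext => x.
  by rewrite big_nil !mul0r addr0.
have := fespace_lin (a i) 1 (Ww i) IH; congr (W _); apply/funext => x.
by rewrite big_cons mul1r.
Qed.

Local Notation coefs := (tri_index Th * {ffun 'I_n -> 'I_r.+1})%type.

Definition monomial_value (al : {ffun 'I_n -> 'I_r.+1}) (x : 'rV[R]_n) : R :=
  if (mi_order (mi_of al) <= r)%N then \prod_(i < n) x ord0 i ^+ al i else 0.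

Lemma fespace_coef v : W v -> exists c : coefs -> R, forall T x, element T x ->
  v x = \sum_al c (T, al) * monomial_value al x.
Proof.
move=> [_ _ _ pv].
have /choice[c cE] : forall T : tri_index Th, exists c : {ffun 'I_n -> 'I_r.+1} -> R, forall x, element T x ->
    v x = \sum_al c al * monomial_value al x.
  move=> T; have [p [c pE] vp] := pv T; exists c => x xT; rewrite vp ?mem_set// pE.
  rewrite big_mkcond; apply: eq_bigr => al _; rewrite /monomial_value.
  by case: ifP => // _; rewrite mulr0.
by exists (fun p => c p.1 p.2).
Qed.

Definition orthonormal_family k (w : 'I_k -> 'rV[R]_n -> R) :=
  (forall i, W (w i)) /\ forall i j, ip (w i) (w j) = (i == j)%:R.

Lemma orthonormal_comb k (w : 'I_k -> 'rV[R]_n -> R) (a : 'I_k -> R) j : orthonormal_family w ->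
  ip (fun x => \sum_i a i * w i x) (w j) = a j.
Proof.
move=> [Ww ow]; rewrite (ip_sum mO); [|by move=> i; exact: fespace_sqint|exact: fespace_sqint].
by rewrite (bigD1 j)//= ow eqxx mulr1 big1 ?addr0// => i /negbTE ij; rewrite ow ij mulr0.
Qed.

(** More coefficient vectors than their length are linearly dependent. The same
    combination of the functions vanishes on Omega, which contradicts
    orthonormality. *)
Lemma orthonormal_size k (w : 'I_k -> 'rV[R]_n -> R) : orthonormal_family w ->
  (k <= #|{: coefs}|)%N.
Proof.
move=> ow; have [Ww _] := ow.
have /choice[c cE] : forall i, exists c : coefs -> R, forall T x, element T x ->
    w i x = \sum_al c (T, al) * monomial_value al x by move=> i; exact: fespace_coef.
rewrite leqNgt; apply/negP => lt_k.
pose M : 'M[R]_(k, #|{: coefs}|) := \matrix_(i, e) c i (enum_val e).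
have : kermx M != 0.
  rewrite kermx_eq0 -row_leq_rank -ltnNge; apply: leq_ltn_trans lt_k; exact: rank_leq_col.
move=> /rowV0Pn[u /sub_kermxP uM u0].
have z0 x : Omega x -> \sum_i u ord0 i * w i x = 0.
  move=> /subset_closure; rewrite (tri_cover Th) => -[T _ xT].
  under eq_bigr => i _ do rewrite (cE i T)// mulr_sumr.
  rewrite exchange_big big1// => al _; under eq_bigr do rewrite mulrA.
  rewrite -mulr_suml; have := congr1 (fun A : 'rV[R]_ _ => A ord0 (enum_rank (T, al))) uM.
  rewrite !mxE; under eq_bigr do rewrite mxE enum_rankK.
  by move=> ->; rewrite mul0r.
case/eqP: u0; apply/rowP => j; rewrite mxE -(orthonormal_comb (fun i => u ord0 i) j ow).
rewrite -[RHS](@ip0l _ _ _ mu _ mO (w j)); apply: eq_Rintegral => x; rewrite inE => Ox.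
by rewrite z0.
Qed.

(** An orthonormal family of maximal size: the normalised remainder of a function
    outside its span would extend it. *)
Lemma orthonormal_basis v0 : W v0 -> exists k (w : 'I_k -> 'rV[R]_n -> R),
  orthonormal_family w /\
  forall v, W v -> ae_eq mu Omega v (fun x => \sum_i ip v (w i) * w i x).
Proof.
move=> Wv0.
(* The empty family makes the maximum meaningful even for the null space. *)
pose P k := `[< exists w : 'I_k -> 'rV[R]_n -> R, orthonormal_family w >].
have P0 : exists k, P k.
  exists 0%N; apply/asboolP; exists (fun _ => v0); split => [[]//|[]//].
have Pmax k : P k -> (k <= #|{: coefs}|)%N by move=> /asboolP[w]; exact: orthonormal_size.
case: (ex_maxnP P0 Pmax) => k /asboolP[w ow] kmax; exists k, w; split => // v Wv.
have [Ww oww] := ow.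
pose s x := \sum_i ip v (w i) * w i x.
have Ws : W s by exact: fespace_sum Wv Ww.
pose q x := 1 * v x + -1 * s x.
have Wq : W q by exact: fespace_lin.
have sq := fespace_sqint Wq; have ss := fespace_sqint Ws; have sv := fespace_sqint Wv.
have qw i : ip q (w i) = 0.
  have sw := fespace_sqint (Ww i).
  by rewrite (ip_lin mO)// orthonormal_comb// mul1r mulN1r subrr.
have q0 : ip q q = 0.
  apply/eqP; rewrite eq_le ip_ge0 andbT leNgt; apply/negP => qq.
  pose e x := (nrm q)^-1 * q x.
  have nq : 0 < nrm q by rewrite sqrtr_gt0.
  have se : sqi e := sqint_scale mO (nrm q)^-1 sq.
  have We : W e.
    have := fespace_lin (nrm q)^-1 0 Wq Wq; congr (W _); apply/funext => x.
    by rewrite mul0r addr0.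
  pose w' (i : 'I_k.+1) := oapp w e (unlift ord0 i).
  have : P k.+1.
    apply/asboolP; exists w'; split.
      by move=> i; rewrite /w'; case: (unlift ord0 i).
    have ee : ip e e = 1.
      rewrite (ipZl mO)// ipC (ipZl mO)// mulrA -invfM -expr2 sqr_nm mulVf ?gt_eqF//.
    have ew j : ip e (w j) = 0.
      by rewrite (ipZl mO)//; [rewrite qw mulr0|exact: fespace_sqint].
    move=> i j; rewrite /w'; case: (unliftP ord0 i) => [i' ->|->]; case: (unliftP ord0 j) => [j' ->|->] /=.
    - by rewrite oww (inj_eq lift_inj).
    - by rewrite ipC ew.
    - by rewrite ew.
    - by rewrite ee.
  by move=> /kmax; rewrite ltnn.
have := ip_eq0 mO sq q0; apply: filterS => x h Ox; have := h Ox.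
by rewrite /q mul1r mulN1r => /eqP; rewrite subr_eq0 => /eqP.
Qed.

End finite_element_space.

(** * The energy on a finite-dimensional space of vector fields *)

Section galerkin_energy.
Context d (T : measurableType d) (R : realType) (mu : {measure set T -> \bar R}) (D : set T).
Hypothesis mD : measurable D.
Context (N : nat) (coef expo : 'I_N.+1 -> R).
Hypothesis H : forch_polynomial coef expo.
Context (n : nat).
Local Notation a0 := (coef ord0).
Local Notation sl := (forch_s coef expo).
Local Notation flux := (fluxv coef expo).
Local Notation Psi := (forch_Psi coef expo).
Implicit Types (F G : T -> 'rV[R]_n).

Definition sqvec F := forall i, sqint mu D (fun x => F x ord0 i).

Lemma integrable_dotv F G : sqvec F -> sqvec G -> mu.-integrable D (EFin \o (fun x => dotv (F x) (G x))).
Proof.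
move=> sF sG.
have := integrable_sum mD (index_enum 'I_n) (P := xpredT) (fun i _ => sqint_mul mD (sF i) (sG i)).
by apply: eq_integrable => // x _; rewrite /= sumEFin.
Qed.

Lemma measurable_comp_rowvec F (h : 'rV[R]_n -> R) : (forall i, measurable_fun D (fun x => F x ord0 i)) ->
  continuous h -> measurable_fun D (fun x => h (F x)).
Proof.
move=> mF ch.
pose F' : T -> 'rV[R]_n := fun x => \row_i ((fun x => F x ord0 i) \_ D) x.
have mF' : measurable_fun setT F'.
  apply: measurable_fun_rowvecP => i; under eq_fun do rewrite mxE.
  exact/(measurable_restrictT _ mD).
have m1 : measurable_fun setT (h \o F') by apply: measurableT_comp => //; exact: continuous_measurable_rowvec.
apply: (eq_measurable_fun (h \o F')); last exact: measurable_funTS.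
move=> x xD; rewrite /=; congr h; apply/rowP => i; rewrite mxE patchE xD//.
Qed.

Lemma continuous_flux i : continuous (fun x : 'rV[R]_n => flux x ord0 i).
Proof.
have L0 : 0 < 3 / a0 by rewrite divr_gt0// (coef0_gt0 H).
move=> x; have FF := nbhs_filter x.
apply/(@cvgrPdist_le _ _ _ _ FF) => e e0.
have k0 : 0 < e / (3 / a0) / n.+1%:R by rewrite divr_gt0// divr_gt0.
have close : \forall y \near nbhs x, forall j : 'I_n, `|x ord0 j - (y : 'rV[R]_n) ord0 j| <= e / (3 / a0) / n.+1%:R.
  apply: (@filter_forall _ _ _ _ FF) => j; have c := @coord_continuous_rowvec R n j x.
  by move/(@cvgrPdist_le _ _ _ _ FF) : c => /(_ _ k0).
apply: filterS close => y close.
rewrite -rowBE; apply: le_trans (coord_le_enorm _ _) _.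
apply: le_trans (fluxv_lip H _ _) _; rewrite mulrC -ler_pdivlMr//.
apply: le_trans (enorm_le_sum _) _.
apply: (@le_trans _ _ (\sum_(i < n) (e / (3 / a0) / n.+1%:R))).
  by apply: ler_sum => j _; rewrite rowBE.
have A0 : 0 <= e / (3 / a0) by rewrite divr_ge0 ?ltW.
move: (e / (3 / a0)) A0 => A A0; rewrite sumr_const card_ord -[_ *+ n]mulr_natr -mulrA.
by rewrite ler_piMr// mulrC ler_pdivrMr ?ltr0n// mul1r ler_nat.
Qed.

Lemma sqvec_flux F : sqvec F -> sqvec (fun x => flux (F x)).
Proof.
move=> sF i.
have mF j : measurable_fun D (fun x => F x ord0 j) by case: (sF j).
apply: (sqint_le mD _ _ (sqint_scale mD a0^-1 (sqint_enorm mD sF))).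
  by apply: (@measurable_comp_rowvec F (fun x => flux x ord0 i)) => //; exact: continuous_flux.
move=> x Dx; apply: le_trans (coord_le_enorm _ _) _; rewrite (enorm_fluxv H).
rewrite ger0_norm ?mulr_ge0 ?enorm_ge0 ?invr_ge0 ?(ltW (coef0_gt0 H))//.
by apply: (forch_s_le_lin H); exact: enorm_ge0.
Qed.

Lemma measurable_forch_s : measurable_fun setT sl.
Proof.
apply: continuous_measurable_fun => x; apply/cvgrPdist_le => e e0.
have ea0 : 0 < e * a0 by rewrite mulr_gt0// (coef0_gt0 H).
apply/nbhs_ballP; exists (e * a0) => //= y; rewrite /ball/= => /ltW xy.
by apply: le_trans (forch_s_lip H _ _) _; rewrite mulrC ler_pdivrMr ?(coef0_gt0 H).
Qed.

Lemma measurable_Psi : measurable_fun setT Psi.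
Proof.
rewrite /forch_Psi.
apply: (measurable_sum (h := fun i xi => coef i * (sl xi `^ (expo i + 2) * ((expo i + 1) / (expo i + 2)))) _ _) => i.
apply: measurable_funM => //; apply: measurable_funM => //.
exact: (measurableT_comp (measurable_powR _) measurable_forch_s).
Qed.

Lemma integrable_sl F : sqvec F ->
  mu.-integrable D (EFin \o (fun x => sl (enorm (F x)) * enorm (F x))).
Proof.
move=> sF; have := integrable_dotv (sqvec_flux sF) sF.
by apply: eq_integrable => // x _; rewrite /= (dotv_fluxv H).
Qed.

Lemma integrable_Psi F : sqvec F -> mu.-integrable D (EFin \o (fun x => Psi (enorm (F x)))).
Proof.
move=> sF; apply: (le_integrable mD _ _ (integrable_sl sF)).
  apply/measurable_EFinP; apply: (measurableT_comp measurable_Psi).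
  by apply: measurable_enorm => // i; case: (sF i).
move=> x Dx; rewrite /= lee_fin !ger0_norm ?(forch_Psi_ge0 H) ?enorm_ge0//.
  by apply: (forch_Psi_le H); exact: enorm_ge0.
by rewrite mulr_ge0 ?enorm_ge0// (forch_s_ge0 H).
Qed.

(** The flux has length s(|F|) and a_0 s(xi)^2 <= s(xi) xi, so that Young's
    inequality for s(|F|) |G| absorbs the flux in the dissipation. *)
Lemma flux_absorb F G : sqvec F -> sqvec G ->
  \int[mu]_(x in D) dotv (flux (F x)) (G x) <=
  4^-1 * (\int[mu]_(x in D) dotv (flux (F x)) (F x)) +
  a0^-1 * nm mu D (fun x => enorm (G x)) ^+ 2.
Proof.
move=> sF sG; have a00 := coef0_gt0 H.
have iF := integrable_dotv (sqvec_flux sF) sF.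
have iG := (sqint_enorm mD sG).2.
have i2 := sqint_mul mD (sqint_enorm mD sG) (sqint_enorm mD sG).
rewrite sqr_nm /ip -(RintegralZl 4^-1 mD iF) -(RintegralZl a0^-1 mD i2).
rewrite -RintegralD//; first apply: le_Rintegral => //.
- exact: integrable_dotv (sqvec_flux sF) sG.
- have := integrableD mD (integrableZl mD 4^-1 iF) (integrableZl mD a0^-1 iG).
  by apply: eq_integrable => // x _; rewrite /= -!EFinM -!EFinD -expr2.
- move=> x Dx; apply: le_trans (dotv_fluxv_le H _ _) _; rewrite (dotv_fluxv H).
  set b := enorm (G x); set s := sl _.
  have h := coef0_sqr_s H (enorm_ge0 (F x)); rewrite -/s in h.
  apply: (@le_trans _ _ (4^-1 * (a0 * s ^+ 2) + a0^-1 * (b * b))); last by rewrite lerD2r ler_pM2l.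
  rewrite -subr_ge0 (_ : _ - _ = a0 * (2^-1 * s - a0^-1 * b) ^+ 2).
    by rewrite mulr_ge0 ?sqr_ge0// ltW.
  by field; rewrite gt_eqF.
- exact: (integrableZl mD 4^-1 iF).
- have := integrableZl mD a0^-1 iG.
  by apply: eq_integrable => // x _; rewrite /= -!EFinM -expr2.
Qed.

Lemma dissipation_le F : sqvec F ->
  \int[mu]_(x in D) dotv (flux (F x)) (F x) <= a0^-1 * nm mu D (fun x => enorm (F x)) ^+ 2.
Proof.
move=> sF; rewrite sqr_nm /ip.
have i2 := sqint_mul mD (sqint_enorm mD sF) (sqint_enorm mD sF).
rewrite -RintegralZl//; apply: le_Rintegral => //.
- exact: integrable_dotv (sqvec_flux sF) sF.
- exact: (integrableZl mD a0^-1 i2).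
move=> x Dx; rewrite (dotv_fluxv H) mulrA ler_wpM2r ?enorm_ge0//.
by apply: (forch_s_le_lin H); exact: enorm_ge0.
Qed.

Lemma dissipation_ge0 F : 0 <= \int[mu]_(x in D) dotv (flux (F x)) (F x).
Proof.
by apply: Rintegral_ge0 => x _; rewrite (dotv_fluxv H) mulr_ge0 ?enorm_ge0// (forch_s_ge0 H).
Qed.

Context (k : nat) (G : 'I_k -> T -> 'rV[R]_n).
Hypothesis sG : forall i, sqvec (G i).

Definition field (p : 'rV[R]_k) (x : T) : 'rV[R]_n := \sum_i p ord0 i *: G i x.

Lemma sqvec_field p : sqvec (field p).
Proof.
move=> j; rewrite (_ : (fun _ => _) = fun x => \sum_i p ord0 i * G i x ord0 j).
  by apply: (sqint_sum mD) => i; exact: sG.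
by apply/funext => x; rewrite summxE; apply: eq_bigr => i _; rewrite mxE.
Qed.

Lemma fieldB p q x : field p x - field q x = field (p - q) x.
Proof.
rewrite /field -sumrB; apply: eq_bigr => i _; by rewrite !mxE scalerBl.
Qed.

Lemma dotv_field v p x : dotv v (field p x) = \sum_i p ord0 i * dotv v (G i x).
Proof.
rewrite dotvC /field; elim/big_ind2 : _ => [|u1 y1 u2 y2 <- <-|i _].
- by rewrite /dotv big1// => i _; rewrite mxE mul0r.
- by rewrite dotvDl.
- by rewrite dotvZl dotvC.
Qed.

Definition galerkin_flux (p : 'rV[R]_k) : 'rV[R]_k :=
  \row_i \int[mu]_(x in D) dotv (flux (field p x)) (G i x).

Definition galerkin_energy (p : 'rV[R]_k) : R := \int[mu]_(x in D) Psi (enorm (field p x)).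

Lemma galerkin_flux_dotv p z :
  dotv (galerkin_flux p) z = \int[mu]_(x in D) dotv (flux (field p x)) (field z x).
Proof.
have sF := sqvec_flux (sqvec_field p).
transitivity (\int[mu]_(x in D) \sum_i z ord0 i * dotv (flux (field p x)) (G i x)); last first.
  by apply: eq_Rintegral => x _; rewrite dotv_field.
have ii i : mu.-integrable D (EFin \o (fun x => dotv (flux (field p x)) (G i x))) by exact: integrable_dotv.
rewrite (Rintegral_sum mD) => [|i]; last exact: (integrableZl mD (z ord0 i) (ii i)).
apply: eq_bigr => i _; rewrite mxE mulrC RintegralZl//.
Qed.

(** The convexity of [forch_Psi] under the integral: [galerkin_flux] is the gradient
    of [galerkin_energy]. *)
Lemma galerkin_convex p q :
  dotv (galerkin_flux p) (q - p) <= galerkin_energy q - galerkin_energy p.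
Proof.
have sF := sqvec_flux (sqvec_field p).
have ip := integrable_Psi (sqvec_field p); have iq := integrable_Psi (sqvec_field q).
rewrite galerkin_flux_dotv /galerkin_energy -RintegralB//; apply: le_Rintegral => //.
- exact: integrable_dotv sF (sqvec_field _).
- exact: (integrableB mD iq ip).
by move=> x Dx; rewrite -fieldB; exact: (fluxv_convex H).
Qed.

Lemma galerkin_energy_le p : galerkin_energy p <= dotv (galerkin_flux p) p.
Proof.
rewrite galerkin_flux_dotv; apply: le_Rintegral => //.
- exact: integrable_Psi (sqvec_field _).
- exact: integrable_dotv (sqvec_flux (sqvec_field p)) (sqvec_field _).
by move=> x Dx; rewrite (dotv_fluxv H); apply: (forch_Psi_le H); exact: enorm_ge0.
Qed.

Lemma galerkin_energy_ge p : dotv (galerkin_flux p) p <= 2 * galerkin_energy p.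
Proof.
have ip := integrable_Psi (sqvec_field p).
rewrite galerkin_flux_dotv -RintegralZl//; apply: le_Rintegral => //.
- exact: integrable_dotv (sqvec_flux (sqvec_field p)) (sqvec_field _).
- exact: (integrableZl mD 2 ip).
move=> x Dx; rewrite (dotv_fluxv H); have := forch_Psi_ge H (enorm_ge0 (field p x)); lra.
Qed.

(** The dependence of this constant on the basis is harmless, as it serves only to
    differentiate the energy along the flow. *)
Definition galerkin_lip : R :=
  \sum_(i < k) (3 / a0 * (\sum_j nm mu D (fun x => enorm (G j x))) * nm mu D (fun x => enorm (G i x))).

Lemma galerkin_lip_ge0 : 0 <= galerkin_lip.
Proof.
apply: sumr_ge0 => i _; rewrite mulr_ge0 ?nm_ge0// mulr_ge0 ?divr_ge0 ?(ltW (coef0_gt0 H))//.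
by apply: sumr_ge0 => j _; exact: nm_ge0.
Qed.

Lemma nm_field z : nm mu D (fun x => enorm (field z x)) <=
  enorm z * \sum_j nm mu D (fun x => enorm (G j x)).
Proof.
pose g x := \sum_j enorm z * enorm (G j x).
have sg : sqint mu D g by apply: (sqint_sum mD) => j; exact: (sqint_enorm mD (sG j)).
apply: (@le_trans _ _ (nm mu D g)).
  have se := sqint_enorm mD (sqvec_field z).
  rewrite /nm ler_sqrt ?ip_ge0//; apply: le_Rintegral => //.
  - exact: (sqint_mul mD se se).
  - exact: (sqint_mul mD sg sg).
  have h x : enorm (field z x) <= g x.
    rewrite /g /field; elim/big_ind2 : _ => [|u1 y1 u2 y2 h1 h2|j _].
    - by rewrite enorm0.
    - by apply: le_trans (enormD _ _) _; exact: lerD.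
    - by rewrite enormZ ler_wpM2r ?enorm_ge0//; exact: coord_le_enorm.
  by move=> x Dx; apply: ler_pM => //; exact: enorm_ge0.
rewrite /g mulr_sumr.
elim: (index_enum 'I_k) => [|j s IH].
  rewrite big_nil; under eq_fun do rewrite big_nil.
  by rewrite /nm (ip0l _ mD) sqrtr0.
rewrite big_cons.
have s1 : sqint mu D (fun x => enorm z * enorm (G j x)) by exact: (sqint_scale mD _ (sqint_enorm mD (sG j))).
have s2 : sqint mu D (fun x => \sum_(i <- s) enorm z * enorm (G i x)).
  by apply: (sqint_sum mD) => i; exact: (sqint_enorm mD (sG i)).
have := nmD mD s1 s2; rewrite (nmZ mD)//; last exact: (sqint_enorm mD (sG j)).
rewrite ger0_norm ?enorm_ge0// => h.
under eq_fun do rewrite big_cons.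
by apply: le_trans h _; rewrite lerD2l.
Qed.

Lemma galerkin_lipschitz p q :
  enorm (galerkin_flux q - galerkin_flux p) <= galerkin_lip * enorm (q - p).
Proof.
have L0 : 0 < 3 / a0 by rewrite divr_gt0// (coef0_gt0 H).
apply: le_trans (enorm_le_sum _) _; rewrite /galerkin_lip mulr_suml; apply: ler_sum => i _.
have sq := sqvec_flux (sqvec_field q); have sp := sqvec_flux (sqvec_field p).
have iq := integrable_dotv sq (sG i); have ip_ := integrable_dotv sp (sG i).
rewrite rowBE !mxE -RintegralB//.
have sz := sqint_enorm mD (sqvec_field (q - p)); have sg := sqint_enorm mD (sG i).
apply: (@le_trans _ _ (3 / a0 * ip mu D (fun x => enorm (field (q - p) x)) (fun x => enorm (G i x)))).
  apply: le_trans (le_normr_Rintegral mD _) _; first exact: (integrableB mD iq ip_).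
  have im := sqint_mul mD sz sg.
  rewrite /ip -RintegralZl//; apply: le_Rintegral => //.
  - by have := integrable_abse (integrableB mD iq ip_); apply: eq_integrable.
  - exact: (integrableZl mD (3 / a0) im).
  move=> x Dx; rewrite -dotvBl mulrA -fieldB.
  apply: (@le_trans _ _ (enorm (flux (field q x) - flux (field p x)) * enorm (G i x))).
    rewrite ler_norml dotv_le andbT lerNl -dotvNl.
    by apply: le_trans (dotv_le _ _) _; rewrite enormN.
  by rewrite ler_wpM2r ?enorm_ge0//; exact: (fluxv_lip H).
set S := \sum_j _; set g := nm mu D _; rewrite (_ : _ * _ * g * _ = 3 / a0 * (enorm (q - p) * S * g)); last by ring.
rewrite ler_pM2l//; apply: le_trans (le_trans (ler_norm _) (ip_le mD sz sg)) _.
by rewrite ler_wpM2r ?nm_ge0//; exact: nm_field.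
Qed.

End galerkin_energy.

(** * Differentiation in time *)

Section time_dependence.
Context (R : realType) (n : nat) (Omega : set 'rV[R]_n).
Hypothesis oO : open Omega.
Local Notation mu := (lebesgue_rowvec R n).
Local Notation mO := (open_measurable_rowvec oO).
Local Notation sqi := (sqint mu Omega).
Local Notation nrm := (nm mu Omega).
Local Notation ip := (ip mu Omega).
Implicit Types (u : R -> 'rV[R]_n -> R) (v w : 'rV[R]_n -> R).

Lemma near0_ereal (e : R) : 0 < e -> nbhs (0%E : \bar R) [set y | (y < e%:E)%E].
Proof.
move=> e0; rewrite /nbhs /= /ereal_nbhs /=.
apply/nbhs_ballP; exists e => //= y; rewrite /ball/= sub0r normrN lte_fin.
exact: le_lt_trans (ler_norm _).
Qed.

Lemma cvge_within0 (f : R -> \bar R) (t : R) :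
  f s @[s --> within `[0, +oo[ (nbhs t)] --> 0%E ->
  forall e, 0 < e -> exists2 del, 0 < del & forall s, 0 <= s -> `|s - t| < del -> (f s < e%:E)%E.
Proof.
move=> h e e0; have /nbhs_ballP[del /= del0 hd] := h _ (near0_ereal e0).
exists del => // s s0 st; apply: (hd s); last by rewrite /= in_itv/= andbT.
by rewrite /ball/= distrC.
Qed.

Lemma cvge_within0' (f : R -> \bar R) (t : R) :
  f s @[s --> within `[0, +oo[ (t^')] --> 0%E ->
  forall e, 0 < e -> exists2 del, 0 < del &
    forall s, 0 <= s -> s != t -> `|s - t| < del -> (f s < e%:E)%E.
Proof.
move=> h e e0; have /nbhs_ballP[del /= del0 hd] := h _ (near0_ereal e0).
exists del => // s s0 snt st; apply: (hd s) => //; last by rewrite /= in_itv/= andbT.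
by rewrite /ball/= distrC.
Qed.

(** The data are given for t >= 0 only; precomposed with t |-> max t 0 they are
    continuous on the whole line. *)
Lemma continuous_max0 (g : R -> R) :
  (forall t e, 0 <= t -> 0 < e -> exists2 del, 0 < del &
    forall s, 0 <= s -> `|s - t| < del -> `|g s - g t| < e) ->
  continuous (fun t : R => g (Num.max t 0)).
Proof.
move=> h t; apply/cvgrPdist_lt => e e0.
have t0 : 0 <= Num.max t 0 by rewrite le_max lexx orbT.
have [del del0 hd] := h _ _ t0 e0.
apply/nbhs_ballP; exists del => //= s; rewrite /ball/= distrC => st.
rewrite distrC; apply: hd; first by rewrite le_max lexx orbT.
apply: le_lt_trans st; rewrite /Num.max; case: ifPn => h1; case: ifPn => h2 //.
- by rewrite subrr normr0.
- rewrite sub0r normrN; move: h1 h2; rewrite -leNgt => h1 h2.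
  have st0 : s - t <= 0 by lra.
  by rewrite ger0_norm// ler0_norm//; lra.
- rewrite subr0; move: h1 h2; rewrite -leNgt => h1 h2.
  have st0 : 0 <= s - t by lra.
  by rewrite !ger0_norm//; lra.
Qed.

Lemma L2continuous_ip u w : (forall t, 0 <= t -> sqi (u t)) -> sqi w ->
  L2continuous Omega u -> continuous (fun t : R => ip (u (Num.max t 0)) w).
Proof.
move=> su sw cu; apply: (@continuous_max0 (fun t => ip (u t) w)) => t e t0 e0.
have w0 : 0 < nrm w + 1 by rewrite ltr_wpDl// nm_ge0.
have [|del del0 hd] := cvge_within0 (cu t t0) (e := e / (nrm w + 1)); first exact: divr_gt0.
exists del => // s s0 st; have := hd s s0 st.
have sd := sqint_sub mO (su s s0) (su t t0).
rewrite (Lqnorm2_nm oO sd) lte_fin ltr_pdivlMr// => lt.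
rewrite -(ipBl mO)//; [|exact: su|exact: su].
apply: le_lt_trans (ip_le mO sd sw) _; apply: le_lt_trans lt.
by rewrite ler_wpM2l ?nm_ge0// lerDl.
Qed.

Lemma L2derive_ip u t v w : (forall t, 0 <= t -> sqi (u t)) -> sqi v -> sqi w -> 0 <= t ->
  L2derive Omega u t v -> forall e, 0 < e -> exists2 del, 0 < del &
  forall s, 0 <= s -> s != t -> `|s - t| < del ->
    `|(s - t)^-1 * (ip (u s) w - ip (u t) w) - ip v w| < e.
Proof.
move=> su sv sw t0 du e e0.
have w0 : 0 < nrm w + 1 by rewrite ltr_wpDl// nm_ge0.
have [|del del0 hd] := cvge_within0' du (e := e / (nrm w + 1)); first exact: divr_gt0.
exists del => // s s0 snt st; have := hd s s0 snt st.
have s1 := sqint_sub mO (su s s0) (su t t0).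
have s2 := sqint_scale mO (s - t)^-1 s1; have s3 := sqint_sub mO s2 sv.
rewrite (Lqnorm2_nm oO s3) lte_fin ltr_pdivlMr// => lt.
rewrite -(ipBl mO)//; [|exact: su|exact: su]; rewrite -(ipZl mO)// -(ipBl mO)//.
apply: le_lt_trans (ip_le mO s3 sw) _; apply: le_lt_trans lt.
by rewrite ler_wpM2l ?nm_ge0// lerDl.
Qed.

Lemma L2derive_continuous u u' w : (forall t, 0 <= t -> sqi (u t)) -> (forall t, 0 <= t -> sqi (u' t)) ->
  sqi w -> (forall t, 0 <= t -> L2derive Omega u t (u' t)) ->
  continuous (fun t : R => ip (u (Num.max t 0)) w).
Proof.
move=> su su' sw du; apply: (@continuous_max0 (fun t => ip (u t) w)) => t e t0 e0.
have [del del0 hd] := L2derive_ip su (su' t t0) sw t0 (du t t0) ltr01.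
set l := ip (u' t) w in hd; have l0 : 0 < `|l| + 1 by rewrite ltr_wpDl.
exists (Num.min del (e / (`|l| + 1))); first by rewrite lt_min del0 divr_gt0.
move=> s s0; rewrite lt_min ltr_pdivlMr// => /andP[sd se].
have [->|snt] := eqVneq s t; first by rewrite subrr normr0.
have st0 : s - t != 0 by rewrite subr_eq0.
apply: le_lt_trans se; rewrite -[X in `|X|](mulKf st0) mulrCA normrM ler_wpM2l//.
set q := _^-1 * _.
have -> : q = l + (q - l) by ring.
by apply: le_trans (ler_normD _ _) _; rewrite lerD2l ltW//; exact: hd.
Qed.

Lemma L2derive_is_derive u t v w : (forall t, 0 <= t -> sqi (u t)) -> sqi v -> sqi w -> 0 < t ->
  L2derive Omega u t v -> is_derive t (1 : R) (fun t : R => ip (u (Num.max t 0)) w) (ip v w).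
Proof.
move=> su sv sw t0 du; apply/is_derive1P; apply/cvgrPdist_lt => e e0.
have [del del0 hd] := L2derive_ip su sv sw (ltW t0) du e0.
near=> h.
have h0 : h != 0 by near: h; exact: nbhs_dnbhs_neq.
have hdel : `|h| < del by near: h; exact: dnbhs0_lt.
have ht : `|h| < t by near: h; exact: dnbhs0_lt.
have s0 : 0 < h + t by move: ht; rewrite ltr_norml => /andP[]; lra.
have := hd (h + t) (ltW s0); rewrite addrK -subr_eq0 addrK => /(_ h0 hdel).
by rewrite !max_l ?(ltW s0) ?(ltW t0)// distrC.
Unshelve. all: by end_near. Qed.

End time_dependence.

(** * The semidiscrete problem in coordinates *)

Section gradients_of_combinations.
Context (R : realType) (n : nat) (Omega : set 'rV[R]_n).
Hypothesis oO : open Omega.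
Local Notation mu := (lebesgue_rowvec R n).
Local Notation mO := (open_measurable_rowvec oO).
Local Notation sqi := (sqint mu Omega).
Local Notation H1 := (sobolev Omega 1 2%:E).

Lemma is_wderiv_ae al (u u' v : 'rV[R]_n -> R) : loc_integrable Omega u' -> ae_eq mu Omega u u' ->
  is_wderiv Omega al u v -> is_wderiv Omega al u' v.
Proof.
move=> lu' uu [lu lv h]; split=> // theta th; rewrite -h//.
have [c _] := test_pderivs (flatten [seq nseq (al i) i | i <- enum 'I_n]) th.
have mt : measurable_fun Omega (mi_pderiv al theta).
  by apply: measurable_funTS; exact: continuous_measurable_rowvec.
apply: (Rintegral_ae mO).
- by apply: measurable_funM mt; case: lu'.
- by apply: measurable_funM mt; case: lu.
by apply: filterS uu => x e Ox; rewrite e.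
Qed.

Lemma wgrad_ae (u u' : 'rV[R]_n -> R) : H1 u -> H1 u' -> ae_eq mu Omega u u' ->
  ae_eq mu Omega (wgrad Omega u) (wgrad Omega u').
Proof.
move=> hu hu' uu.
have h : \forall x \ae mu, forall i : 'I_n, Omega x ->
    wderiv Omega (mi_unit i) u' x = wderiv Omega (mi_unit i) u x.
  apply: filter_forall => i; apply: wderiv_ae => //.
  apply: is_wderiv_ae uu _; first by apply: sqint_loc_integrable => //; exact: sobolev_sqint hu'.
  by have [] := sobolev_wd oO i hu.
by apply: filterS h => x h Ox; apply/rowP => i; rewrite !wgradE h.
Qed.

Lemma sobolev_sum (I : Type) (s : seq I) (a : I -> R) (w : I -> 'rV[R]_n -> R) v :
  H1 v -> (forall i, H1 (w i)) ->
  H1 (fun x => \sum_(i <- s) a i * w i x) /\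
  ae_eq mu Omega (wgrad Omega (fun x => \sum_(i <- s) a i * w i x))
    (fun x => \sum_(i <- s) a i *: wgrad Omega (w i) x).
Proof.
move=> hv hw; elim: s => [|i s [IH1 IH2]].
  have E : (fun x => \sum_(i <- [::]) a i * w i x) = fun x => 0 * v x + 0 * v x.
    by apply/funext => x; rewrite big_nil !mul0r addr0.
  rewrite E; split; first exact: sobolev_lin.
  apply: filterS (wgrad_lin oO 0 0 hv hv) => x h Ox.
  by rewrite h// big_nil !scale0r addr0.
have E : (fun x => \sum_(i <- i :: s) a i * w i x) =
    fun x => a i * w i x + 1 * \sum_(i <- s) a i * w i x.
  by apply/funext => x; rewrite big_cons mul1r.
rewrite E; split; first exact: sobolev_lin.
apply: filterS2 IH2 (wgrad_lin oO (a i) 1 (hw i) IH1) => x h1 h2 Ox.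
by rewrite h2// h1// big_cons scale1r.
Qed.

End gradients_of_combinations.

Section semidiscrete_flow.
Context (R : realType) (m : nat).
Local Notation n := m.+2.
Context (Omega : set 'rV[R]_n).
Hypotheses (oO : open Omega) (bO : bounded_set Omega).
Context (N : nat) (coef expo : 'I_N.+1 -> R).
Hypothesis H : forch_polynomial coef expo.
Context (C0 : R) (C00 : 0 < C0).
Local Notation mu := (lebesgue_rowvec R n).
Local Notation mO := (open_measurable_rowvec oO).
Local Notation sqi := (sqint mu Omega).
Local Notation nrm := (nm mu Omega).
Local Notation ip := (ip mu Omega).
Local Notation H1 := (sobolev Omega 1 2%:E).
Local Notation h1norm := (h1norm Omega).
Local Notation be := (forch_beta expo).
Local Notation a0 := (coef ord0).
Local Notation flux := (fluxv coef expo).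
Context (Th : triangulation Omega) (r : nat) (proj : ('rV[R]_n -> R) -> 'rV[R]_n -> R)
  (f phi phit : R -> 'rV[R]_n -> R) (rho0 : 'rV[R]_n -> R) (rt : R -> 'rV[R]_n -> R).
Local Notation W := (fespace Th r).
Hypothesis projP : L2projection Omega W proj.
Hypothesis stab : projection_stable Omega proj C0.
Hypothesis data : regular_data Omega f phi phit rho0.
Hypothesis sol : semidiscrete_solution Omega coef expo W proj f phi phit rho0 rt.
Context (k : nat) (w : 'I_k -> 'rV[R]_n -> R).
Hypothesis ow : orthonormal_family Th r w.
Hypothesis basis : forall v, W v -> ae_eq mu Omega v (fun x => \sum_i ip v (w i) * w i x).

Local Notation Doo := (Omega_lty oO bO).
Let Ww i : W (w i) := ow.1 i.
Let G i x := wgrad Omega (w i) x.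
Let coord (v : 'rV[R]_n -> R) : 'rV[R]_k := \row_i ip v (w i).

Lemma sqint_Lq1 v : sqi v -> Lqspace Omega 1%:E v.
Proof.
move=> sv; split; first exact: sqint_measurable sv.
rewrite LqnormE ?oner_eq0// invr1 poweRe1; last by apply: integral_ge0 => x _; rewrite lee_fin powR_ge0.
have /integrableP[_] := sqint_integrable mO Doo sv.
by congr (_ < _)%E; apply: eq_integral => x _; rewrite powRr1.
Qed.

Lemma proj_fespace v : sqi v -> W (proj v).
Proof. by move=> /sqint_Lq1/projP[]. Qed.

Lemma coord_proj v : sqi v -> coord (proj v) = coord v.
Proof.
move=> /sqint_Lq1/projP[_ h]; apply/rowP => i; rewrite !mxE.
by have := h _ (Ww i).
Qed.

Let sG i : sqvec mu Omega (G i).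
Proof. by move=> j; apply: sqint_wgrad_coord => //; exact: fespace_sobolev (Ww i). Qed.

(** Only almost everywhere, as the weak gradients are chosen for each function
    separately. *)
Lemma wgrad_coord v : W v -> ae_eq mu Omega (wgrad Omega v) (field G (coord v)).
Proof.
move=> Wv; have hv := fespace_sobolev Wv.
have [h1 h2] := sobolev_sum oO (index_enum 'I_k) (fun i => ip v (w i)) hv (fun i => fespace_sobolev (Ww i)).
apply: filterS2 (wgrad_ae oO hv h1 (basis Wv)) h2 => x e1 e2 Ox.
rewrite e1// e2//; apply: eq_bigr => i _; by rewrite mxE.
Qed.

Lemma wgrad_proj v : sqi v -> ae_eq mu Omega (wgrad Omega (proj v)) (field G (coord v)).
Proof. by move=> sv; rewrite -coord_proj//; apply: wgrad_coord; exact: proj_fespace. Qed.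

Lemma enorm_coord v : W v -> enorm (coord v) = nrm v.
Proof.
move=> Wv; have sv := fespace_sqint oO Wv.
have sw i : sqi (w i) by exact: fespace_sqint.
apply/eqP; rewrite -(eqrXn2 (_ : 0 < 2)%N (enorm_ge0 _) (nm_ge0 _ _ _))//; apply/eqP.
rewrite sqr_enorm sqr_nm.
transitivity (ip (fun x => \sum_i ip v (w i) * w i x) v).
  by rewrite (ip_sum mO)//; apply: eq_bigr => i _; rewrite !mxE (ipC _ _ (w i)).
have ss : sqi (fun x => \sum_i ip v (w i) * w i x) by exact: (sqint_sum mO).
apply: (ip_ae mO (sqint_measurable ss) (sqint_measurable sv) (sqint_measurable sv) (sqint_measurable sv)) => //.
  by apply: filterS (basis Wv) => x e Ox; rewrite -e.
exact: ae_eq_refl.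
Qed.

(** Testing the definition of proj v with proj v itself. *)
Lemma bessel v : sqi v -> enorm (coord v) <= nrm v.
Proof.
move=> sv; rewrite -coord_proj// enorm_coord; last exact: proj_fespace.
have Wp := proj_fespace sv; have sp := fespace_sqint oO Wp.
have [p0|pn] := eqVneq (nrm (proj v)) 0; first by rewrite p0 nm_ge0.
have pp : 0 < nrm (proj v) by rewrite lt_neqAle eq_sym pn nm_ge0.
rewrite -(ler_pM2r pp) -expr2 sqr_nm.
have [_ h] := projP (sqint_Lq1 sv).
have -> : ip (proj v) (proj v) = ip v (proj v) by exact: h.
exact: le_trans (ler_norm _) (ip_le mO sv sp).
Qed.

Lemma h1norm_proj v : H1 v -> h1norm (proj v) <= C0 * h1norm v.
Proof.
move=> hv; have sv := sobolev_sqint oO hv.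
have hp := fespace_sobolev (proj_fespace sv).
by have := stab (leqnn 1) hv; rewrite !sobnorm_h1norm// -EFinM lee_fin.
Qed.

Lemma nm_field_coord v : H1 v ->
  nrm (fun x => enorm (field G (coord v) x)) ^+ 2 <= n%:R * C0 ^+ 2 * h1norm v ^+ 2.
Proof.
move=> hv; have sv := sobolev_sqint oO hv; have hp := fespace_sobolev (proj_fespace sv).
have -> : nrm (fun x => enorm (field G (coord v) x)) = nrm (fun x => enorm (wgrad Omega (proj v) x)).
  apply: (nm_ae mO).
  - exact: sqint_measurable (sqint_enorm mO (sqvec_field mO sG _)).
  - exact: sqint_measurable (sqint_grad oO hp).
  by apply: filterS (wgrad_proj sv) => x e Ox; rewrite e.
apply: le_trans (nm_grad_le oO hp) _; rewrite -mulrA ler_wpM2l// -exprMn.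
by rewrite lerXn2r ?nnegrE ?h1norm_ge0 ?mulr_ge0 ?h1norm_ge0 ?(ltW C00)//; exact: h1norm_proj.
Qed.

Let sqf t : 0 <= t -> sqi (f t).
Proof. by case: data => _ h _ _ _ /h[/Lqspace2P]. Qed.
Let hphi t : 0 <= t -> H1 (phi t).
Proof. by case: data => _ h _ _ _ /h[]. Qed.
Let hphit t : 0 <= t -> H1 (phit t).
Proof. by case: data => _ h _ _ _ /h[]. Qed.
Let dphi t : 0 <= t -> L2derive Omega phi t (phit t).
Proof. by case: data => _ h _ _ _ /h[]. Qed.
Let Wrt t : 0 <= t -> W (rt t).
Proof. by case: sol => h _ _ _ /h. Qed.
Let sphi t : 0 <= t -> sqi (phi t).
Proof. by move=> /hphi; exact: sobolev_sqint. Qed.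
Let sphit t : 0 <= t -> sqi (phit t).
Proof. by move=> /hphit; exact: sobolev_sqint. Qed.
Let srt t : 0 <= t -> sqi (rt t).
Proof. by move=> /Wrt; exact: fespace_sqint. Qed.

(** The coordinates are frozen for negative times, which makes them continuous on
    the whole line and changes nothing for t >= 0. *)
Definition flow_y (t : R) : 'rV[R]_k := coord (rt (Num.max t 0)).
Definition flow_z (t : R) : 'rV[R]_k := coord (phi (Num.max t 0)).
Definition flow_F (t : R) : 'rV[R]_k := coord (f (Num.max t 0) \- phit (Num.max t 0)).
Definition flow_zeta (t : R) : 'rV[R]_k := coord (phit (Num.max t 0)).
Definition rho_h (t : R) := rt t \+ proj (phi t).
Definition flow_D (t : R) : R := \int[mu]_(x in Omega) (enorm (wgrad Omega (rho_h t) x) `^ be).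
Definition flow_ft (t : R) : R := nrm (f t \- phit t).
Definition flow_Phi := galerkin_flux mu Omega coef expo G.
Definition flow_J := galerkin_energy mu Omega coef expo G.

Lemma rho_h_fespace t : 0 <= t -> W (rho_h t).
Proof.
move=> t0; have := fespace_lin oO 1 1 (Wrt t0) (proj_fespace (sphi t0)).
by congr (W _); apply/funext => x; rewrite !mul1r.
Qed.

Lemma coord_rho_h t : 0 <= t -> coord (rho_h t) = flow_y t + flow_z t.
Proof.
move=> t0; rewrite /flow_y /flow_z max_l// -(coord_proj (sphi t0)).
apply/rowP => i; rewrite !mxE -(ipDl mO)//; first exact: srt.
- exact: fespace_sqint (proj_fespace (sphi t0)).
- exact: fespace_sqint.
Qed.

Lemma wgrad_rho_h t : 0 <= t ->
  ae_eq mu Omega (wgrad Omega (rho_h t)) (field G (flow_y t + flow_z t)).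
Proof. by move=> t0; rewrite -coord_rho_h//; apply: wgrad_coord; exact: rho_h_fespace. Qed.

Lemma sqint_rho_h t : 0 <= t -> sqi (fun x => enorm (wgrad Omega (rho_h t) x)).
Proof. by move=> /rho_h_fespace/fespace_sobolev; exact: sqint_grad. Qed.

Lemma flow_DE t : 0 <= t ->
  flow_D t = \int[mu]_(x in Omega) (enorm (field G (flow_y t + flow_z t) x) `^ be).
Proof.
move=> t0; apply: (Rintegral_ae mO).
- apply: (measurableT_comp (measurable_powR _)); exact: sqint_measurable (sqint_rho_h t0).
- apply: (measurableT_comp (measurable_powR _)).
  exact: sqint_measurable (sqint_enorm mO (sqvec_field mO sG _)).
by apply: filterS (wgrad_rho_h t0) => x e Ox; rewrite e.
Qed.

Lemma gradnormE t : 0 <= t -> (gradnorm Omega be (rho_h t) `^ be = (flow_D t)%:E)%E.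
Proof.
move=> t0; have be1 := forch_beta_gt1 H; have be0 : 0 < be by exact: lt_trans be1.
rewrite /gradnorm LqnormE ?gt_eqF// -poweRrM mulVf ?gt_eqF// poweRe1; last first.
  by apply: integral_ge0 => x _; rewrite lee_fin powR_ge0.
have ig := powR_integrable mO Doo (sqint_rho_h t0) (fun=> enorm_ge0 _) be0 (ltW (forch_beta_lt2 H)).
rewrite /flow_D /Rintegral (fineK (integrable_fin_num mO ig)); apply: eq_integral => x _.
by rewrite ger0_norm ?enorm_ge0.
Qed.

Lemma flow_equation (t : R) i : 0 < t -> is_derive t (1 : R) (fun t : R => flow_y t ord0 i)
  (flow_F t ord0 i - flow_Phi (flow_y t + flow_z t) ord0 i).
Proof.
move=> t0; have t0' := ltW t0; have [_ _ _ /(_ t t0)[rtt [Wrtt drt eq_]]] := sol.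
have sw := fespace_sqint oO (Ww i).
have -> : (fun t => flow_y t ord0 i) = (fun t => ip (rt (Num.max t 0)) (w i)).
  by apply/funext => s; rewrite mxE.
have -> : flow_F t ord0 i - flow_Phi (flow_y t + flow_z t) ord0 i = ip rtt (w i).
  apply/eqP; rewrite subr_eq; apply/eqP; rewrite /flow_F max_l// mxE.
  have := eq_ _ (Ww i); rewrite !inner_ip => <-; congr (_ + _).
  rewrite mxE; apply: (Rintegral_ae mO).
  - have sF := sqvec_flux mO H (fun j => sqint_wgrad_coord oO j (fespace_sobolev (rho_h_fespace t0'))).
    by apply: measurable_dotv => // j; [exact: sqint_measurable (sF j)|exact: sqint_measurable (sG i j)].
  - have sF := sqvec_flux mO H (sqvec_field mO sG (flow_y t + flow_z t)).
    by apply: measurable_dotv => // j; [exact: sqint_measurable (sF j)|exact: sqint_measurable (sG i j)].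
  by apply: filterS (wgrad_rho_h t0') => x e Ox; rewrite -e.
exact: (L2derive_is_derive oO srt (fespace_sqint oO Wrtt) sw t0 drt).
Qed.

Lemma flow_z_derive (t : R) i : 0 < t ->
  is_derive t (1 : R) (fun t : R => flow_z t ord0 i) (flow_zeta t ord0 i).
Proof.
move=> t0; have t0' := ltW t0; have sw := fespace_sqint oO (Ww i).
have -> : (fun t => flow_z t ord0 i) = (fun t => ip (phi (Num.max t 0)) (w i)).
  by apply/funext => s; rewrite mxE.
rewrite /flow_zeta max_l// mxE.
exact: (L2derive_is_derive oO sphi (sphit t0') sw t0 (dphi t0')).
Qed.

Lemma flow_energy_bound del Cdel t : 0 < del -> 0 <= t ->
  (forall xi, 0 <= xi -> xi `^ be <= del / (fine (mu Omega) + 1) + Cdel * (forch_s coef expo xi * xi)) ->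
  flow_D t <= del + Cdel * dotv (flow_Phi (flow_y t + flow_z t)) (flow_y t + flow_z t).
Proof.
move=> del0 t0 hd; set p := flow_y t + flow_z t.
have sF := sqvec_field mO sG p; have M0 : 0 <= fine (mu Omega) by rewrite fine_ge0.
have isl := integrable_sl mO H sF.
have be1 := forch_beta_gt1 H; have be0 : 0 < be by exact: lt_trans be1.
pose c := del / (fine (mu Omega) + 1).
have ic : mu.-integrable Omega (EFin \o (fun=> c)).
  apply: measurable_bounded_integrable => //; [exact: mO|exact: Doo|].
  by exists `|c|; split; [exact: num_real|move=> B cB x _; exact: ltW].
rewrite flow_DE// /flow_Phi galerkin_flux_dotv//; last exact: mO.
apply: (@le_trans _ _ (\int[mu]_(x in Omega) (c +
    Cdel * (forch_s coef expo (enorm (field G p x)) * enorm (field G p x))))).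
  apply: le_Rintegral; first exact: mO.
  - exact: (powR_integrable mO Doo (sqint_enorm mO sF) (fun=> enorm_ge0 _) be0 (ltW (forch_beta_lt2 H))).
  - exact: (integrableD mO ic (integrableZl mO Cdel isl)).
  by move=> x _; apply: hd; exact: enorm_ge0.
rewrite (RintegralD mO ic (integrableZl mO Cdel isl)) (RintegralZl Cdel mO isl).
rewrite Rintegral_cst; last exact: mO.
apply: lerD.
  rewrite /c mulrAC ler_pdivrMr ?ltr_wpDl// ler_pM2l//.
  by rewrite lerDl.
rewrite le_eqVlt; apply/orP; left; apply/eqP; congr (_ * _).
by apply: eq_Rintegral => x _; rewrite (dotv_fluxv H).
Qed.

(** [flux_absorb] for the gradient of proj v, which the stability of the projection
    bounds by the H^1 norm of v. *)
Lemma flow_absorb t v : 0 <= t -> H1 v ->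
  dotv (flow_Phi (flow_y t + flow_z t)) (coord v) <=
  4^-1 * dotv (flow_Phi (flow_y t + flow_z t)) (flow_y t + flow_z t) +
  (n%:R * C0 ^+ 2 / a0 + 1) * h1norm v ^+ 2.
Proof.
move=> t0 hv; have sF := sqvec_field mO sG; have a00 := coef0_gt0 H.
rewrite /flow_Phi !(galerkin_flux_dotv mO H sG).
apply: le_trans (flux_absorb mO H (sF _) (sF _)) _; rewrite lerD2l.
apply: (@le_trans _ _ (a0^-1 * (n%:R * C0 ^+ 2 * h1norm v ^+ 2))).
  by apply: ler_wpM2l; [rewrite invr_ge0 ltW|exact: nm_field_coord].
have := sqr_ge0 (h1norm v).
have -> : a0^-1 * (n%:R * C0 ^+ 2 * h1norm v ^+ 2) = n%:R * C0 ^+ 2 / a0 * h1norm v ^+ 2 by ring.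
by move=> s2; rewrite (mulrDl (n%:R * C0 ^+ 2 / a0) 1) mul1r lerDl.
Qed.

(** The initial condition makes y + z at time 0 the coordinates of rho0, so that the
    initial energy involves rho0 alone. *)
Lemma flow_J0_le : flow_J (flow_y 0 + flow_z 0) <= n%:R * C0 ^+ 2 / a0 * h1norm rho0 ^+ 2.
Proof.
have h0 : H1 rho0 by case: data.
have s0 := sobolev_sqint oO h0; have a00 := coef0_gt0 H.
have -> : flow_y 0 + flow_z 0 = coord rho0.
  case: sol => _ _ rt0 _; rewrite /flow_y /flow_z maxxx rt0.
  have sd : sqi (rho0 \- phi 0) by exact: (sqint_sub mO s0 (sphi (lexx 0))).
  rewrite coord_proj//; apply/rowP => i; rewrite !mxE (ipBl mO)//; [|exact: sphi|exact: fespace_sqint (Ww i)].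
  by rewrite subrK.
have sF := sqvec_field mO sG (coord rho0).
apply: le_trans (galerkin_energy_le mO H sG _) _.
rewrite (galerkin_flux_dotv mO H sG); apply: le_trans (dissipation_le mO H sF) _.
apply: (@le_trans _ _ (a0^-1 * (n%:R * C0 ^+ 2 * h1norm rho0 ^+ 2))).
  by apply: ler_wpM2l; [rewrite invr_ge0 ltW|exact: nm_field_coord].
by rewrite le_eqVlt; apply/orP; left; apply/eqP; ring.
Qed.

Lemma flow_y0_le : enorm (flow_y 0) ^+ 2 <= 2 * (h1norm rho0 ^+ 2 + nrm (phi 0) ^+ 2).
Proof.
have h0 : H1 rho0 by case: data.
have s0 := sobolev_sqint oO h0; have sp := sphi (lexx 0).
have sd : sqi (rho0 \- phi 0) by exact: (sqint_sub mO s0 sp).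
have : enorm (flow_y 0) <= h1norm rho0 + nrm (phi 0).
  case: sol => _ _ rt0 _; rewrite /flow_y maxxx rt0 coord_proj//.
  apply: le_trans (bessel sd) _; apply: le_trans (nmB mO s0 sp) _.
  by rewrite lerD2r; exact: nm_le_h1norm0.
have := enorm_ge0 (flow_y 0); have := h1norm_ge0 Omega rho0; have := nm_ge0 mu Omega (phi 0).
move: (enorm _) (h1norm rho0) (nrm (phi 0)) => x y z z0 y0 x0 h.
have : x ^+ 2 <= (y + z) ^+ 2 by rewrite lerXn2r ?nnegrE ?addr_ge0.
by have := sqr_ge0 (y - z); rewrite !expr2; nra.
Qed.

Lemma flow_gradient_flow Cemb (Cd : R -> R) : 0 < Cemb ->
  (forall v, H10 Omega v -> nrm v <= Cemb * (\int[mu]_(x in Omega) (enorm (wgrad Omega v x) `^ be)) `^ be^-1) ->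
  (forall del, 0 < del -> forall xi, 0 <= xi ->
     xi `^ be <= del / (fine (mu Omega) + 1) + Cd del * (forch_s coef expo xi * xi)) ->
  gradient_flow be (n%:R * C0 ^+ 2 / a0 + 1) (Cemb + C0) (galerkin_lip mu Omega coef G) Cd
    flow_Phi flow_J flow_y flow_z flow_F flow_zeta flow_D flow_ft (fun t => h1norm (phi t)) (fun t => h1norm (phit t)).
Proof.
move=> Cemb0 emb growth; have [_ _ cf cphit _] := data; have [_ crt _ _] := sol.
have sw i := fespace_sqint oO (Ww i).
split.
- exact: (galerkin_convex mO H sG).
- exact: (galerkin_energy_le mO H sG).
- exact: (galerkin_energy_ge mO H sG).
- by move=> p; rewrite /flow_Phi (galerkin_flux_dotv mO H sG); exact: dissipation_ge0.
- exact: (galerkin_lipschitz mO H sG).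
- by move=> t _; apply: Rintegral_ge0 => x _; exact: powR_ge0.
- by move=> t _; exact: nm_ge0.
- by move=> t _; exact: h1norm_ge0.
- by move=> t _; exact: h1norm_ge0.
- by move=> del t del0 t0; apply: flow_energy_bound => //; exact: growth.
- move=> t t0; rewrite /flow_y max_l// enorm_coord; last exact: Wrt.
  have Wr := rho_h_fespace t0; have Wp := proj_fespace (sphi t0).
  have sr := fespace_sqint oO Wr; have sp := fespace_sqint oO Wp.
  have -> : rt t = fun x => rho_h t x - proj (phi t) x by apply/funext => x; rewrite /rho_h /= addrK.
  apply: le_trans (nmB mO sr sp) _.
  have h1 := emb _ (fespace_H10 Wr); rewrite -/(flow_D t) in h1.
  have h2 := le_trans (nm_le_h1norm0 oO sp) (h1norm_proj (hphi t0)).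
  have D0 : 0 <= flow_D t `^ be^-1 by exact: powR_ge0.
  have := h1norm_ge0 Omega (phi t); move: h1 h2; have C00' := C00.
  move: (nrm _) (nrm _) (h1norm _) (flow_D t `^ be^-1) D0 => a b c e e0; nra.
- move=> t t0; have E : flow_z t = coord (phi t) by rewrite /flow_z max_l.
  by have := flow_absorb t0 (hphi t0); rewrite -E.
- by move=> t t0; have := flow_absorb t0 (hphit t0); rewrite /flow_zeta max_l.
- move=> t v t0; rewrite /flow_F max_l//.
  have sd : sqi (f t \- phit t) by exact: (sqint_sub mO (sqf t0) (sphit t0)).
  apply: le_trans (dotv_le _ _) _; rewrite ler_wpM2r ?enorm_ge0//.
  exact: bessel.
- move=> i; rewrite (_ : (fun _ => _) = fun t : R => ip (rt (Num.max t 0)) (w i)).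
    exact: L2continuous_ip.
  by apply/funext => t; rewrite mxE.
- move=> i; rewrite (_ : (fun _ => _) = fun t : R => ip (phi (Num.max t 0)) (w i)).
    exact: (L2derive_continuous oO sphi sphit (sw i) dphi).
  by apply/funext => t; rewrite mxE.
- move=> i; rewrite (_ : (fun _ => _) = fun t : R =>
    ip (f (Num.max t 0)) (w i) + -1 * ip (phit (Num.max t 0)) (w i)).
    apply: continuous_add; first exact: L2continuous_ip.
    apply: continuous_mul; first exact: cst_continuous.
    exact: L2continuous_ip.
  apply/funext => t; have t0 : 0 <= Num.max t 0 by rewrite le_max lexx orbT.
  by rewrite mxE (ipBl mO)// ?mulN1r//; [exact: sqf|exact: sphit].
- move=> i; rewrite (_ : (fun _ => _) = fun t : R => ip (phit (Num.max t 0)) (w i)).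
    exact: L2continuous_ip.
  by apply/funext => t; rewrite mxE.
- by move=> i t; exact: flow_equation.
- by move=> i t; exact: flow_z_derive.
Qed.

End semidiscrete_flow.

(** * Upper limits and the final estimates *)

Section limsup_at_infinity.
Context (R : realType).
Implicit Types F : R -> \bar R.
Local Open Scope ereal_scope.

Lemma limsup_oo_lt F c : limsup_oo F < c -> exists2 T : R, (0 <= T)%R & forall t, (T <= t)%R -> F t <= c.
Proof.
move=> /ereal_inf_lt[_ [A [M [Mr MA]] <-] Ac].
exists (Num.max M 0 + 1)%R; first by rewrite addr_ge0// le_max lexx orbT.
move=> t Mt; apply: le_trans (ltW Ac); apply: ereal_sup_ubound; exists t => //; apply: MA.
by apply: lt_le_trans Mt; rewrite (@le_lt_trans _ _ (Num.max M 0))%R ?le_max ?lexx// ltrDl.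
Qed.

Lemma limsup_oo_le F c (T : R) : (forall t, (T <= t)%R -> F t <= c) -> limsup_oo F <= c.
Proof.
move=> h; apply: (@le_trans _ _ (ereal_sup (F @` [set t | (T < t)%R]))).
  by apply: ereal_inf_lbound; eexists => //; exists T; split => //; exact: num_real.
by apply: ge_ereal_sup => _ [t Tt <-]; apply: h; exact: ltW.
Qed.

Lemma limsup_oo_ge0 F : (forall t, 0 <= F t) -> 0 <= limsup_oo F.
Proof.
by move=> F0; apply: limf_esup_ge0 => // -[M [_ h]].
Qed.

Lemma limsup_oo_eq0 F : (forall t, 0 <= F t) ->
  limsup_oo F = 0 <-> forall e : R, (0 < e)%R -> exists2 T : R, (0 <= T)%R & forall t, (T <= t)%R -> F t <= e%:E.
Proof.
move=> F0; split => [F00 e e0|h].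
  by apply: limsup_oo_lt; rewrite F00 lte_fin.
apply/eqP; rewrite eq_le limsup_oo_ge0// andbT.
apply/lee_addgt0Pr => e e0; have [T _ hT] := h _ e0.
by rewrite add0e; exact: limsup_oo_le hT.
Qed.

End limsup_at_infinity.

Theorem theorem4p2 (R : realType) (d : nat) (Omega : set 'rV[R]_d)
    (N : nat) (coef expo : 'I_N.+1 -> R) (C0 C1 sigma : R) :
  (2 <= d)%N -> open Omega -> bounded_set Omega -> smooth_boundary Omega ->
  forch_polynomial coef expo -> forch_a expo <= 4 / (d%:R + 2) ->
  0 < C0 -> 0 < C1 -> 0 < sigma ->
  exists2 C : R, 0 < C &
  forall (Th : triangulation Omega) (r : nat)
         (proj : ('rV[R]_d -> R) -> 'rV[R]_d -> R)
         (f phi phit : R -> 'rV[R]_d -> R) (rho0 : 'rV[R]_d -> R)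
         (rt : R -> 'rV[R]_d -> R),
  quasiuniform Th sigma ->
  L2projection Omega (fespace Th r) proj ->
  projection_stable Omega proj C0 ->
  projection_approx Omega proj (meshsize Th) r C1 ->
  regular_data Omega f phi phit rho0 ->
  semidiscrete_solution Omega coef expo (fespace Th r) proj
    f phi phit rho0 rt ->
  let rho_h t := rt t \+ proj (phi t) in
  let beta := forch_beta expo in
  let g := data_g Omega expo f phi phit in
  [/\ forall Env : R -> R, is_envelope g Env -> forall t, 0 <= t ->
        (gradnorm Omega beta (rho_h t) `^ beta <=
         C%:E * bound_A Omega expo phi phit rho0 Env t)%E,
      (limsup_oo (fun t => gradnorm Omega beta (rho_h t) `^ beta) <=
       C%:E * (1 + limsup_oo (fun t => sobnorm Omega 1 2%:E (phit t) ^+ 2) +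
               limsup_oo g `^ (2 / beta)))%E &
      limsup_oo (fun t => Lqnorm Omega 2%:E (f t \- phit t)%R) = 0%E ->
      limsup_oo (fun t => sobnorm Omega 1 2%:E (phi t)) = 0%E ->
      limsup_oo (fun t => sobnorm Omega 1 2%:E (phit t)) = 0%E ->
      limsup_oo (fun t => gradnorm Omega beta (rho_h t)) = 0%E].
Proof.
case: d Omega => [|[|m]]// Omega _ oO bO _ H deg C00 _ _.
set n := m.+2 in Omega oO bO deg *.
have mO := open_measurable_rowvec oO.
pose mu := lebesgue_rowvec R n.
have be1 := forch_beta_gt1 H; have be2 := forch_beta_lt2 H.
have la2 := forch_lambda_ge2 H; have bl := forch_conjugate H; have a00 := coef0_gt0 H.
pose be := forch_beta expo; pose lam := forch_lambda expo.
have be0 : 0 < be by exact: lt_trans be1.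
(* The Degree Condition, with d = m + 2. *)
have beq : 2 * (m%:R + 2) / (m%:R + 4) <= be.
  have m0 : 0 <= m%:R :> R by rewrite ler0n.
  have nE : n%:R = m%:R + 2 :> R by rewrite /n -addn2 natrD.
  rewrite nE in deg; rewrite /be /forch_beta.
  have -> : 2 * (m%:R + 2) / (m%:R + 4) = 2 - 4 / (m%:R + 2 + 2) :> R by field; lra.
  lra.
have [Cemb Cemb0 emb] := H10_embedding oO bO be1 be2 beq.
have M0 : 0 <= fine (mu Omega) by rewrite fine_ge0.
(* The factor 1 / (|Omega| + 1) makes the integral of the additive constant at
   most del. *)
have /choice[Cd hCd] : forall del : R, exists Cdel : R, 0 < Cdel /\ (0 < del -> forall xi, 0 <= xi ->
    xi `^ be <= del / (fine (mu Omega) + 1) + Cdel * (forch_s coef expo xi * xi)).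
  move=> del; have [del0|ndel] := ltP 0 del; last by exists 1; split=> // /lt_geF; rewrite ndel.
  have c0 : 0 < del / (fine (mu Omega) + 1) by rewrite divr_gt0// ltr_wpDl.
  have p0 : 0 < (del / (fine (mu Omega) + 1)) `^ be^-1 by exact: powR_gt0.
  have [Cdel Cdel0 hC] := forch_growth H p0; exists Cdel; split => // _ xi xi0.
  by apply: le_trans (hC _ xi0) _; rewrite powRVK ?gt_eqF// ltW.
pose Cp := n%:R * C0 ^+ 2 / coef ord0 + 1.
have q0 : 0 <= n%:R * C0 ^+ 2 / coef ord0.
  by rewrite divr_ge0 ?(ltW a00)// mulr_ge0 ?sqr_ge0// ler0n.
have Cp0 : 0 < Cp by rewrite /Cp ltr_wpDl.
have Cs0 : 0 < Cemb + C0 by rewrite addr_gt0.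
have [C Cpos est] := gradient_flow_estimates be1 be2 la2 bl Cp0 Cs0 (fun del _ => (hCd del).1).
(* K bounds the initial energies by the norms of rho0 and phi 0; the factor
   2 + 2^qe comes from replacing upper limits by slightly larger bounds. *)
pose K := 2 + n%:R * C0 ^+ 2 / coef ord0.
pose qe := 2 / be.
have qe0 : 0 < qe by rewrite divr_gt0.
have K1 : 1 <= K by rewrite /K; lra.
have K0 : 0 < K by exact: lt_le_trans K1.
pose C2 := C * (2 + 2 `^ qe).
have p2 : 0 <= 2 `^ qe :> R by exact: powR_ge0.
have C20 : 0 < C2 by rewrite mulr_gt0// ltr_pwDl.
exists (C * K + C2); first by rewrite addr_gt0// mulr_gt0.
move=> Th r proj f phi phit rho0 rt _ projP stab _ data sol rho beta g.
have [k [w [ow basis]]] : exists k (w : 'I_k -> 'rV[R]_n -> R), orthonormal_family Th r w /\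
    forall v, fespace Th r v -> ae_eq mu Omega v (fun x => \sum_i ip mu Omega v (w i) * w i x).
  by case: sol => /(_ 0 (lexx 0)) W0 _ _ _; exact: orthonormal_basis W0.
have GF := flow_gradient_flow oO bO H C00 projP stab data sol ow basis Cemb0 emb
  (fun del => (hCd del).2).
have [est1 est2 est3] := est _ _ _ _ _ _ _ _ _ _ _ _ (galerkin_lip_ge0 _ _ H _) GF.
have hphi t : 0 <= t -> sobolev Omega 1 2%:E (phi t).
  by case: data => _ h _ _ _ /h[].
have hphit t : 0 <= t -> sobolev Omega 1 2%:E (phit t).
  by case: data => _ h _ _ _ /h[].
have sphit t : 0 <= t -> sqint mu Omega (phit t) by move=> /hphit; exact: sobolev_sqint.
have sd t : 0 <= t -> sqint mu Omega (f t \- phit t).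
  move=> t0; have h := sphit t t0; case: data => _ /(_ t t0)[/Lqspace2P sf _ _ _] _ _ _.
  exact: (sqint_sub mO sf h).
have DE t : 0 <= t -> (gradnorm Omega beta (rho t) `^ beta = (flow_D Omega expo proj phi rt t)%:E)%E.
  by move=> t0; exact: (gradnormE oO bO H projP data sol t0).
have gE t : 0 <= t -> g t = (flow_ft Omega f phit t `^ lam + h1norm Omega (phi t) ^+ 2)%:E.
  move=> t0; rewrite /g /data_g (sobnorm_h1norm oO (hphi _ t0)) (Lqnorm2_nm oO (sd _ t0)).
  by rewrite poweR_EFin -EFin_expe -EFinD.
have sob0 u : (0 <= sobnorm Omega 1 2%:E u)%E by exact: poweR_ge0.
have g0 t : (0 <= g t)%E by rewrite /g /data_g adde_ge0 ?poweR_ge0// expe_ge0.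
split.
- move=> Env [cE Emono Eg] t t0; rewrite DE//.
  have mE : measurable_fun (`[0, t]%classic : set R) Env.
    apply: (@subspace_continuous_measurable_fun R `[0, t]%classic Env) => //.
    apply: continuous_subspaceW cE => s /=; rewrite !in_itv/= andbT.
    by move=> /andP[].
  have mp : measurable_fun (`[0, t]%classic : set R) (fun s => h1norm Omega (phit s)).
    case: data => _ _ _ _ mp.
    apply: (eq_measurable_fun (fine \o (fun s => sobnorm Omega 1 2%:E (phit s)))).
      move=> s; rewrite inE /= in_itv/= => /andP[s0 _].
      exact: (congr1 fine (sobnorm_h1norm oO (hphit _ s0))).
    apply: measurableT_comp; first exact: fine_measurable.
    apply: measurable_funS mp => // s /=; rewrite !in_itv/= andbT.
    by move=> /andP[].
  have Eg' s : 0 <= s -> flow_ft Omega f phit s `^ lam + h1norm Omega (phi s) ^+ 2 <= Env s.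
    by move=> s0; have := Eg s s0; rewrite gE// lee_fin.
  apply: le_trans (est1 Env t t0 Emono Eg' mE mp) _; rewrite /bound_A.
  have h0 : sobolev Omega 1 2%:E rho0 by case: data.
  have sp0 : sqint mu Omega (phi 0) by exact: sobolev_sqint (hphi _ (lexx 0)).
  rewrite (sobnorm_h1norm oO h0) (Lqnorm2_nm oO sp0) -!EFin_expe.
  set I1 := (\int[_]_(s in _) _)%E; set I2 := (X in (_ <= _ * (_ + X))%E).
  have -> : I2 = I1.
    apply: eq_integral => s sI.
    have s0 : 0 <= s by move: sI; rewrite inE /= in_itv/= => /andP[].
    by rewrite (sobnorm_h1norm oO (hphit _ s0)) -EFin_expe -EFinD -EFinM.
  have I0 : (0 <= I1)%E.
    apply: integral_ge0 => s _; rewrite lee_fin mulr_ge0 ?expR_ge0// addr_ge0 ?sqr_ge0//.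
    exact: powR_ge0.
  have y0 := flow_y0_le oO bO projP data sol ow basis.
  have J0 := flow_J0_le oO bO H C00 projP stab data sol ow basis.
  rewrite -!EFinD.
  set A := (X in (X%:E + I1)%E); set B := (X in (_ <= _ * (X%:E + _))%E).
  have AB : A <= K * B.
    rewrite /A /B /K; move: J0 y0 (sqr_ge0 (h1norm Omega rho0)) (sqr_ge0 (nm mu Omega (phi 0))) q0.
    move: (flow_J _ _ _ _ _) (enorm _ ^+ 2) (h1norm Omega rho0 ^+ 2) (nm mu Omega (phi 0) ^+ 2).
    move: (n%:R * C0 ^+ 2 / coef ord0) => q J y a b hJ hy a0 b0 q0'.
    by have := mulr_ge0 q0' b0; nra.
  have B0 : 0 <= B by rewrite !addr_ge0 ?sqr_ge0.
  apply: (@le_trans _ _ ((C * K)%:E * (B%:E + I1))%E); last first.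
    apply: lee_wpmul2r; last by rewrite lee_fin lerDl ltW.
    by rewrite adde_ge0// lee_fin.
  rewrite EFinM -muleA; apply: lee_wpmul2l; first by rewrite lee_fin ltW.
  rewrite ge0_muleDr ?lee_fin// -EFinM; apply: leeD; first by rewrite lee_fin.
  by apply: lee_pemull => //; rewrite lee_fin.
- have P0 : (0 <= limsup_oo (fun t => sobnorm Omega 1 2%:E (phit t) ^+ 2))%E.
    by apply: limsup_oo_ge0 => t; exact: expe_ge0.
  have G0 : (0 <= limsup_oo g)%E by exact: limsup_oo_ge0.
  set P := limsup_oo (fun t => sobnorm Omega 1 2%:E (phit t) ^+ 2)%E in P0 *.
  set G := limsup_oo g in G0 *.
  have CC0 : 0 < C * K + C2 by rewrite addr_gt0// mulr_gt0.
  have [Poo|Pfin] := eqVneq P +oo%E.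
    rewrite Poo addey// addye; last by rewrite gt_eqF// (lt_le_trans _ (poweR_ge0 _ _))// ltNyr.
    by rewrite gt0_muley ?leey// lte_fin.
  have [Goo|Gfin] := eqVneq G +oo%E.
    rewrite Goo poweRyr ?gt_eqF// addey; last by rewrite gt_eqF// (lt_le_trans (ltNyr 0))// adde_ge0.
    by rewrite gt0_muley ?leey// lte_fin.
  have [p PE] : exists p, P = p%:E by exists (fine P); rewrite fineK// ge0_fin_numE// ltey.
  have [gg GE] : exists gg, G = gg%:E by exists (fine G); rewrite fineK// ge0_fin_numE// ltey.
  rewrite PE GE !lee_fin in P0 G0 *.
  (* The data are eventually below their upper limits plus 1, and the constant
     term of the estimate absorbs the excess. *)
  have [T1 T10 hT1] : exists2 T : R, 0 <= T & forall t, T <= t -> (sobnorm Omega 1 2%:E (phit t) ^+ 2 <= (p + 1)%:E)%E.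
    by apply: limsup_oo_lt; rewrite -/P PE lte_fin ltrDl.
  have [T2 T20 hT2] : exists2 T : R, 0 <= T & forall t, T <= t -> (g t <= (gg + 1)%:E)%E.
    by apply: limsup_oo_lt; rewrite -/G GE lte_fin ltrDl.
  have T0 : 0 <= Num.max T1 T2 by rewrite le_max T10.
  have [||t hg|t hp|T3 T3T hT3] := est2 (gg + 1) (p + 1) (Num.max T1 T2) T0.
  + by rewrite addr_ge0.
  + by rewrite addr_ge0.
  + have t0 := le_trans T0 hg; rewrite ge_max in hg; case/andP: hg => _ hg.
    by have := hT2 _ hg; rewrite gE// lee_fin.
  + have t0 := le_trans T0 hp; rewrite ge_max in hp; case/andP: hp => hp _.
    by have := hT1 _ hp; rewrite (sobnorm_h1norm oO (hphit _ t0)) -EFin_expe lee_fin.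
  apply: (limsup_oo_le (T := T3)) => t T3t; have t0 := le_trans (le_trans T0 T3T) T3t.
  rewrite DE// poweR_EFin -!EFinD -EFinM lee_fin; apply: le_trans (hT3 _ T3t) _.
  rewrite -/qe; have g2 : (gg + 1) `^ qe <= 2 `^ qe * (1 + gg `^ qe).
    by have := powRD_le ler01 G0 (ltW qe0); rewrite powR1 [1 + gg]addrC.
  have gq : 0 <= gg `^ qe by exact: powR_ge0.
  have CK0 : 0 <= C * K by rewrite mulr_ge0 ?ltW.
  apply: (@le_trans _ _ (C2 * (1 + p + gg `^ qe))); last first.
    by rewrite ler_wpM2r ?lerDr// !addr_ge0.
  rewrite /C2 -mulrA ler_pM2l//; move: p2 g2 gq; move: (2 `^ qe) ((gg + 1) `^ qe) (gg `^ qe) => a e x b h x0.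
  by have := mulr_ge0 b P0; nra.
- move=> l1 l2 l3.
  have grad0 t : (0 <= gradnorm Omega beta (rho t))%E by exact: Lnorm_ge0.
  apply/(limsup_oo_eq0 grad0) => e e0.
  have L0 t : (0 <= Lqnorm Omega 2%:E (f t \- phit t)%R)%E by exact: Lnorm_ge0.
  move/(limsup_oo_eq0 L0) : l1 => l1.
  move/(limsup_oo_eq0 (fun t => sob0 (phi t))) : l2 => l2.
  move/(limsup_oo_eq0 (fun t => sob0 (phit t))) : l3 => l3.
  have ebe : 0 < e `^ be by exact: powR_gt0.
  have [|||T T0 hT] := est3 _ _ _ _ ebe.
  + move=> e' e'0; have [T T0 hT] := l1 _ e'0; exists T => // t Tt.
    by have := hT _ Tt; rewrite (Lqnorm2_nm oO (sd _ (le_trans T0 Tt))) lee_fin.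
  + move=> e' e'0; have [T T0 hT] := l2 _ e'0; exists T => // t Tt.
    by have := hT _ Tt; rewrite (sobnorm_h1norm oO (hphi _ (le_trans T0 Tt))) lee_fin.
  + move=> e' e'0; have [T T0 hT] := l3 _ e'0; exists T => // t Tt.
    by have := hT _ Tt; rewrite (sobnorm_h1norm oO (hphit _ (le_trans T0 Tt))) lee_fin.
  exists T => // t Tt; have t0 := le_trans T0 Tt.
  have -> : gradnorm Omega beta (rho t) = ((flow_D Omega expo proj phi rt t) `^ be^-1)%:E.
    rewrite -poweR_EFin -DE// -poweRrM mulfV ?gt_eqF// poweRe1//.
  have eE : (e `^ be) `^ be^-1 = e by rewrite -powRrM mulfV ?gt_eqF// powRr1// ltW.
  rewrite lee_fin -eE.
  apply: powR_mono (hT _ Tt); first by rewrite invr_ge0 ltW.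
  by apply: Rintegral_ge0 => x _; exact: powR_ge0.
Qed.
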